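(* Let $p\ge 8$ be an even integer, let $F$ be a $2$-connected graph, and let $v,z\in V(F)$ be distinct. Suppose that $d_F(v)\ge 5$ and that $d_F(w)\ge p$ for every $w\in V(F)\setminus\{v,z\}$. Then there are distinct vertices $x,y\in N_F(v)$ and an even integer $\ell$ such that $F$ contains cycles $D_0,D_1,\ldots,D_{(p-8)/2}$ with $vx,vy\in E(D_i)$ and $|D_i|=\ell+2i$ for every $0\le i\le (p-8)/2$.
   Context: Graphs are finite and simple. $d_F(w)$ is the degree of $w$ in $F$, $N_F(v)$ is the set of neighbours of $v$, and $|D|$ denotes the length (number of vertices) of a cycle $D$. *)

(* Defs.v *)
From mathcomp Require Import all_boot.

Set Implicit Arguments.
Unset Strict Implicit.
Unset Printing Implicit Defensive.

Section Graphs.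

Variables (T : finType) (e : rel T).

Definition simple_graph : Prop := symmetric e /\ irreflexive e.

Definition nbhd (v : T) : {set T} := [set w | e v w].

Definition degree (v : T) : nat := #|nbhd v|.

(* The edge relation of the graph with the vertices of X deleted. *)
Definition delete (X : {set T}) : rel T :=
  [rel x y | [&& x \notin X, y \notin X & e x y]].

(* Only pairs outside X matter: in [delete X] the vertices of X remain in the
   carrier as isolated points. *)
Definition connected_without (X : {set T}) : Prop :=
  forall x y : T, x \notin X -> y \notin X -> connect (delete X) x y.

(* More than k vertices, and no separating set with fewer than k vertices. *)
Definition k_connected (k : nat) : Prop :=
  k < #|T| /\ forall X : {set T}, #|X| < k -> connected_without X.

(* A cycle is given by the sequence of its vertices in cyclic order, without
   repetition, so its length is [size D].  The bound on the size is needed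
   since [ucycleb] accepts the empty sequence and both ends of a single edge. *)
Definition is_cycle (D : seq T) : bool := (2 < size D) && ucycleb e D.

End Graphs.

(* [next D u] is u itself when u does not occur in D, hence the membership
   conditions. *)
Definition cycle_edge (T : finType) (D : seq T) (u w : T) : bool :=
  ((u \in D) && (next D u == w)) || ((w \in D) && (next D w == u)).

(* Main.v *)
Require Import Defs.
From mathcomp Require Import all_boot zify.

Set Implicit Arguments.
Unset Strict Implicit.
Unset Printing Implicit Defensive.

(* Write p = 2k + 6; the cycles wanted are v followed by paths with b, b + 2, ...,
   b + 2(k - 1) vertices between two neighbours of v, with b odd.

   The engine is a statement on bipartite graphs, proved by induction: if every
   vertex has degree more than k (entries N and exits E each count as one) and
   every part cut off by one vertex meets N or E, then there are k paths from N to
   E whose lengths, corrected by labels on E, form an arithmetic progression of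
   difference 2.  Take a complete bipartite subgraph (A0, B0), B0 in N,
   #|A0| < #|B0|, with A0 as large as possible: it provides #|A0| + 1 consecutive
   lengths, and outside of it every vertex loses so few neighbours that the
   induction hypothesis supplies the others.

   A maximal cut keeps half of every degree, so that large degrees produce either
   the cycles or an end block of a bipartite subgraph avoiding v, in which any two
   vertices are joined by k such paths (a lump).  Three disjoint paths from v to a
   lump suffice: two of them have the same parity relative to the bipartition.
   Otherwise the lump lies in a set with two boundary vertices; let Y be a maximal
   one.  The vertices outside Y still have large degree, so there is a second lump
   beyond Y, in a set Y' almost disjoint from Y.  By maximality of Y, three
   disjoint paths lead from v to the boundaries of Y and Y'.  Together with Y, Y'
   and an augmenting path they contain three paths from v to some vertex, disjoint
   but for their ends, two of which run through Y and Y'; two of the three agree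
   in parity, and their union has the required lengths. *)

(** The constant p = 2k + 6 is a sum of losses. The engine needs degree k + 1; one more is spent on
    [v], when paths between two of its neighbours are sought in a component without it, or on the
    cut vertex of an end block, whose own degree is not controlled. The cut therefore starts from 2k
    + 3, half of which, rounded up, is k + 2. The last 3 pay for [z] and the two boundary vertices
    of Y, which the search for the second lump leaves out.

    The engine rests on two exchanges. A vertex of a remaining piece that has lost neighbours
    becomes an entry or an exit of that piece, which gives back a unit. And lengths add like
    sumsets: k' lengths in the piece and m in the biclique give k' + m - 1 together, so the piece
    may lose about as much degree as the biclique gains. The balance is delicate when the biclique
    holds the exits and must give up vertices to the end of the path, or when A0 has one vertex and
    leaves no room to vary. Labels record that exits of a piece may continue differently; they sit
    on exits only, so some pieces are traversed backwards. *)

(** * Paths and connectivity *)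

(* [lia] is slow when boolean facts about sets are in the context. *)
Ltac nlia :=
  repeat match goal with H : ?P |- _ =>
    lazymatch P with
    | is_true (leq _ _) => fail
    | @eq nat _ _ => fail
    | nat => fail
    | _ => clear H
    end
  end;
  change (nat_of_bool true) with 1; change (nat_of_bool false) with 0;
  repeat match goal with |- context [nat_of_bool ?b] =>
    let x := fresh "b" in let lx := fresh "lb" in
    have lx := leq_b1 b; move: lx; generalize (nat_of_bool b) => x lx end;
  intros; lia.

Lemma disjP (T : finType) (A B : {set T}) :
  (forall t, t \in A -> t \notin B) -> [disjoint A & B].
Proof. by move=> H; rewrite disjoints_subset; apply/subsetP => t /H; rewrite inE. Qed.

Section Paths.

Variables (T : finType) (e : rel T).
Hypothesis e_sym : symmetric e.
Implicit Types (S A B K : {set T}) (x y z w : T).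

(* A path is measured by its number of vertices. *)
Definition Pth S x y n :=
  exists2 p : seq T, path e x p &
    [/\ last x p = y, uniq (x :: p), {subset x :: p <= S} & size (x :: p) = n].

Lemma Pth_sub S S' x y n : S \subset S' -> Pth S x y n -> Pth S' x y n.
Proof.
move=> /subsetP sub [p ep [lp up sp np]]; exists p => //; split=> // w /sp; exact: sub.
Qed.

Lemma Pth1 S x : x \in S -> Pth S x x 1.
Proof. by move=> xS; exists [::] => //; split=> // w; rewrite inE => /eqP->. Qed.

Lemma Pth_in S x y n : Pth S x y n -> x \in S /\ y \in S.
Proof.
case=> p ep [<- _ sp _]; split; apply: sp; first exact: mem_head.
exact: mem_last.
Qed.

Lemma Pth_pos S x y n : Pth S x y n -> 0 < n.
Proof. by case=> p _ [_ _ _ <-]. Qed.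

Lemma Pth_cat S1 S2 x y z w n m : [disjoint S1 & S2] -> e y z ->
  Pth S1 x y n -> Pth S2 z w m -> Pth (S1 :|: S2) x w (n + m).
Proof.
move=> dis eyz [p ep [lp up sp <-]] [q eq [lq uq sq <-]].
exists (p ++ z :: q); first by rewrite cat_path lp /= eyz ep.
split.
- by rewrite last_cat.
- rewrite -cat_cons cat_uniq; apply/and3P; split=> //; apply/hasPn => t /sq tS2.
  apply: contraL dis => /sp tS1; apply/pred0Pn; exists t; exact/andP.
- by move=> t; rewrite -cat_cons mem_cat => /orP[/sp|/sq] tS; rewrite inE tS ?orbT.
- by rewrite -cat_cons size_cat.
Qed.

Lemma Pth_sym S x y n : Pth S x y n -> Pth S y x n.
Proof.
case=> p ep [lp up sp <-]; exists (rev (belast x p)).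
  by rewrite -lp rev_path; apply: sub_path ep => a b; rewrite e_sym.
have E : y :: rev (belast x p) = rev (x :: p) by rewrite [in RHS]lastI rev_rcons lp.
split.
- have := congr1 (last y) E; rewrite /= => ->; by rewrite rev_cons last_rcons.
- by rewrite E rev_uniq.
- by move=> t; rewrite E mem_rev => /sp.
- by rewrite E size_rev.
Qed.

(** Both paths count the common vertex [y], hence the predecessor. *)
Lemma Pth_join S1 S2 x y z n m : S1 :&: S2 \subset [set y] ->
  Pth S1 x y n -> Pth S2 y z m -> Pth (S1 :|: S2) x z (n + m).-1.
Proof.
move=> /subsetP dis P1 [q eq [lq uq sq <-]].
case: q eq lq uq sq => [|z' q] /=.
  move=> _ <- _ _; rewrite addn1 /=; apply: Pth_sub P1; exact: subsetUl.
move=> /andP[eyz eq] lq /andP[yq uq] sq; rewrite addnS.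
have P2 : Pth (S2 :\ y) z' z (size q).+1.
  exists q => //; split=> // t tq; rewrite in_setD1; apply/andP; split.
    by apply: contraNneq yq => <-.
  by apply: sq; rewrite inE tq orbT.
suff /Pth_cat H : [disjoint S1 & S2 :\ y].
  apply: Pth_sub (H _ _ _ _ _ _ eyz P1 P2); apply: setUS; exact: subD1set.
rewrite disjoint_sym disjoints_subset; apply/subsetP => t; rewrite !inE => /andP[ty t2].
by apply: contra ty => t1; rewrite -in_set1 dis // inE t1.
Qed.

Lemma Pth2 x y : x != y -> e x y -> Pth [set x; y] x y 2.
Proof.
move=> xy exy; apply: (Pth_cat (n := 1) (m := 1) _ exy); try by apply: Pth1; rewrite set11.
by apply: disjP => t /set1P->; rewrite in_set1.
Qed.

(* Stating connectivity through absorbing sets avoids walks altogether. *)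
Definition absorbs K S := forall w y, w \in K -> y \in S -> e w y -> y \in K.

Definition connected S := forall A, A \subset S -> A != set0 -> absorbs A S -> S \subset A.

Lemma connected_Pth S x y : connected S -> x \in S -> y \in S -> exists n, Pth S x y n.
Proof.
move=> cS xS yS.
pose r := [rel a b | [&& a \in S, b \in S & e a b]].
pose A := [set w in S | connect r x w].
have: S \subset A.
  apply: cS.
  - by apply/subsetP => w; rewrite inE => /andP[].
  - by apply/set0Pn; exists x; rewrite inE xS connect0.
  - move=> w z; rewrite !inE => /andP[wS xw] zS ewz; rewrite zS /=.
    apply: connect_trans xw _; apply: connect1; exact/and3P.
move=> /subsetP/(_ y yS); rewrite inE => /andP[_ /connectP[p0 rp0 lp0]].
case: (shortenP rp0) lp0 => p rp up _ lp.
exists (size (x :: p)), p; first by apply: sub_path rp => a b /and3P[].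
split=> // t; rewrite inE => /predU1P[-> //|tp].
elim: p (x) rp {up lp} tp => //= b p IH a /andP[/and3P[_ bS _] rp].
by rewrite inE => /predU1P[->//|]; apply: IH rp.
Qed.

Definition component S u :=
  [set w in S | connect [rel a b | [&& a \in S, b \in S & e a b]] u w].

Lemma component_conn S u : u \in S ->
  [/\ component S u \subset S, u \in component S u, absorbs (component S u) S & connected (component S u)].
Proof.
rewrite /component; set r := [rel a b | _] => uS.
have rsym : connect_sym r.
  apply: sym_connect_sym => a b /=; rewrite e_sym; by case: (a \in S); case: (b \in S).
set K := [set w in S | _].
have cK : absorbs K S.
  move=> w z; rewrite !inE => /andP[wS xw] zS ewz; rewrite zS /=.
  apply: connect_trans xw _; apply: connect1; exact/and3P.
split=> //.
- by apply/subsetP => w; rewrite inE => /andP[].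
- by rewrite inE uS connect0.
- move=> A AK /set0Pn[a aA] cA; apply/subsetP => w.
  have := subsetP AK a aA; rewrite !inE => /andP[aS ua] /andP[wS uw].
  have aw : connect r a w by rewrite (connect_trans _ uw) // rsym.
  case/connectP: aw => p rp ->{w wS uw}.
  elim: p a aA rp {aS ua} => //= b p IH a aA /andP[/and3P[aS bS eab] rp].
  apply: (IH b) => //; apply: (cA a) => //; apply: (cK a) => //; exact: (subsetP AK).
Qed.

Lemma component_ex S u : u \in S ->
  exists K, [/\ K \subset S, u \in K, absorbs K S & connected K].
Proof. by exists (component S u); apply: component_conn. Qed.

Definition nbr_set B : {set T} := [set w | [exists b in B, e w b]].

Lemma nbr_setP B w : reflect (exists2 b, b \in B & e w b) (w \in nbr_set B).
Proof. by rewrite inE; apply: (iffP exists_inP). Qed.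

Lemma mem_nbr_set B w y : y \in B -> e w y -> w \in nbr_set B.
Proof. by move=> yB ewy; apply/nbr_setP; exists y. Qed.

Lemma nbr_set1 b w : (w \in nbr_set [set b]) = e w b.
Proof.
apply/nbr_setP/idP => [[c /set1P->]//|ewb]; by exists b; rewrite ?set11.
Qed.

Definition deg S w := #|[set y in S | e w y]|.

(** The degree estimates of the induction are instances: surviving neighbours go into [K], lost ones
    into [R]. *)
Lemma deg_cover S K (R : {set T}) w : (forall y, y \in S -> e w y -> (y \in K) || (y \in R)) ->
  deg S w <= deg K w + deg R w.
Proof.
move=> H; apply: leq_trans (leq_card_setU _ _); apply: subset_leq_card.
apply/subsetP => y; rewrite !inE => /andP[yS ewy]; by rewrite ewy !andbT; apply: H.
Qed.

Lemma degU A B w : deg (A :|: B) w <= deg A w + deg B w.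
Proof. by apply: deg_cover => y; rewrite inE. Qed.

Lemma deg1 b w : deg [set b] w = e w b.
Proof.
rewrite /deg; case eb: (e w b).
  by rewrite (_ : [set y in _ | _] = [set b]) ?cards1 //; apply/setP=> y; rewrite !inE andbC;
     case: eqP => [->|]; rewrite ?eb ?andbF.
apply/eqP; rewrite cards_eq0; apply/eqP/setP => y; rewrite !inE.
by case: eqP => //= ->.
Qed.

Lemma deg0 S w : (forall y, y \in S -> ~~ e w y) -> deg S w = 0.
Proof.
move=> H; apply/eqP; rewrite cards_eq0; apply/eqP/setP => y; rewrite !inE.
by apply/negP => /andP[/H/negbTE->].
Qed.

Lemma deg_nbr_set B w : (w \in nbr_set B) = (0 < deg B w).
Proof.
rewrite card_gt0; apply/nbr_setP/set0Pn => [[b bB ewb]|[b]]; first by exists b; rewrite inE bB.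
by rewrite inE => /andP[bB ewb]; exists b.
Qed.

Lemma deg_le S w : deg S w <= #|S|.
Proof. by apply: subset_leq_card; apply/subsetP => y; rewrite inE => /andP[]. Qed.

End Paths.

(** * Families of paths of lengths in progression *)

Section Instances.

Variables (T : finType) (e : rel T) (col : T -> bool).
Hypothesis e_sym : symmetric e.
Hypothesis e_col : forall x y, e x y -> col x != col y.
Implicit Types (S A B K D M N E : {set T}) (x y z w u d : T).

(* lam w is the number of vertices that a fixed continuation beyond w adds. *)
Definition path_family S N E (lam : T -> nat) k := exists b, forall i, i < k ->
  exists u w n, [/\ u \in N, w \in E, Pth e S u w n & n + lam w = b + 2 * i].

(** A pocket is a nonempty union of components of S - d; it may be all of S - d. *)
Definition pocket S d A := [&& d \in S, A \subset S, d \notin A, A != set0 &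
  [forall w in A, forall y in S, e w y ==> (y \in A) || (y == d)]].

Definition hits_pockets S M := [forall d, forall A : {set T}, pocket S d A ==> ~~ [disjoint A & M]].

Lemma pocketP S d A : reflect [/\ d \in S, A \subset S, d \notin A, A != set0 &
  forall w y, w \in A -> y \in S -> e w y -> (y \in A) \/ y = d] (pocket S d A).
Proof.
apply: (iffP and5P) => -[-> -> -> -> H]; split=> //.
  move=> w y wA yS ewy; move/forall_inP: H => /(_ w wA)/forall_inP/(_ y yS).
  by rewrite ewy /= => /orP[|/eqP]; [left|right].
apply/forall_inP => w wA; apply/forall_inP => y yS; apply/implyP => ewy.
by case: (H w y wA yS ewy) => [->|->]; rewrite ?eqxx ?orbT.
Qed.

Lemma sepP S M d A : hits_pockets S M -> pocket S d A -> exists2 w, w \in A & w \in M.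
Proof.
move=> /forallP/(_ d)/forallP/(_ A)/implyP H /H /pred0Pn[w /andP[]]; by exists w.
Qed.

(** Passing to a component makes the offending pocket connected, and it touches [d] because [S] is
    connected. *)
Lemma sepPn S M : connected e S -> ~~ hits_pockets S M -> exists d A,
  [/\ pocket S d A, connected e A, forall w, w \in A -> w \notin M & exists2 w, w \in A & e w d].
Proof.
move=> cS; rewrite negb_forall => /existsP[d]; rewrite negb_forall => /existsP[A].
rewrite negb_imply negbK => /andP[/pocketP[dS AS dA /set0Pn[a aA] cA] dis].
have [K [KA aK cK coK]] := component_ex e_sym aA.
have pK w y : w \in K -> y \in S -> e w y -> (y \in K) \/ y = d.
  move=> wK yS ewy; case: (cA w y (subsetP KA _ wK) yS ewy) => [yA|->]; [left|by right].
  exact: cK ewy.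
have dK : d \notin K by apply: contra dA => /(subsetP KA).
exists d, K; split=> //.
- apply/pocketP; split=> //; first exact: subset_trans AS.
  by apply/set0Pn; exists a.
- move=> w /(subsetP KA) wA; apply/negP => wM; move/pred0P/(_ w): dis.
  by rewrite /= wA wM.
- have [/existsP[w /andP[]]|/existsPn H] := boolP [exists w, (w \in K) && e w d]; first by exists w.
  have /subsetP/(_ d dS) : S \subset K; last by rewrite (negbTE dK).
  apply: cS; first exact: subset_trans AS.
    by apply/set0Pn; exists a.
  move=> w y wK yS ewy; case: (pK w y wK yS ewy) => // yd.
  by have := H w; rewrite wK -yd ewy.
Qed.

(** A pocket of [D] that avoids [M'] has no edge leaving [D], so it is a pocket of [S] as well. *)
Lemma sep_sub S M D M' : hits_pockets S M -> D \subset S ->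
    (forall w, w \in D -> w \in M -> w \in M') ->
    (forall w y, w \in D -> y \in S -> y \notin D -> e w y -> w \in M') ->
  hits_pockets D M'.
Proof.
move=> sS DS HM HB; apply/forallP => d; apply/forallP => A; apply/implyP.
move=> /pocketP[dD AD dA A0 cA]; apply/negP => dis.
have nM w : w \in A -> w \notin M'.
  by move=> wA; apply/negP => wM; move/pred0P/(_ w): dis; rewrite /= wA wM.
have [|w wA wM] := sepP (d := d) (A := A) sS.
  apply/pocketP; split=> //; [exact: (subsetP DS)|exact: subset_trans DS|].
  move=> w y wA yS ewy; have wD := subsetP AD _ wA.
  case yD: (y \in D); first exact: cA ewy.
  by have := nM w wA; rewrite (HB w y) ?yD.
by have := nM w wA; rewrite HM // (subsetP AD).
Qed.

(** Whatever is linked through the pocket is linked through its cut vertex [d] already. *)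
Lemma conn_pocket S d A : connected e S -> pocket S d A -> connected e (S :\: A).
Proof.
move=> cS /pocketP[dS AS dA A0 cA] X XD X0 cX.
have XS : X \subset S by apply: subset_trans XD (subsetDl _ _).
have nXA w : w \in X -> w \notin A by move=> /(subsetP XD); rewrite inE => /andP[].
case dX: (d \in X).
  have /subsetP H : S \subset X :|: A.
    apply: cS.
    - by rewrite subUset XS.
    - by case/set0Pn: X0 => t tX; apply/set0Pn; exists t; rewrite inE tX.
    - move=> w y; rewrite !inE => /orP[wX|wA] yS ewy.
        case yA: (y \in A); rewrite ?orbT // (cX w y) ?inE ?yA //.
      by case: (cA w y wA yS ewy) => [->|->]; rewrite ?dX ?orbT.
  apply/subsetP => w; rewrite inE => /andP[wA wS].
  by move: (H w wS); rewrite inE (negbTE wA) orbF.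
have /subsetP/(_ d dS) : S \subset X; last by rewrite dX.
apply: cS => // w y wX yS ewy.
case yA: (y \in A); last by apply: (cX w) => //; rewrite inE yA.
have eyw : e y w by rewrite e_sym.
case: (cA y w yA (subsetP XS _ wX) eyw) => [wA|wd].
  by have := nXA w wX; rewrite wA.
by rewrite -wd wX in dX.
Qed.

(* The degree condition is void for k <= 1, where one path is all that is asked. *)
Record instance S N E k : Prop := Instance {
  inst_conn : connected e S;
  inst_NS : N \subset S;
  inst_ES : E \subset S;
  inst_N0 : N != set0;
  inst_E0 : E != set0;
  inst_mono : exists c, forall w, w \in N -> col w = c;
  inst_sep : hits_pockets S (N :|: E);
  inst_deg : forall w, w \in S -> 1 < k -> k < deg e S w + (w \in N) + (w \in E)
}.

Lemma fam_one S N E lam k : instance S N E k -> path_family S N E lam 1.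
Proof.
case=> cS NS ES /set0Pn[u uN] /set0Pn[w wE] _ _ _.
have [n P] := connected_Pth cS (subsetP NS _ uN) (subsetP ES _ wE).
by exists (n + lam w) => i i1; exists u, w, n; split=> //; nlia.
Qed.

(** Sumset of two progressions of step 2. The i-th length takes the family up to its last index k' -
    1 and leaves the remainder to the [m] extensions. *)
Lemma fam_lift S N E lam D N' E' lam' k' m c k :
    path_family D N' E' lam' k' -> 0 < k' -> 0 < m -> k < k' + m ->
    (forall u w n j, u \in N' -> w \in E' -> j < m -> Pth e D u w n ->
      exists x y t, [/\ x \in N, y \in E, Pth e S x y t &
                        t + lam y = n + lam' w + c + 2 * j]) ->
  path_family S N E lam k.
Proof.
move=> [b Hb] k'0 m0 kk H; exists (b + c) => i ik.
have [|u [w [n [uN wE P En]]]] := Hb (minn i k'.-1); first nlia.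
have [|x [y [t [xN yE Pt Et]]]] := H u w n (i - minn i k'.-1) uN wE _ P; first nlia.
exists x, y, t; split=> //; nlia.
Qed.

Section Step.

Variables (S N E : {set T}) (lam : T -> nat) (k : nat).
Hypothesis S_inst : instance S N E k.
Hypothesis k_gt1 : 1 < k.
Hypothesis IH : forall D N' E' lam' k', #|D| < #|S| -> instance D N' E' k' ->
  path_family D N' E' lam' (maxn 1 k').

Let cS := inst_conn S_inst.
Let NS := inst_NS S_inst.
Let ES := inst_ES S_inst.

Lemma IHsub D N' E' lam' k' t : t \in S -> t \notin D -> D \subset S ->
  instance D N' E' k' -> path_family D N' E' lam' (maxn 1 k').
Proof.
move=> tS tD DS; apply: IH; apply: proper_card; apply/properP; split=> //; by exists t.
Qed.

(** Without exits the pocket must meet [N], and it can be left only through [d]. The neighbours of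
    [d] become exits, which makes up exactly for the lost neighbour [d], so [k] does not drop; a
    fixed path from [d] to [E] completes all paths. *)
Lemma fam_pocket K d : pocket S d K -> connected e K -> (forall w, w \in K -> w \notin E) ->
  path_family S N E lam k.
Proof.
move=> pK coK KE; have cSK := conn_pocket cS pK.
have /pocketP[dS KS dK K0 cK] := pK.
case/set0Pn: (inst_E0 S_inst) => e0 e0E.
have e0S : e0 \in S :\: K.
  by rewrite inE (subsetP ES) // andbT; apply: contraL e0E => /KE.
have [t Pt] : exists t, Pth e (S :\: K) d e0 t by apply: connected_Pth; rewrite // inE dK.
have NK : N :&: K != set0.
  have [w wK] := sepP (inst_sep S_inst) pK; rewrite inE (negbTE (KE w wK)) orbF => wN.
  by apply/set0Pn; exists w; rewrite inE wN.
have dE : K :&: nbr_set e [set d] != set0.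
  apply/negP => /eqP K1; have /subsetP/(_ d dS) : S \subset K; last by rewrite (negbTE dK).
  apply: cS => // w y wK yS ewy; case: (cK w y wK yS ewy) => // yd.
  by move/setP/(_ w): K1; rewrite in_setI nbr_set1 wK -yd ewy inE.
have iK : instance K (N :&: K) (K :&: nbr_set e [set d]) k.
  split=> //; try exact: subsetIl; try exact: subsetIr.
  - by case: (inst_mono S_inst) => c Hc; exists c => w; rewrite inE => /andP[/Hc].
  - apply: sep_sub (inst_sep S_inst) KS _ _ => w.
      by move=> wK; rewrite !in_setU !in_setI wK (negbTE (KE _ wK)) orbF => ->.
    move=> y wK yS yK ewy; rewrite in_setU [X in _ || X]in_setI nbr_set1 wK.
    by case: (cK w y wK yS ewy) yK => [->//|<-]; rewrite ewy orbT.
  - move=> w wK k1; have wS := subsetP KS _ wK.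
    have := inst_deg S_inst wS k1; rewrite !in_setI nbr_set1 wK (negbTE (KE _ wK)) andbT /=.
    have : deg e S w <= deg e K w + deg e [set d] w.
      apply: deg_cover => y yS ewy; rewrite in_set1.
      by case: (cK w y wK yS ewy) => [->|->]; rewrite ?eqxx ?orbT.
    rewrite deg1; nlia.
have F := IHsub (fun=> 0) dS dK KS iK.
apply: (fam_lift (m := 1) (c := t + lam e0) F); try nlia.
move=> u w n j; rewrite in_setI => /andP[uN uK]; rewrite in_setI nbr_set1 => /andP[wK ewd] j1 P.
exists u, e0, (n + t); split=> //; last nlia.
have dis : [disjoint K & S :\: K] by apply: disjP => y yK; rewrite inE yK.
apply: Pth_sub (Pth_cat dis ewd P Pt); by rewrite subUset KS subsetDl.
Qed.

End Step.

End Instances.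

(** * Combining a maximal biclique with the pieces outside it *)

Section Biclique.

Variables (T : finType) (e : rel T) (col : T -> bool).
Hypothesis e_sym : symmetric e.
Hypothesis e_col : forall x y, e x y -> col x != col y.
Implicit Types (A B K D M X : {set T}) (x y z w u d : T).

Variables (S N E : {set T}) (lam : T -> nat) (k : nat).
Hypothesis S_inst : instance e col S N E k.
Hypothesis k_gt1 : 1 < k.
Hypothesis IH : forall D N' E' lam' k', #|D| < #|S| -> instance e col D N' E' k' ->
  path_family e D N' E' lam' (maxn 1 k').

Variables (A0 B0 : {set T}) (s : nat) (c0 : bool).
Hypothesis A0S : A0 \subset S.
Hypothesis B0N : B0 \subset N.
Hypothesis AB : forall a b, a \in A0 -> b \in B0 -> e a b.
Hypothesis cardA : #|A0| = s.
Hypothesis cardB : s < #|B0|.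
Hypothesis colN : forall w, w \in N -> col w = c0.
(** These two bounds express maximality: a vertex of [N] seeing all of [A0] could join [B0], and a
    vertex seeing s + 2 vertices of [B0] could join [A0], with those as the new [B0]. *)
Hypothesis outA : forall w, w \in S -> w \notin A0 -> w \notin B0 ->
  deg e A0 w + (w \in N) <= s.
Hypothesis outB : forall w, w \in S -> w \notin A0 -> w \notin B0 -> deg e B0 w <= s.+1.

Let cS := inst_conn S_inst.
Let NS := inst_NS S_inst.
Let ES := inst_ES S_inst.
Let B0S : B0 \subset S := subset_trans B0N NS.
Let IHs := IHsub IH.
Let famX := fam_pocket e_sym lam S_inst k_gt1 IH.

Lemma colB b : b \in B0 -> col b = c0.
Proof. by move=> /(subsetP B0N)/colN. Qed.

Lemma B0_ex : exists b, b \in B0.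
Proof. by apply/set0Pn; rewrite -card_gt0; apply: leq_ltn_trans cardB. Qed.

Lemma colA a : a \in A0 -> col a = ~~ c0.
Proof.
case: B0_ex => b bB aA; have := e_col (AB aA bB); rewrite (colB bB).
by case: (col a); case: c0.
Qed.

Lemma A0_notinN a : a \in A0 -> a \notin N.
Proof. by move=> aA; apply/negP => /colN; rewrite colA //; case: c0. Qed.

Lemma A0_notinB a : a \in A0 -> a \notin B0.
Proof. by move/A0_notinN; apply: contra => /(subsetP B0N). Qed.

Lemma B0_notinA b : b \in B0 -> b \notin A0.
Proof. by apply: contraL => /A0_notinB. Qed.

Lemma edge_neq x y : e x y -> x != y.
Proof. by move/e_col; apply: contraNneq => ->. Qed.

(** A zigzag between the two sides. Only its end is prescribed: any start in [B0] will do, since all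
    of [B0] consists of entries. *)
Lemma zigB j A' B' b : A' \subset A0 -> B' \subset B0 -> b \in B' ->
  j <= #|A'| -> j < #|B'| -> exists2 x, x \in B' & Pth e (A' :|: B') x b (2 * j + 1).
Proof.
elim: j A' B' b => [|j IHj] A' B' b AA BB bB jA jB.
  by exists b => //; apply: Pth1; rewrite inE bB orbT.
have /set0Pn[a aA] : A' != set0 by rewrite -card_gt0; exact: leq_ltn_trans jA.
have cA' : j <= #|A' :\ a| by move: jA; rewrite (cardsD1 a) aA.
have cB' : j < #|B' :\ b| by move: jB; rewrite (cardsD1 b) bB.
have /set0Pn[b' b'B] : B' :\ b != set0 by rewrite -card_gt0; exact: leq_ltn_trans cB'.
have [|||||x xB P] := IHj (A' :\ a) (B' :\ b) b' => //.
- exact: subset_trans (subD1set _ _) AA.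
- exact: subset_trans (subD1set _ _) BB.
move: b'B xB; rewrite !inE => /andP[b'b b'B] /andP[xb xB].
have aA0 := subsetP AA _ aA; have bB0 := subsetP BB _ bB; have b'B0 := subsetP BB _ b'B.
have eab := AB aA0 bB0; have ebA : e b' a by rewrite e_sym AB.
exists x => //; rewrite (_ : 2 * j.+1 + 1 = 2 * j + 1 + 2); last nlia.
have dis : [disjoint A' :\ a :|: B' :\ b & [set a; b]].
  apply: disjP => t; rewrite !inE negb_or.
  case/orP => /andP[-> t']; rewrite ?andbT //=.
    by apply: contraL (subsetP AA _ t') => /eqP->; exact: B0_notinA.
  by apply: contraL (subsetP BB _ t') => /eqP->; exact: A0_notinB.
apply: Pth_sub (Pth_cat dis ebA P (Pth2 (edge_neq eab) eab)).
apply/subsetP => t; rewrite !inE => /orP[/orP[]/andP[_ ->]|/orP[]/eqP->]; by rewrite ?aA ?bB ?orbT.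
Qed.

Lemma zigA j A' B' a : A' \subset A0 -> B' \subset B0 -> a \in A' ->
  j < #|A'| -> j < #|B'| -> exists2 x, x \in B' & Pth e (A' :|: B') x a (2 * j + 2).
Proof.
move=> AA BB aA jA jB.
have cA' : j <= #|A' :\ a| by move: jA; rewrite (cardsD1 a) aA.
have /set0Pn[b bB] : B' != set0 by rewrite -card_gt0; exact: leq_ltn_trans jB.
have [|||||x xB P] := @zigB j (A' :\ a) B' b => //.
  exact: subset_trans (subD1set _ _) AA.
exists x => //; rewrite (_ : 2 * j + 2 = 2 * j + 1 + 1); last nlia.
have eba : e b a by rewrite e_sym AB ?(subsetP AA) ?(subsetP BB).
have dis : [disjoint A' :\ a :|: B' & [set a]].
  apply: disjP => t; rewrite !inE => /orP[/andP[]//|tB].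
  by apply: contraL (subsetP BB _ tB) => /eqP->; apply: A0_notinB; exact: (subsetP AA).
apply: Pth_sub (Pth_cat dis eba P (Pth1 e (set11 a))).
apply/subsetP => t; rewrite !inE => /orP[/orP[/andP[_ ->]|->]|/eqP->]; by rewrite ?aA ?orbT.
Qed.

Lemma degB0_same w : col w = c0 -> deg e B0 w = 0.
Proof. by move=> cw; apply: deg0 => b bB; apply/negP => /e_col; rewrite cw colB ?eqxx. Qed.

Lemma degA0_opp w : col w = ~~ c0 -> deg e A0 w = 0.
Proof. by move=> cw; apply: deg0 => b bB; apply/negP => /e_col; rewrite cw colA ?eqxx. Qed.

Lemma notinN_opp w : col w = ~~ c0 -> w \notin N.
Proof. by move=> cw; apply/negP => /colN; rewrite cw; case: c0. Qed.

(** A pocket of [D] avoiding [M'] contains no exit and no vertex with an edge out of [D]; it is a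
    pocket of [S] to which [fam_pocket] applies. *)
Lemma fam_or D M' : connected e D -> D \subset S ->
    (forall w, w \in D -> w \in E -> w \in M') ->
    (forall w y, w \in D -> y \in S -> y \notin D -> e w y -> w \in M') ->
  hits_pockets e D M' \/ path_family e S N E lam k.
Proof.
move=> cD DS HE HB; case sD: (hits_pockets e D M'); [by left|right].
have [d [A [/pocketP[dD AD dA A1 cA] cnA AM _]]] := sepPn e_sym cD (negbT sD).
apply: (@famX A d) => //.
  apply/pocketP; split=> //; [exact: (subsetP DS)|exact: subset_trans DS|].
  move=> w y wA yS ewy; have wD := subsetP AD _ wA.
  case yD: (y \in D); first exact: cA ewy.
  by have := AM w wA; rewrite (HB w y) ?yD.
by move=> w wA; apply: contra (AM w wA) => wE; apply: HE => //; exact: (subsetP AD).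
Qed.

Lemma s0A : s = 0 -> A0 = set0.
Proof. by move=> s0; apply/eqP; rewrite -cards_eq0 cardA s0. Qed.

(** [D] is attached to the biclique by [A0] and to the rest by [c] alone. The paths zigzag in the
    biclique, enter [D] from [A0], leave it to [c] and follow the fixed path in [X]. The zigzag has
    s lengths, so [D] must supply k + 1 - s. *)
Lemma fam_hang D c X e0 t : D \subset S -> connected e D -> D != set0 ->
    (forall w, w \in D -> w \notin A0 /\ w \notin B0) ->
    c \in S -> c \notin D -> c \notin A0 ->
    (forall w, w \in D -> w \notin E) ->
    (forall w y, w \in D -> y \in S -> e w y -> [|| y \in D, y \in A0 | y == c]) ->
    (exists2 w, w \in D & e w c) ->
    X \subset S -> [disjoint X & D :|: A0] -> Pth e X c e0 t -> e0 \in E ->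
    s <= #|B0 :\: X| ->
  path_family e S N E lam k.
Proof.
move=> DS cD D0 DQ cS' cD' cA0 DE DB [w0 w0D ew0c] XS disX PX e0E sB.
have XD t' : t' \in X -> t' \notin D /\ t' \notin A0.
  move=> tX; move/pred0P/(_ t'): disX; rewrite /= tX inE /= => /norP[]; by [].
have Dnb : D :&: nbr_set e [set c] != set0.
  by apply/set0Pn; exists w0; rewrite in_setI nbr_set1 w0D.
have degD w : w \in D -> deg e S w <= deg e D w + deg e A0 w + (e w c).
  move=> wD; rewrite -deg1 -addnA; apply: leq_trans (leq_add (leqnn _) (degU _ _ _ _)).
  by apply: deg_cover => y yS ewy; rewrite !inE; exact: DB ewy.
have mono_c : exists c1, forall w, w \in D :&: nbr_set e [set c] -> col w = c1.
  exists (~~ col c) => w; rewrite in_setI nbr_set1 => /andP[_ /e_col].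
  by case: (col w); case: (col c).
have [/eqP DA|DA] := boolP (D :&: nbr_set e A0 == set0).
  apply: (@famX D c) => //; apply/pocketP; split=> // w y wD yS ewy.
  case/or3P: (DB w y wD yS ewy) => [|yA|/eqP]; [by left| |by right].
  by move: (DA) => /setP/(_ w); rewrite in_setI wD in_set0 (mem_nbr_set yA ewy).
have s_gt0 : 0 < s.
  case: (posnP s) DA => // /s0A-> /set0Pn[w]; rewrite in_setI => /andP[_ /nbr_setP[a]].
  by rewrite inE.
(* With s = 1 the zigzag does not vary and [D] must supply all k lengths. A vertex of [N] that does
   not see [A0] would then lose its credit, so [N] stays among the terminals. Starting in [N] or
   with a detour through [B0] and [A0] differs by 2 vertices; to put this into labels, the family is
   traversed from [c]. *)
have [s1|s_gt1] : s = 1 \/ 1 < s by nlia.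
  have /cards1P[a Aa] : #|A0| == 1 by rewrite cardA s1.
  have iD : instance e col D (D :&: nbr_set e [set c]) (D :&: (N :|: nbr_set e A0)) k.
    split=> //; try exact: subsetIl.
    - apply: contraNneq DA => H; apply/eqP/setP => w; have /setP/(_ w) := H.
      by rewrite in_set0 !in_setI in_setU; case: (w \in D); case: (_ \in nbr_set _ _); rewrite ?orbT.
    - apply: sep_sub (inst_sep S_inst) DS _ _ => [w wD|w y wD yS yD ewy].
        rewrite in_setU (negbTE (DE _ wD)) orbF => wN.
        by rewrite in_setU [X in _ || X]in_setI in_setU wD wN orbT.
      rewrite in_setU !in_setI nbr_set1 in_setU wD /=.
      case/or3P: (DB w y wD yS ewy) => [yD'|yA|/eqP<-]; rewrite ?ewy //.
        by rewrite yD' in yD.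
      by rewrite (mem_nbr_set yA ewy) ?orbT.
    - move=> w wD _; have wS := subsetP DS _ wD; have [wA wB] := DQ w wD.
      have := inst_deg S_inst wS k_gt1; rewrite (negbTE (DE _ wD)).
      have := degD w wD; have := outA wS wA wB; rewrite !in_setI wD nbr_set1 in_setU deg_nbr_set s1 /=.
      case: (w \in N) => /=; first by nlia.
      by case: (deg e A0 w) => [|n] /=; nlia.
  have F := IHs (fun w => if w \in N then 0 else 2) cS' cD' DS iD.
  apply: (fam_lift (m := 1) (c := t + lam e0) F); try nlia.
  move=> u w n j; rewrite in_setI nbr_set1 => /andP[uD euc].
  rewrite in_setI in_setU => /andP[wD wNA] j1 /(Pth_sym e_sym) P.
  have disDX : [disjoint D & X].
    by apply: disjP => t' tD; apply: contraL tD => /XD[].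
  have PC := Pth_cat disDX euc P PX.
  case wN: (w \in N) wNA => /= wNA.
    exists w, e0, (n + t); split=> //; last nlia.
    by apply: Pth_sub PC; rewrite subUset DS.
  case/nbr_setP: wNA => a' a'A ewa.
  have /set0Pn[b] : B0 :\: X != set0 by rewrite -card_gt0; exact: leq_trans sB.
  rewrite inE => /andP[bX bB].
  have eba : e b a' by rewrite e_sym AB.
  have eaw : e a' w by rewrite e_sym.
  exists b, e0, (2 + (n + t)); split=> //; [exact: (subsetP B0N)| |nlia].
  have dis : [disjoint [set b; a'] & D :|: X].
    apply: disjP => t'; rewrite !inE negb_or => /orP[]/eqP->.
      by rewrite bX andbT; apply: contraL bB => /DQ[].
    apply/andP; split; first by apply: contraL a'A => /DQ[].
    by apply: contraL a'A => /XD[].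
  apply: Pth_sub (Pth_cat dis eaw (Pth2 (edge_neq eba) eba) PC).
  apply/subsetP => t'; rewrite !inE => /orP[/orP[]/eqP->|/orP[/(subsetP DS)|/(subsetP XS)]] //.
    exact: (subsetP B0S).
  exact: (subsetP A0S).
have [sD|//] : hits_pockets e D (D :&: nbr_set e A0 :|: D :&: nbr_set e [set c]) \/ path_family e S N E lam k.
  apply: fam_or => // [w wD wE|w y wD yS yD ewy]; first by have := DE w wD; rewrite wE.
  rewrite in_setU !in_setI nbr_set1 wD /=.
  case/or3P: (DB w y wD yS ewy) => [yD'|yA|/eqP<-]; rewrite ?ewy ?orbT //.
    by rewrite yD' in yD.
  by rewrite (mem_nbr_set yA ewy).
have iD : instance e col D (D :&: nbr_set e A0) (D :&: nbr_set e [set c]) (k + 1 - s).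
  split=> //; try exact: subsetIl.
  - exists c0 => w; rewrite in_setI => /andP[_ /nbr_setP[a aA /e_col]]; rewrite (colA aA).
    by case: (col w); case: c0.
  - move=> w wD k1; have wS := subsetP DS _ wD; have [wA wB] := DQ w wD.
    have := inst_deg S_inst wS k_gt1; rewrite (negbTE (DE _ wD)).
    have := degD w wD; have := outA wS wA wB; rewrite !in_setI wD nbr_set1 deg_nbr_set /=.
    by case: (deg e A0 w) => [|n] /=; nlia.
have F := IHs (fun=> 0) cS' cD' DS iD.
apply: (fam_lift (m := s) (c := t + lam e0 + 2) F); try nlia.
move=> u w n j; rewrite in_setI => /andP[uD /nbr_setP[a aA eua]].
rewrite in_setI nbr_set1 => /andP[wD ewc] js P.
have [|||||b] := @zigA j A0 (B0 :\: X) a => //; try nlia.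
  exact: subsetDl.
rewrite inE => /andP[bX bB] PQ.
exists b, e0, (2 * j + 2 + (n + t)); split=> //; [exact: (subsetP B0N)| |nlia].
have disDX : [disjoint D & X].
  by apply: disjP => t' tD; apply: contraL tD => /XD[].
have eau : e a u by rewrite e_sym.
have dis : [disjoint A0 :|: B0 :\: X & D :|: X].
  apply: disjP => t'; rewrite !inE negb_or => /orP[tA|/andP[-> tB]]; rewrite ?andbT.
    apply/andP; split; first by apply: contraL tA => /DQ[].
    by apply: contraL tA => /XD[].
  by apply: contraL tB => /DQ[].
apply: Pth_sub (Pth_cat dis eau PQ (Pth_cat disDX ewc P PX)).
rewrite !subUset A0S DS XS /= andbT; exact: subset_trans (subsetDl _ _) B0S.
Qed.

Let R := S :\: (A0 :|: B0).

Lemma R_sub K : K \subset R -> K \subset S.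
Proof. by move/subset_trans; apply; exact: subsetDl. Qed.

Lemma R_notQ K w : K \subset R -> w \in K -> w \notin A0 /\ w \notin B0.
Proof. by move=> /subsetP sub /sub; rewrite !inE negb_or => /andP[/andP[]]. Qed.

Lemma R_nbrs K w y : absorbs e K R -> w \in K -> y \in S -> e w y ->
  [|| y \in K, y \in A0 | y \in B0].
Proof.
move=> cK wK yS ewy; case yA: (y \in A0); first by rewrite orbT.
case yB: (y \in B0); first by rewrite !orbT.
by rewrite (cK w y) // !inE yA yB.
Qed.

Lemma R_deg K w : absorbs e K R -> w \in K ->
  deg e S w <= deg e K w + deg e A0 w + deg e B0 w.
Proof.
move=> cK wK; rewrite -addnA; apply: leq_trans (leq_add (leqnn _) (degU _ _ _ _)).
by apply: deg_cover => y yS ewy; rewrite !inE; exact: R_nbrs ewy.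
Qed.

Lemma mono_nbB B' K w : B' \subset B0 -> w \in K :&: nbr_set e B' -> col w = ~~ c0.
Proof.
move=> BB; rewrite in_setI => /andP[_ /nbr_setP[b bB /e_col]]; rewrite (colB (subsetP BB _ bB)).
by case: (col w); case: c0.
Qed.

Lemma mono_nbA K w : w \in K :&: nbr_set e A0 -> col w = c0.
Proof.
rewrite in_setI => /andP[_ /nbr_setP[b bB /e_col]]; rewrite (colA bB).
by case: (col w); case: c0.
Qed.

Lemma col_cases w : col w = c0 \/ col w = ~~ c0.
Proof. by case: (col w); case: c0; auto. Qed.

(** Ending in [B0], the zigzag has s + 1 lengths, so [K] needs only k - s. A vertex with the colour
    of [N] loses at most s, its credit in [N] included; one of the other colour loses at most s + 1
    and regains 1 as an entry. *)
Lemma case_B0 K : K \subset R -> connected e K -> absorbs e K R ->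
  K :&: E != set0 -> K :&: nbr_set e B0 != set0 -> path_family e S N E lam k.
Proof.
move=> KR cK cloK KE KB; have KS := R_sub KR.
case: B0_ex => b1 b1B; have b1S := subsetP B0S _ b1B.
have b1K : b1 \notin K by apply/negP => /(R_notQ KR)[_]; rewrite b1B.
have [sK|nsK] := boolP (hits_pockets e K (K :&: nbr_set e B0 :|: K :&: E)).
  have iK : instance e col K (K :&: nbr_set e B0) (K :&: E) (k - s).
    split=> //; try exact: subsetIl.
    - by exists (~~ c0) => w; apply: mono_nbB.
    - move=> w wK k1; have wS := subsetP KS _ wK; have [wA wB] := R_notQ KR wK.
      have := inst_deg S_inst wS k_gt1; have := R_deg cloK wK.
      rewrite !in_setI wK deg_nbr_set /=.
      case: (col_cases w) => cw.
        by have := outA wS wA wB; rewrite degB0_same //; nlia.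
      have := outB wS wA wB; rewrite degA0_opp // (negbTE (notinN_opp cw)).
      by case: (deg e B0 w) => [|n] /=; nlia.
  have F := IHs lam b1S b1K KS iK.
  apply: (fam_lift (m := s.+1) (c := 1) F); try nlia.
  move=> u w n j; rewrite in_setI => /andP[uK /nbr_setP[b bB eub]].
  rewrite in_setI => /andP[wK wE] js P.
  have [|||||x xB PQ] := @zigB j A0 B0 b => //; try nlia.
  exists x, w, (2 * j + 1 + n); split=> //; [exact: (subsetP B0N)| |nlia].
  have ebu : e b u by rewrite e_sym.
  have dis : [disjoint A0 :|: B0 & K].
    by apply: disjP => t; rewrite inE => tQ; apply/negP => /(R_notQ KR)[];
       case/orP: tQ => ->.
  by apply: Pth_sub (Pth_cat dis ebu PQ P); rewrite !subUset A0S B0S.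
(* The offending pocket sees neither exits nor [B0]: it hangs on [A0] and [d], and the rest of [K]
   leads from [d] to an exit. *)
have [d [D [/pocketP[dK DK dD D0 cD] cnD DM Dd]]] := sepPn e_sym cK nsK.
have cKD : connected e (K :\: D) by apply: (conn_pocket e_sym (d := d)) => //; apply/pocketP.
case/set0Pn: KE => e0; rewrite in_setI => /andP[e0K e0E].
have DE w : w \in D -> w \notin E.
  move=> wD; have := DM w wD; rewrite !inE (subsetP DK _ wD) /= negb_or.
  by case/andP.
have e0D : e0 \notin D by apply: contraL e0E => /DE.
have [t PX] : exists t, Pth e (K :\: D) d e0 t by apply: connected_Pth; rewrite // inE ?dD ?e0D.
apply: (fam_hang (D := D) (c := d) _ _ _ _ _ _ _ _ _ _ _ _ PX e0E) => //.
- exact: subset_trans KS.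
- by move=> w /(subsetP DK)/(R_notQ KR).
- exact: (subsetP KS).
- by case: (R_notQ KR dK).
- move=> w y wD yS ewy; have wK := subsetP DK _ wD.
  case/or3P: (R_nbrs cloK wK yS ewy) => [yK|->|yB]; rewrite ?orbT //.
    by case: (cD w y wD yK ewy) => [->|->]; rewrite ?eqxx ?orbT.
  have := DM w wD; rewrite in_setU [X in X || _]in_setI wK.
  by rewrite (mem_nbr_set yB ewy).
- exact: subset_trans (subsetDl _ _) KS.
- apply: disjP => w; rewrite in_setD => /andP[wD /(R_notQ KR)[wA _]].
  by rewrite in_setU negb_or wD.
- rewrite (_ : B0 :\: _ = B0); first exact: ltnW.
  apply/setP => w; rewrite !inE; case wB: (w \in B0); rewrite ?andbF //.
  by rewrite andbT negb_and; apply/orP; right; apply/negP => /(R_notQ KR)[_]; rewrite wB.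
Qed.

(** Ending in [A0], the zigzag has s lengths, one fewer than in [case_B0]. A neighbour of [A0]
    regains 1 as an entry; any other vertex of [K] loses at most its credit in [N], which s - 1
    covers because s exceeds 1. *)
Lemma case_A0_big K : 1 < s -> K \subset R -> connected e K -> absorbs e K R ->
  K :&: E != set0 -> K :&: nbr_set e B0 = set0 -> K :&: nbr_set e A0 != set0 -> path_family e S N E lam k.
Proof.
move=> s_gt1 KR cK cloK KE KB KA; have KS := R_sub KR.
case: B0_ex => b1 b1B; have b1S := subsetP B0S _ b1B.
have b1K : b1 \notin K by apply/negP => /(R_notQ KR)[_]; rewrite b1B.
have nB w y : w \in K -> y \in B0 -> ~~ e w y.
  move=> wK yB; apply/negP => ewy; move/setP/(_ w): KB.
  by rewrite in_setI wK in_set0 (mem_nbr_set yB ewy).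
have [sK|//] : hits_pockets e K (K :&: nbr_set e A0 :|: K :&: E) \/ path_family e S N E lam k.
  apply: fam_or => // [w wK wE|w y wK yS yK ewy].
    by rewrite in_setU [X in _ || X]in_setI wK wE orbT.
  case/or3P: (R_nbrs cloK wK yS ewy) => [yK'|yA|yB]; first by rewrite yK' in yK.
    by rewrite in_setU in_setI wK (mem_nbr_set yA ewy).
  by have := nB w y wK yB; rewrite ewy.
have iK : instance e col K (K :&: nbr_set e A0) (K :&: E) (k + 1 - s).
  split=> //; try exact: subsetIl.
  - by exists c0 => w; apply: mono_nbA.
  - move=> w wK k1; have wS := subsetP KS _ wK; have [wA wB] := R_notQ KR wK.
    have := inst_deg S_inst wS k_gt1; have := R_deg cloK wK; have := outA wS wA wB.
    rewrite !in_setI wK deg_nbr_set (deg0 (nB w ^~ wK)) /=.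
    by case: (deg e A0 w) => [|n] /=; nlia.
have F := IHs lam b1S b1K KS iK.
apply: (fam_lift (m := s) (c := 2) F); try nlia.
move=> u w n j; rewrite in_setI => /andP[uK /nbr_setP[a aA eua]].
rewrite in_setI => /andP[wK wE] js P.
have [|||||x xB PQ] := @zigA j A0 B0 a => //; try nlia.
exists x, w, (2 * j + 2 + n); split=> //; [exact: (subsetP B0N)| |nlia].
have eau : e a u by rewrite e_sym.
have dis : [disjoint A0 :|: B0 & K].
  by apply: disjP => t; rewrite inE => tQ; apply/negP => /(R_notQ KR)[];
     case/orP: tQ => ->.
by apply: Pth_sub (Pth_cat dis eau PQ P); rewrite !subUset A0S B0S.
Qed.

Lemma fam_short b : b \in B0 -> b \in E -> k <= s.+1 -> path_family e S N E lam k.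
Proof.
move=> bB bE ks; exists (1 + lam b) => i ik.
have [|||||x xB PQ] := @zigB i A0 B0 b => //; try nlia.
exists x, b, (2 * i + 1); split=> //; [exact: (subsetP B0N)| |nlia].
by apply: Pth_sub PQ; rewrite subUset A0S.
Qed.

(** The single vertex a of [A0] separates [K] from a part [D] around a vertex of [B0]. Each side
    supplies k - 1 lengths, and gluing them at a gives 2k - 3, enough for k > 2; for k at most 2 the
    biclique alone suffices if it holds an exit. *)
Lemma case_A0_one K : s = 1 -> K \subset R -> connected e K -> absorbs e K R ->
    (forall D, D \subset R -> connected e D -> absorbs e D R ->
      D :&: E != set0 -> D :&: nbr_set e B0 = set0) ->
  K :&: E != set0 -> K :&: nbr_set e A0 != set0 -> path_family e S N E lam k.
Proof.
move=> s1 KR cK cloK noB KE KA; have KS := R_sub KR.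
have KB := noB K KR cK cloK KE.
have /cards1P[a Aa] : #|A0| == 1 by rewrite cardA s1.
have aA : a \in A0 by rewrite Aa set11.
have aS := subsetP A0S _ aA.
(* [D] is the component of S - a around b. An exit of [D] outside [B0] would lie in a component of
   [R] with exits; by [noB] such a component does not see [B0], so without a it cannot be reached
   from b. *)
have around b : b \in B0 -> exists D, [/\ b \in D, pocket e S a D, connected e D,
    forall w, w \in D -> w \in E -> w \in B0 & [disjoint D & K]].
  move=> bB; have [|D [DSa bD cD cnD]] := @component_ex _ e e_sym (S :\ a) b.
    by rewrite !inE (subsetP B0S) // andbT; apply: contraTneq aA => <-; exact: B0_notinA.
  have far K' w : K' \subset R -> absorbs e K' R -> K' :&: nbr_set e B0 = set0 -> w \in D -> w \notin K'.
    move=> K'R cK' K'B wD; apply/negP => wK'.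
    have /subsetP/(_ b bD) : D \subset K' :&: D.
      apply: cnD; first exact: subsetIr.
        by apply/set0Pn; exists w; rewrite inE wK'.
      move=> x y; rewrite !in_setI => /andP[xK' xD] yD exy; rewrite yD andbT.
      have := subsetP DSa _ yD; rewrite !inE => /andP[ya yS].
      case/or3P: (R_nbrs cK' xK' yS exy) => // [|yB].
        by rewrite Aa in_set1 (negbTE ya).
      move/setP/(_ x): K'B; by rewrite in_setI xK' in_set0 (mem_nbr_set yB exy).
    by rewrite in_setI => /andP[/(R_notQ K'R)[_]]; rewrite bB.
  exists D; split=> //.
  - apply/pocketP; split=> //.
    + exact: subset_trans DSa (subD1set _ _).
    + by apply/negP => /(subsetP DSa); rewrite !inE eqxx.
    + by apply/set0Pn; exists b.
    + move=> w y wD yS ewy; have [->|ya] := eqVneq y a; [by right|left].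
      by apply: (cD w) => //; rewrite !inE ya.
  - move=> w wD wE; apply/negPn/negP => wB.
    have := subsetP DSa _ wD; rewrite !inE => /andP[wa wS].
    have wR : w \in R by rewrite !inE Aa in_set1 (negbTE wa) (negbTE wB).
    have [K' [K'R wK' cK' cnK']] := component_ex e_sym wR.
    have K'B : K' :&: nbr_set e B0 = set0.
      by apply: noB => //; apply/set0Pn; exists w; rewrite inE wK'.
    by have := far K' w K'R cK' K'B wD; rewrite wK'.
  - by apply: disjP => w; apply: far.
(* If [B0] has no exit, then neither has [D], a pocket at a. *)
have [/set0Pn[b]|/negPn/eqP EB] := boolP (B0 :&: E != set0); last first.
  case: B0_ex => b bB; have [D [bD pD cnD DE _]] := around b bB.
  apply: (famX pD) => // w wD; apply/negP => wE; move/setP/(_ w): EB.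
  by rewrite inE wE DE // inE.
rewrite in_setI => /andP[bB bE].
have [ks|ks] := leqP k s.+1; first exact: (fam_short bB bE ks).
have [D [bD pD cnD DE disDK]] := around b bB.
have /pocketP[_ DS aD _ cD] := pD.
have nB w y : w \in K -> y \in B0 -> ~~ e w y.
  move=> wK yB; apply/negP => ewy; move/setP/(_ w): KB.
  by rewrite in_setI wK in_set0 (mem_nbr_set yB ewy).
have aK : a \notin K by apply/negP => /(R_notQ KR)[]; rewrite aA.
have [sK|//] : hits_pockets e K (K :&: nbr_set e A0 :|: K :&: E) \/ path_family e S N E lam k.
  apply: fam_or => // [w wK wE|w y wK yS yK ewy].
    by rewrite in_setU [X in _ || X]in_setI wK wE orbT.
  case/or3P: (R_nbrs cloK wK yS ewy) => [yK'|yA|yB]; first by rewrite yK' in yK.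
    by rewrite in_setU in_setI wK (mem_nbr_set yA ewy).
  by have := nB w y wK yB; rewrite ewy.
have iK : instance e col K (K :&: nbr_set e A0) (K :&: E) k.-1.
  split=> //; try exact: subsetIl.
  - by exists c0 => w; apply: mono_nbA.
  - move=> w wK k1; have wS := subsetP KS _ wK; have [wA wB] := R_notQ KR wK.
    have := inst_deg S_inst wS k_gt1; have := R_deg cloK wK; have := outA wS wA wB.
    rewrite !in_setI wK deg_nbr_set (deg0 (nB w ^~ wK)) s1 /=.
    by case: (deg e A0 w) => [|n] /=; nlia.
have [b2 F2] := IHs lam aS aK KS iK.
have iD : instance e col D (N :&: D) (D :&: nbr_set e [set a]) k.-1.
  have bNa : b \in nbr_set e [set a] by rewrite nbr_set1 e_sym AB.
  split=> //; try exact: subsetIl; try exact: subsetIr.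
  - by apply/set0Pn; exists b; rewrite inE (subsetP B0N).
  - by apply/set0Pn; exists b; rewrite in_setI bD.
  - by exists c0 => w; rewrite in_setI => /andP[/colN].
  - apply: sep_sub (inst_sep S_inst) DS _ _ => [w wD|w y wD yS yD ewy].
      rewrite !in_setU in_setI wD andbT => /orP[->//|wE].
      by rewrite (subsetP B0N) ?DE.
    rewrite in_setU [X in _ || X]in_setI wD nbr_set1.
    by case: (cD w y wD yS ewy) yD => [->//|<-]; rewrite ewy orbT.
  - move=> w wD k1; have wS := subsetP DS _ wD.
    have := inst_deg S_inst wS k_gt1; rewrite !in_setI wD nbr_set1 andbT.
    have : deg e S w <= deg e D w + deg e [set a] w.
      apply: deg_cover => y yS ewy; rewrite in_set1.
      by case: (cD w y wD yS ewy) => [->|->]; rewrite ?eqxx ?orbT.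
    by rewrite deg1 /=; nlia.
have F := IHs (fun=> 0) aS aD DS iD.
apply: (fam_lift (m := k.-1) (c := 1 + b2) F); try nlia.
move=> u w n j; rewrite in_setI => /andP[uN uD].
rewrite in_setI nbr_set1 => /andP[wD ewa] js P.
have [|u2 [w2 [n2 []]]] := F2 j; first nlia.
rewrite !in_setI Aa nbr_set1 => /andP[u2K eu2a] /andP[w2K w2E] P2 En2.
exists u, w2, (n + (1 + n2)); split=> //; last nlia.
have eau2 : e a u2 by rewrite e_sym.
have dis2 : [disjoint [set a] & K] by apply: disjP => t /set1P->.
have dis1 : [disjoint D & [set a] :|: K].
  apply: disjP => t tD; rewrite !inE negb_or; apply/andP; split.
    by apply: contraNneq aD => <-.
  by move: disDK; rewrite disjoint_subset => /subsetP/(_ t tD).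
apply: Pth_sub (Pth_cat dis1 ewa P (Pth_cat dis2 eau2 (Pth1 e (set11 a)) P2)).
by rewrite !subUset DS KS sub1set aS.
Qed.

(** [b] has no neighbour in [B0], whose vertices share its colour, and at most s in [A0]. *)
Lemma out_nbr b : b \in B0 -> s < deg e S b -> exists2 w, w \in R & e b w.
Proof.
move=> bB sb; have [/existsP[w /andP[wR ebw]]|/existsPn H] := boolP [exists w, (w \in R) && e b w].
  by exists w.
suff : deg e S b <= s by move/(leq_trans sb); rewrite ltnn.
rewrite -cardA -[#|A0|]addn0 -(degB0_same (colB bB)).
apply: leq_trans (leq_add (deg_le e A0 b) (leqnn _)); apply: deg_cover => y yS eby.
by have := H y; rewrite eby andbT !inE yS andbT negbK.
Qed.

Lemma degB_D1 b w : deg e B0 w <= deg e (B0 :\ b) w + e w b.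
Proof. by rewrite -deg1; apply: deg_cover => y yB _; rewrite !inE yB andbT orNb. Qed.

(** * Exits inside the biclique *)

Section ExitB.

Variables (b0 : T) (K : {set T}) (w1 : T).
Hypothesis b0B : b0 \in B0.
Hypothesis b0E : b0 \in E.
Hypothesis KR : K \subset R.
Hypothesis cK : connected e K.
Hypothesis cloK : absorbs e K R.
Hypothesis w1K : w1 \in K.
Hypothesis ew1b : e w1 b0.
Hypothesis KE : forall w, w \in K -> w \notin E.

Let KS := R_sub KR.
Let b0S := subsetP B0S _ b0B.

Let b0K : b0 \notin K.
Proof. by apply/negP => /(R_notQ KR)[_]; rewrite b0B. Qed.

Let cardB1 : s <= #|B0 :\ b0|.
Proof. by move: cardB; rewrite (cardsD1 b0) b0B. Qed.

Lemma hang_b0 : K :&: nbr_set e (B0 :\ b0) = set0 -> path_family e S N E lam k.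
Proof.
move=> KB; apply: (fam_hang (D := K) (c := b0) _ _ _ _ _ _ _ _ _ _ _ _ (Pth1 e (set11 b0)) b0E) => //.
- by apply/set0Pn; exists w1.
- by move=> w /(R_notQ KR).
- exact: B0_notinA.
- move=> w y wK yS ewy; case/or3P: (R_nbrs cloK wK yS ewy) => [->|->|yB]; rewrite ?orbT //.
  have [->|yb] := eqVneq y b0; first by rewrite !orbT.
  have yB1 : y \in B0 :\ b0 by rewrite !inE yb.
  by move/setP/(_ w): KB; rewrite in_setI wK in_set0 (mem_nbr_set yB1 ewy).
- by exists w1.
- by rewrite sub1set.
- by apply: disjP => t /set1P->; rewrite in_setU negb_or b0K B0_notinA.
Qed.

(** The pocket hangs on [A0] and [d]; the continuation crosses the rest of [K] to [w1] and stops at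
    the exit [b0]. *)
Lemma hang_in_K d D : pocket e K d D -> connected e D -> (exists2 w, w \in D & e w d) ->
    (forall w, w \in D -> w \notin nbr_set e (B0 :\ b0) /\ ~~ e w b0) ->
  path_family e S N E lam k.
Proof.
move=> pD cnD Dd DB; have /pocketP[dK DK dD D0 cD] := pD.
have cKD := conn_pocket e_sym cK pD.
have w1D : w1 \notin D by apply/negP => /DB[_]; rewrite ew1b.
have [t P] : exists t, Pth e (K :\: D) d w1 t.
  by apply: connected_Pth; rewrite // inE ?dD ?w1D.
have dis : [disjoint K :\: D & [set b0]].
  apply: disjP => y; rewrite !inE => /andP[_ yK]; apply: contraTneq yK => ->; exact: b0K.
have PX := Pth_cat dis ew1b P (Pth1 e (set11 b0)).
apply: (fam_hang (D := D) (c := d) _ _ _ _ _ _ _ _ _ _ _ _ PX b0E) => //.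
- exact: subset_trans KS.
- by move=> w /(subsetP DK)/(R_notQ KR).
- exact: (subsetP KS).
- by case: (R_notQ KR dK).
- by move=> w /(subsetP DK)/KE.
- move=> w y wD yS ewy; have wK := subsetP DK _ wD.
  case/or3P: (R_nbrs cloK wK yS ewy) => [yK|->|yB]; rewrite ?orbT //.
    by case: (cD w y wD yK ewy) => [->|->]; rewrite ?eqxx ?orbT.
  case: (DB w wD) => /negP[]; have [yb|yb] := eqVneq y b0; last first.
    by apply: (mem_nbr_set (y := y)) ewy; rewrite !inE yb.
  by case: (DB w wD) => _; rewrite -yb ewy.
- by rewrite subUset sub1set b0S (subset_trans (subsetDl _ _) KS).
- apply: disjP => y; rewrite !in_setU in_setD in_set1 => /orP[/andP[yD /(R_notQ KR)[yA _]]|/eqP->].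
    by rewrite negb_or yD.
  rewrite negb_or B0_notinA // andbT; apply: contra b0K; exact: (subsetP DK).
- apply: leq_trans cardB1 _; apply: subset_leq_card; apply/subsetP => y.
  rewrite !inE negb_or => /andP[-> yB]; rewrite yB !andbT negb_and.
  by apply/orP; right; apply/negP => /(R_notQ KR)[_]; rewrite yB.
Qed.

(** Reserving [b0] as the end leaves more than s vertices of [B0], so the zigzag keeps its s + 1
    lengths. *)
Lemma exitB_wide : s.+1 < #|B0| -> K :&: nbr_set e (B0 :\ b0) != set0 -> path_family e S N E lam k.
Proof.
move=> cB KB.
have [sK|nsK] := boolP (hits_pockets e K (K :&: nbr_set e (B0 :\ b0) :|: K :&: nbr_set e [set b0])); last first.
  have [d [D [pD cnD DM Dd]]] := sepPn e_sym cK nsK.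
  have /pocketP[_ DK _ _ _] := pD.
  apply: hang_in_K pD cnD Dd _ => w wD; have := DM w wD.
  by rewrite in_setU !in_setI nbr_set1 (subsetP DK _ wD) /= negb_or => /andP[].
have iK : instance e col K (K :&: nbr_set e (B0 :\ b0)) (K :&: nbr_set e [set b0]) (k - s).
  split=> //; try exact: subsetIl.
  - by apply/set0Pn; exists w1; rewrite in_setI nbr_set1 w1K.
  - by exists (~~ c0) => w; apply: mono_nbB; exact: subD1set.
  - move=> w wK kk; have wS := subsetP KS _ wK; have [wA wB] := R_notQ KR wK.
    have := inst_deg S_inst wS k_gt1; have := R_deg cloK wK; rewrite (negbTE (KE wK)).
    rewrite !in_setI wK nbr_set1 deg_nbr_set /=.
    case: (col_cases w) => cw.
      by have := outA wS wA wB; rewrite degB0_same //; nlia.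
    have := outB wS wA wB; have := degB_D1 b0 w.
    rewrite degA0_opp // (negbTE (notinN_opp cw)).
    by case: (deg e (_ :\ _) w) => [|n] /=; nlia.
have F := IHs (fun=> lam b0) b0S b0K KS iK.
apply: (fam_lift (m := s.+1) (c := 2) F); try nlia.
move=> u w n j; rewrite in_setI => /andP[uK /nbr_setP[b bB1 eub]].
rewrite in_setI nbr_set1 => /andP[wK ewb0] js P.
have cB1 : s < #|B0 :\ b0| by move: cB; rewrite (cardsD1 b0) b0B.
have [|||||x] := @zigB j A0 (B0 :\ b0) b => //; try nlia.
  exact: subD1set.
rewrite !inE => /andP[_ xB] PQ.
exists x, b0, (2 * j + 1 + (n + 1)); split=> //; [exact: (subsetP B0N)| |nlia].
have ebu : e b u by rewrite e_sym.
have dis2 : [disjoint K & [set b0]].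
  by apply: disjP => t tK; rewrite in_set1; apply: contraNneq b0K => <-.
have dis1 : [disjoint A0 :|: B0 :\ b0 & K :|: [set b0]].
  apply: disjP => t; rewrite !inE negb_or => /orP[tA|/andP[-> tB]]; rewrite ?andbT.
    apply/andP; split; first by apply: contraL tA => /(R_notQ KR)[].
    by apply: contraTneq tA => ->; exact: B0_notinA.
  by apply: contraL tB => /(R_notQ KR)[].
apply: Pth_sub (Pth_cat dis1 ebu PQ (Pth_cat dis2 ewb0 P (Pth1 e (set11 b0)))).
by rewrite !subUset A0S KS sub1set b0S (subset_trans (subD1set _ _) B0S).
Qed.

(** Beside [b0] only s vertices of [B0] remain, so the zigzag has s lengths and [K] must supply k +
    1 - s. To afford this, neighbours of [A0] become exits too, continuing through some a in [A0] to
    [b0]; A0 - a still allows every j < s. *)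
Lemma exitB_tight : #|B0| = s.+1 -> 1 < s -> K :&: nbr_set e (B0 :\ b0) != set0 ->
  path_family e S N E lam k.
Proof.
move=> cB s_gt1 KB; set E' := K :&: (nbr_set e [set b0] :|: nbr_set e A0).
have [sK|//] : hits_pockets e K (K :&: nbr_set e (B0 :\ b0) :|: E') \/ path_family e S N E lam k.
  apply: fam_or => // [w wK wE|w y wK yS yK ewy]; first by have := KE wK; rewrite wE.
  rewrite in_setU !in_setI in_setU nbr_set1 wK /=.
  case/or3P: (R_nbrs cloK wK yS ewy) => [yK'|yA|yB]; first by rewrite yK' in yK.
    by rewrite (mem_nbr_set yA ewy) !orbT.
  have [<-|yb] := eqVneq y b0; first by rewrite ewy orbT.
  by rewrite (mem_nbr_set (y := y)) // !inE yb.
have cB1 : #|B0 :\ b0| = s by move: cB; rewrite (cardsD1 b0) b0B => -[].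
have iK : instance e col K (K :&: nbr_set e (B0 :\ b0)) E' (k + 1 - s).
  split=> //; try exact: subsetIl.
  - by apply/set0Pn; exists w1; rewrite in_setI in_setU nbr_set1 ew1b w1K.
  - by exists (~~ c0) => w; apply: mono_nbB; exact: subD1set.
  - move=> w wK kk; have wS := subsetP KS _ wK; have [wA wB] := R_notQ KR wK.
    have := inst_deg S_inst wS k_gt1; have := R_deg cloK wK; rewrite (negbTE (KE wK)).
    rewrite !in_setI wK in_setU nbr_set1 !deg_nbr_set /=.
    case: (col_cases w) => cw.
      have := outA wS wA wB; rewrite degB0_same //.
      by case: (deg e A0 w) => [|n] /=; rewrite ?orbT /=; nlia.
    have := deg_le e (B0 :\ b0) w; have := degB_D1 b0 w.
    rewrite degA0_opp // (negbTE (notinN_opp cw)) cB1 orbF.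
    by case: (deg e (_ :\ _) w) => [|n] /=; nlia.
have F := IHs (fun w => lam b0 + if e w b0 then 1 else 2) b0S b0K KS iK.
apply: (fam_lift (m := s) (c := 1) F); try nlia.
move=> u w n j; rewrite in_setI => /andP[uK /nbr_setP[b bB1 eub]].
rewrite in_setI in_setU nbr_set1 => /andP[wK ewbA] js P.
have ebu : e b u by rewrite e_sym.
have dis2 : [disjoint K & [set b0]].
  by apply: disjP => t tK; rewrite in_set1; apply: contraNneq b0K => <-.
have [ewb0|/negbTE ewb0] := boolP (e w b0).
  have [|||||x] := @zigB j A0 (B0 :\ b0) b => //; try nlia.
    exact: subD1set.
  rewrite !inE => /andP[_ xB] PQ.
  exists x, b0, (2 * j + 1 + (n + 1)); split=> //; [exact: (subsetP B0N)| |nlia].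
  have dis1 : [disjoint A0 :|: B0 :\ b0 & K :|: [set b0]].
    apply: disjP => t; rewrite !inE negb_or => /orP[tA|/andP[-> tB]]; rewrite ?andbT.
      apply/andP; split; first by apply: contraL tA => /(R_notQ KR)[].
      by apply: contraTneq tA => ->; exact: B0_notinA.
    by apply: contraL tB => /(R_notQ KR)[].
  apply: Pth_sub (Pth_cat dis1 ebu PQ (Pth_cat dis2 ewb0 P (Pth1 e (set11 b0)))).
  by rewrite !subUset A0S KS sub1set b0S (subset_trans (subD1set _ _) B0S).
move: ewbA; rewrite ewb0 /= => /nbr_setP[a aA ewa].
have cA1 : #|A0 :\ a| = s.-1 by move: cardA; rewrite (cardsD1 a) aA; nlia.
have [|||||x] := @zigB j (A0 :\ a) (B0 :\ b0) b => //; try nlia; try exact: subD1set.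
rewrite !inE => /andP[_ xB] PQ.
exists x, b0, (2 * j + 1 + (n + 2)); split=> //; [exact: (subsetP B0N)| |nlia].
have eab := AB aA b0B.
have dis3 : [disjoint K & [set a; b0]].
  apply: disjP => t tK; rewrite !inE negb_or; apply/andP; split.
    by apply: contraTneq tK => ->; apply/negP => /(R_notQ KR)[]; rewrite aA.
  by apply: contraNneq b0K => <-.
have dis1 : [disjoint A0 :\ a :|: B0 :\ b0 & K :|: [set a; b0]].
  apply: disjP => t; rewrite !inE !negb_or => /orP[/andP[-> tA]|/andP[-> tB]].
    apply/andP; split; first by apply: contraL tA => /(R_notQ KR)[].
    by apply: contraTneq tA => ->; exact: B0_notinA.
  rewrite andbT; apply/andP; split; first by apply: contraL tB => /(R_notQ KR)[].
  by apply: contraTneq tB => ->; exact: A0_notinB.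
apply: Pth_sub (Pth_cat dis1 ebu PQ (Pth_cat dis3 ewa P (Pth2 (edge_neq eab) eab))).
rewrite !subUset KS !sub1set b0S (subsetP A0S _ aA) (subset_trans (subD1set _ _) B0S) //.
by rewrite (subset_trans (subD1set _ _) A0S).
Qed.

(* With s = 1 the flexibility of the biclique is void: the instance is read
   from b0 backwards and the way into K is recorded in the labels. *)
Lemma exitB_one : #|B0| = s.+1 -> s = 1 -> K :&: nbr_set e (B0 :\ b0) != set0 ->
  path_family e S N E lam k.
Proof.
move=> cB s1 KB.
have /cards1P[a Aa] : #|A0| == 1 by rewrite cardA s1.
have aA : a \in A0 by rewrite Aa set11.
have /cards1P[b1 Bb1] : #|B0 :\ b0| == 1.
  by apply/eqP; move: cB; rewrite (cardsD1 b0) b0B s1; nlia.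
have b1B : b1 \in B0 :\ b0 by rewrite Bb1 set11.
move: (b1B); rewrite !inE => /andP[b1b0 b1B0].
set E' := K :&: (N :|: (nbr_set e A0 :|: nbr_set e (B0 :\ b0))).
have iK : instance e col K (K :&: nbr_set e [set b0]) E' k.
  split=> //; try exact: subsetIl.
  - by apply/set0Pn; exists w1; rewrite in_setI nbr_set1 ew1b w1K.
  - case/set0Pn: KB => w; rewrite in_setI => /andP[wK wB].
    by apply/set0Pn; exists w; rewrite in_setI wK !in_setU wB !orbT.
  - exists (~~ c0) => w; apply: mono_nbB; by rewrite sub1set.
  - apply: sep_sub (inst_sep S_inst) KS _ _ => [w wK|w y wK yS yK ewy].
      by rewrite !in_setU !in_setI !in_setU wK (negbTE (KE wK)) orbF => ->; rewrite orbT.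
    rewrite in_setU !in_setI !in_setU nbr_set1 wK /=.
    case/or3P: (R_nbrs cloK wK yS ewy) => [yK'|yA|yB]; first by rewrite yK' in yK.
      by rewrite (mem_nbr_set yA ewy) !orbT.
    have [<-|yb] := eqVneq y b0; first by rewrite ewy.
    by rewrite (mem_nbr_set (y := y) (B := B0 :\ b0)) ?orbT // !inE yb.
  - move=> w wK kk; have wS := subsetP KS _ wK; have [wA wB] := R_notQ KR wK.
    have := inst_deg S_inst wS k_gt1; have := R_deg cloK wK; rewrite (negbTE (KE wK)).
    rewrite !in_setI wK !in_setU nbr_set1 !deg_nbr_set /=.
    case: (col_cases w) => cw.
      have := outA wS wA wB; rewrite degB0_same // s1.
      by case: (w \in N) => /=; case: (deg e A0 w) => [|n] /=; nlia.
    have := deg_le e (B0 :\ b0) w; have := degB_D1 b0 w.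
    rewrite degA0_opp // (negbTE (notinN_opp cw)) Bb1 cards1 /=.
    by case: (deg e [set b1] w) => [|n] /=; nlia.
(* The label counts the vertices by which [K] is entered: none when w lies in [N], [b1] alone, or
   [b1] followed by a vertex of [A0]. *)
have F := IHs (fun w => lam b0 + if w \in N then 0 else if e w b1 then 1 else 2) b0S b0K KS iK.
apply: (fam_lift (m := 1) (c := 1) F); try nlia.
move=> u w n j; rewrite in_setI nbr_set1 => /andP[uK eub].
rewrite in_setI !in_setU Bb1 nbr_set1 => /andP[wK wE] js /(Pth_sym e_sym) P.
have dis2 : [disjoint K & [set b0]].
  by apply: disjP => t tK; rewrite in_set1; apply: contraNneq b0K => <-.
have PC := Pth_cat dis2 eub P (Pth1 e (set11 b0)).
have subKb : K :|: [set b0] \subset S by rewrite subUset KS sub1set.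
case wN: (w \in N) wE => /= wE.
  by exists w, b0, (n + 1); split=> //; [exact: Pth_sub PC|nlia].
have b1K : b1 \notin K by apply/negP => /(R_notQ KR)[_]; rewrite b1B0.
have dis1 : [disjoint [set b1] & K :|: [set b0]].
  by apply: disjP => t /set1P->; rewrite in_setU in_set1 negb_or b1K.
have b1S := subsetP B0S _ b1B0.
case ewb1: (e w b1) wE; rewrite ?orbF => wE.
  have eb1w : e b1 w by rewrite e_sym.
  exists b1, b0, (1 + (n + 1)); split=> //; [exact: (subsetP B0N)| |nlia].
  apply: Pth_sub (Pth_cat dis1 eb1w (Pth1 e (set11 b1)) PC).
  by rewrite subUset sub1set b1S.
case/nbr_setP: wE => a' a'A ewa; have ea'w : e a' w by rewrite e_sym.
have eba : e b1 a' by rewrite e_sym AB.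
exists b1, b0, (2 + (n + 1)); split=> //; [exact: (subsetP B0N)| |nlia].
have dis : [disjoint [set b1; a'] & K :|: [set b0]].
  apply: disjP => t; rewrite !inE negb_or => /orP[]/eqP->; first by rewrite b1K.
  apply/andP; split; first by apply: contraL a'A => /(R_notQ KR)[].
  by apply: contraTneq a'A => ->; exact: B0_notinA.
apply: Pth_sub (Pth_cat dis ea'w (Pth2 (edge_neq eba) eba) PC).
by rewrite !subUset !sub1set b1S (subsetP A0S) // KS.
Qed.

End ExitB.

Lemma case_exitB b0 : b0 \in B0 -> b0 \in E -> E \subset A0 :|: B0 -> path_family e S N E lam k.
Proof.
move=> b0B b0E EQ; have [ks|ks] := leqP k s.+1; first exact: (fam_short b0B b0E ks).
have [|w1 w1R ebw] := out_nbr b0B.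
  by have := inst_deg S_inst (subsetP B0S _ b0B) k_gt1; move: ks; nlia.
have [K [KR w1K cloK cK]] := component_ex e_sym w1R.
have ew1b : e w1 b0 by rewrite e_sym.
have KE w : w \in K -> w \notin E.
  move=> /(R_notQ KR)[wA wB]; apply/negP => /(subsetP EQ).
  by rewrite inE (negbTE wA) (negbTE wB).
have [/eqP KB|KB] := boolP (K :&: nbr_set e (B0 :\ b0) == set0).
  exact: (hang_b0 b0B b0E KR cK cloK w1K ew1b KE KB).
have [cB|cB] := ltnP s.+1 #|B0|.
  exact: (exitB_wide b0B b0E KR cK cloK w1K ew1b KE cB KB).
have {}cB : #|B0| = s.+1 by apply/eqP; rewrite eqn_leq cB.
have [s0|[s1|s_gt1]] : s = 0 \/ s = 1 \/ 1 < s by nlia.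
- case/set0Pn: KB => w; rewrite in_setI => /andP[_ /nbr_setP[b]].
  suff -> : B0 :\ b0 = set0 by rewrite inE.
  by apply: cards0_eq; move: cB; rewrite (cardsD1 b0) b0B s0; nlia.
- exact: (exitB_one b0B b0E KR cK cloK w1K ew1b KE cB s1 KB).
- exact: (exitB_tight b0B b0E KR cK cloK w1K ew1b KE cB s_gt1 KB).
Qed.

Section ExitA.

Variable a0 : T.
Hypothesis a0E : a0 \in E.
Hypothesis EA : E \subset A0.
Hypothesis cardE : 1 < #|E|.

Let a0A := subsetP EA _ a0E.
Let a0S := subsetP ES _ a0E.

Let R_notE K w : K \subset R -> w \in K -> w \notin E.
Proof. by move=> KR /(R_notQ KR)[wA _]; apply: contra wA => /(subsetP EA). Qed.

(** [E] has at least two vertices, all in [A0]. The saving of 2 pays for the exit [a0], which ends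
    the path and is lost to the zigzag. *)
Lemma degA_far w : w \notin nbr_set e E -> deg e A0 w + 2 <= s.
Proof.
move=> wE; have : deg e A0 w <= #|A0 :\: E|.
  apply: leq_trans (deg_le e _ w); rewrite -[leqRHS]addn0.
  rewrite -(deg0 (e := e) (S := set0) (w := w)); last by move=> y; rewrite inE.
  apply: deg_cover => y yA ewy; rewrite !inE yA orbF andbT.
  by apply: contra wE => yE; exact: mem_nbr_set yE ewy.
have := cardsID E A0; rewrite (setIidPr EA) cardA; move: cardE; nlia.
Qed.

(** As in [fam_hang], but the continuation ends at [a0] in [A0], which leaves s - 1 lengths to the
    zigzag. Since [D] sees no exit, [degA_far] lets it supply k + 2 - s. *)
Lemma fam_hangE D c X t : D \subset S -> connected e D -> D != set0 ->
    (forall w, w \in D -> w \notin A0 /\ w \notin B0) ->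
    c \in S -> c \notin D -> c \notin A0 ->
    (forall w y, w \in D -> y \in S -> e w y -> [|| y \in D, y \in A0 :\: E | y == c]) ->
    (exists2 w, w \in D & e w c) ->
    X \subset S -> [disjoint X & D :|: A0 :\ a0] -> Pth e X c a0 t ->
    s <= #|B0 :\: X| ->
  path_family e S N E lam k.
Proof.
move=> DS cD D0 DQ cS' cD' cA0 DB [w0 w0D ew0c] XS disX PX sB.
have DE w : w \in D -> w \notin E.
  by move=> /DQ[wA _]; apply: contra wA => /(subsetP EA).
have XD t' : t' \in X -> t' \notin D /\ t' \notin A0 :\ a0.
  by move=> tX; move/pred0P/(_ t'): disX; rewrite /= tX in_setU /= => /norP[].
have degD w : w \in D -> deg e S w <= deg e D w + deg e A0 w + (e w c).
  move=> wD; rewrite -deg1 -addnA; apply: leq_trans (leq_add (leqnn _) (degU _ _ _ _)).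
  apply: deg_cover => y yS ewy; rewrite !inE.
  by case/or3P: (DB w y wD yS ewy) => [->|/setDP[->]|->]; rewrite ?orbT.
have nbE w : w \in D -> w \notin nbr_set e E.
  move=> wD; apply/nbr_setP => -[y yE ewy].
  case/or3P: (DB w y wD (subsetP ES _ yE) ewy) => [/DE|/setDP[_]|/eqP yc]; rewrite ?yE //.
  by move: cA0; rewrite -yc (subsetP EA).
have [/eqP DA|DA] := boolP (D :&: nbr_set e A0 == set0).
  apply: (@famX D c) => //; apply/pocketP; split=> // w y wD yS ewy.
  case/or3P: (DB w y wD yS ewy) => [|/setDP[yA _]|/eqP]; [by left| |by right].
  by move: (DA) => /setP/(_ w); rewrite in_setI wD in_set0 (mem_nbr_set yA ewy).
have s_gt2 : 2 < s.
  case/set0Pn: DA => w; rewrite in_setI deg_nbr_set => /andP[/nbE/degA_far]; nlia.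
have [sD|//] : hits_pockets e D (D :&: nbr_set e A0 :|: D :&: nbr_set e [set c]) \/ path_family e S N E lam k.
  apply: fam_or => // [w wD wE|w y wD yS yD ewy]; first by have := DE w wD; rewrite wE.
  rewrite in_setU !in_setI nbr_set1 wD /=.
  case/or3P: (DB w y wD yS ewy) => [yD'|/setDP[yA _]|/eqP<-]; rewrite ?ewy ?orbT //.
    by rewrite yD' in yD.
  by rewrite (mem_nbr_set yA ewy).
have iD : instance e col D (D :&: nbr_set e A0) (D :&: nbr_set e [set c]) (k + 2 - s).
  split=> //; try exact: subsetIl.
  - by apply/set0Pn; exists w0; rewrite in_setI nbr_set1 w0D.
  - by exists c0 => w; apply: mono_nbA.
  - move=> w wD k1; have wS := subsetP DS _ wD; have [wA wB] := DQ w wD.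
    have := inst_deg S_inst wS k_gt1; rewrite (negbTE (DE _ wD)).
    have := degD w wD; have := degA_far (nbE w wD); rewrite !in_setI wD nbr_set1 deg_nbr_set /=.
    by case: (deg e A0 w) => [|n] /=; nlia.
have F := IHs (fun=> 0) cS' cD' DS iD.
apply: (fam_lift (m := s.-1) (c := t + lam a0 + 2) F); try nlia.
move=> u w n j; rewrite in_setI => /andP[uD /nbr_setP[a aA eua]].
rewrite in_setI nbr_set1 => /andP[wD ewc] js P.
have aa0 : a \in A0 :\ a0.
  rewrite !inE aA andbT; apply: contraTneq (nbE u uD) => aa.
  by rewrite negbK (mem_nbr_set a0E) // -aa.
have cA1 : #|A0 :\ a0| = s.-1 by move: cardA; rewrite (cardsD1 a0) a0A; nlia.
have [|||||b] := @zigA j (A0 :\ a0) (B0 :\: X) a => //; try nlia.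
- exact: subD1set.
- exact: subsetDl.
rewrite inE => /andP[bX bB] PQ.
exists b, a0, (2 * j + 2 + (n + t)); split=> //; [exact: (subsetP B0N)| |nlia].
have disDX : [disjoint D & X].
  by apply: disjP => t' tD; apply: contraL tD => /XD[].
have eau : e a u by rewrite e_sym.
have dis : [disjoint A0 :\ a0 :|: B0 :\: X & D :|: X].
  apply: disjP => t'; rewrite [t' \in _ :|: X]in_setU negb_or => /setUP[tA|/setDP[tB tX]].
    apply/andP; split; first by apply: contraL tA => /DQ[tA _]; rewrite !inE negb_and tA orbT.
    by apply: contraL tA => /XD[].
  by rewrite tX andbT; apply: contraL tB => /DQ[].
apply: Pth_sub (Pth_cat dis eau PQ (Pth_cat disDX ewc P PX)).
rewrite !subUset DS XS /= (subset_trans (subD1set _ _) A0S) andbT.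
exact: subset_trans (subsetDl _ _) B0S.
Qed.

Lemma exitA_main K b0 : s < k -> K \subset R -> connected e K -> absorbs e K R ->
    K :&: nbr_set e (B0 :\ b0) != set0 -> K :&: (nbr_set e E :|: nbr_set e [set b0]) != set0 ->
    b0 \in B0 ->
  path_family e S N E lam k.
Proof.
move=> sk KR cK cloK KB KE0 b0B; have KS := R_sub KR.
have b0S := subsetP B0S _ b0B.
have b0K : b0 \notin K by apply/negP => /(R_notQ KR)[_]; rewrite b0B.
have KE w : w \in K -> w \notin E by apply: R_notE.
set E' := K :&: (nbr_set e E :|: (nbr_set e [set b0] :|: [set w | 1 < deg e B0 w])).
have s_gt1 : 1 < s by rewrite -cardA (leq_trans cardE) ?subset_leq_card.
have [sK|nsK] := boolP (hits_pockets e K (K :&: nbr_set e (B0 :\ b0) :|: E')); last first.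
  (* This pocket sees neither [B0] nor an exit. Its continuation crosses the rest of [K] to [w1] and
     ends with [b2] and [a0]. *)
  have [d [D [pD cnD DM Dd]]] := sepPn e_sym cK nsK.
  have /pocketP[dK DK dD D0 cD] := pD; have cKD := conn_pocket e_sym cK pD.
  case/set0Pn: KB => w1; rewrite in_setI => /andP[w1K w1nb].
  case/nbr_setP: (w1nb) => b2 b2B1 ew1b; have b2B := subsetP (subD1set _ _) _ b2B1.
  have w1D : w1 \notin D.
    by apply/negP => /DM; rewrite in_setU in_setI w1K w1nb.
  have [t P] : exists t, Pth e (K :\: D) d w1 t.
    by apply: connected_Pth; rewrite // inE ?dD ?w1D.
  have eba : e b2 a0 by rewrite e_sym AB.
  have dis : [disjoint K :\: D & [set b2; a0]].
    apply: disjP => y; rewrite !inE negb_or => /andP[_ /(R_notQ KR)[yA yB]].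
    apply/andP; split; first by apply: contraNneq yB => ->.
    by apply: contraNneq yA => ->.
  have PX := Pth_cat dis ew1b P (Pth2 (edge_neq eba) eba).
  apply: (fam_hangE (D := D) (c := d) _ _ _ _ _ _ _ _ _ _ _ PX) => //.
  - exact: subset_trans KS.
  - by move=> w /(subsetP DK)/(R_notQ KR).
  - exact: (subsetP KS).
  - by case: (R_notQ KR dK).
  - move=> w y wD yS ewy; have wK := subsetP DK _ wD.
    have := DM w wD; rewrite !in_setU !in_setI !in_setU wK nbr_set1 /= !negb_or.
    case/and4P=> wB wE wb _.
    case/or3P: (R_nbrs cloK wK yS ewy) => [yK|yA|yB].
    + by case: (cD w y wD yK ewy) => [->|->]; rewrite ?eqxx ?orbT.
    + rewrite inE yA andbT; case yE: (y \in E); rewrite ?orbT //.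
      by rewrite (mem_nbr_set yE ewy) in wE.
    + have [yb|yb] := eqVneq y b0; first by rewrite -yb ewy in wb.
      by case/negP: wB; apply: (mem_nbr_set (y := y)) ewy; rewrite !inE yb.
  - rewrite !subUset !sub1set (subsetP B0S _ b2B) a0S andbT /=.
    by rewrite (subset_trans (subsetDl _ _) KS).
  - apply: disjP => y; rewrite in_setU [y \in D :|: _]in_setU negb_or.
    case/orP => [/setDP[yK yD]|/set2P[]->].
    + by rewrite yD !inE negb_and (proj1 (R_notQ KR yK)) orbT.
    + rewrite !inE negb_and (B0_notinA b2B) orbT andbT.
      by apply/negP => /(subsetP DK)/(R_notQ KR)[_]; rewrite b2B.
    + rewrite !inE eqxx andbT.
      by apply/negP => /(subsetP DK)/(R_notQ KR)[]; rewrite a0A.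
  - have : B0 :\ b2 \subset B0 :\: (K :\: D :|: [set b2; a0]).
      apply/subsetP => y; rewrite !inE !negb_or => /andP[-> yB]; rewrite yB andbT /=.
      apply/andP; split.
        by rewrite negb_and; apply/orP; right; apply/negP => /(R_notQ KR)[_]; rewrite yB.
      by apply: contraTneq yB => ->; exact: A0_notinB.
    move/subset_leq_card; apply: leq_trans.
    by move: cardB; rewrite (cardsD1 b2) b2B.
have iK : instance e col K (K :&: nbr_set e (B0 :\ b0)) E' (k + 1 - s).
  split=> //; try exact: subsetIl.
  - case/set0Pn: KE0 => w; rewrite !in_setI !in_setU => /andP[wK wE].
    by apply/set0Pn; exists w; rewrite in_setI wK !in_setU orbA wE.
  - by exists (~~ c0) => w; apply: mono_nbB; exact: subD1set.
  - move=> w wK kk; have wS := subsetP KS _ wK; have [wA wB] := R_notQ KR wK.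
    have := inst_deg S_inst wS k_gt1; have := R_deg cloK wK; rewrite (negbTE (KE w wK)).
    rewrite !in_setI wK !in_setU nbr_set1 [w \in finset _]inE [w \in nbr_set e (_ :\ _)]deg_nbr_set /=.
    case: (col_cases w) => cw.
      have := outA wS wA wB; rewrite degB0_same //.
      have [wE|wE] := boolP (w \in nbr_set e E); first by rewrite /=; nlia.
      by have := degA_far wE; nlia.
    have := outB wS wA wB; have := degB_D1 b0 w.
    rewrite degA0_opp // (negbTE (notinN_opp cw)).
    have -> : w \in nbr_set e E = false.
      apply/negP => /nbr_setP[y /(subsetP EA) yA /e_col]; by rewrite cw (colA yA) eqxx.
    have [ewb|ewb] := boolP (e w b0) => /=.
      by case: (deg e (_ :\ _) w) => [|n] /=; nlia.
    have [g2|g2] := ltnP 1 (deg e B0 w).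
      by case: (deg e (_ :\ _) w) => [|n] /=; nlia.
    by case: (deg e (_ :\ _) w) => [|n] /=; nlia.
pose pk w := odflt a0 [pick a in E | e w a].
have pkP w : w \in nbr_set e E -> pk w \in E /\ e w (pk w).
  rewrite /pk; case: pickP => [a /andP[]//|H] /nbr_setP[a aE ewa].
  by have := H a; rewrite aE ewa.
have F := IHs (fun w => if w \in nbr_set e E then 1 + lam (pk w) else 2 + lam a0) b0S
  b0K KS iK.
apply: (fam_lift (m := s) (c := 1) F); try nlia.
move=> u w n j; rewrite in_setI => /andP[uK /nbr_setP[b bB1 eub]].
case/setD1P: (bB1) => bb0 bB.
rewrite !in_setI !in_setU nbr_set1 [w \in finset _]inE => /andP[wK wE] js P.
have ebu : e b u by rewrite e_sym.
have [wnE|/negbTE wnE] := boolP (w \in nbr_set e E).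
  have [pE ewp] := pkP w wnE; have pA := subsetP EA _ pE.
  have cA1 : #|A0 :\ pk w| = s.-1 by move: cardA; rewrite (cardsD1 (pk w)) pA; nlia.
  have [|||||x xB PQ] := @zigB j (A0 :\ pk w) B0 b => //; try nlia; first exact: subD1set.
  exists x, (pk w), (2 * j + 1 + (n + 1)); split=> //; [exact: (subsetP B0N)| |nlia].
  have dis2 : [disjoint K & [set pk w]].
    apply: disjP => t tK; rewrite in_set1; apply: contraTneq tK => ->.
    by apply/negP => /(R_notQ KR)[]; rewrite pA.
  have dis1 : [disjoint A0 :\ pk w :|: B0 & K :|: [set pk w]].
    apply: disjP => t; rewrite !inE negb_or => /orP[/andP[-> tA]|tB]; rewrite ?andbT.
      by apply: contraL tA => /(R_notQ KR)[].
    apply/andP; split; first by apply: contraL tB => /(R_notQ KR)[].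
    by apply: contraTneq tB => ->; exact: A0_notinB.
  apply: Pth_sub (Pth_cat dis1 ebu PQ (Pth_cat dis2 ewp P (Pth1 e (set11 _)))).
  by rewrite !subUset KS B0S sub1set (subsetP A0S _ pA) (subset_trans (subD1set _ _) A0S).
(* If w sees [b0], that vertex serves, because b was taken in B0 - b0; otherwise w has at least two
   neighbours in [B0]. *)
have [b' [b'B b'b ewb']] : exists b', [/\ b' \in B0, b' != b & e w b'].
  move: wE; rewrite wnE /= => /orP[ewb|]; first by exists b0; rewrite eq_sym.
  have := degB_D1 b w => H1 H2.
  have : 0 < deg e (B0 :\ b) w by move: H1 H2; nlia.
  rewrite -deg_nbr_set => /nbr_setP[b']; rewrite !inE => /andP[b'b b'B] ewb'; by exists b'.
have cA1 : #|A0 :\ a0| = s.-1 by move: cardA; rewrite (cardsD1 a0) a0A; nlia.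
have cB1 : s <= #|B0 :\ b'| by move: cardB; rewrite (cardsD1 b') b'B; nlia.
have bB' : b \in B0 :\ b' by rewrite !inE eq_sym b'b.
have [|||||x] := @zigB j (A0 :\ a0) (B0 :\ b') b => //; try nlia; try exact: subD1set.
rewrite !inE => /andP[_ xB] PQ.
exists x, a0, (2 * j + 1 + (n + 2)); split=> //; [exact: (subsetP B0N)| |nlia].
have eba : e b' a0 by rewrite e_sym AB.
have dis3 : [disjoint K & [set b'; a0]].
  apply: disjP => t tK; rewrite !inE negb_or; have [tA tB] := R_notQ KR tK.
  by apply/andP; split; [apply: contraNneq tB => ->|apply: contraNneq tA => ->].
have dis1 : [disjoint A0 :\ a0 :|: B0 :\ b' & K :|: [set b'; a0]].
  apply: disjP => t; rewrite !inE !negb_or => /orP[/andP[-> tA]|/andP[-> tB]]; rewrite ?andbT.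
    apply/andP; split; first by apply: contraL tA => /(R_notQ KR)[].
    by apply: contraTneq tA => ->; exact: B0_notinA.
  apply/andP; split; first by apply: contraL tB => /(R_notQ KR)[].
  by apply: contraTneq tB => ->; exact: A0_notinB.
apply: Pth_sub (Pth_cat dis1 ebu PQ (Pth_cat dis3 ewb' P (Pth2 (edge_neq eba) eba))).
rewrite !subUset KS !sub1set a0S (subsetP B0S _ b'B) (subset_trans (subD1set _ _) A0S).
by rewrite (subset_trans (subD1set _ _) B0S).
Qed.

Lemma case_exitA_many : path_family e S N E lam k.
Proof.
have s_gt1 : 1 < s by rewrite -cardA (leq_trans cardE) ?subset_leq_card.
have [ks|sk] := leqP k s.
  exists (2 + lam a0) => i ik.
  have [|||||x xB PQ] := @zigA i A0 B0 a0 => //; try nlia.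
  exists x, a0, (2 * i + 2); split=> //; [exact: (subsetP B0N)| |nlia].
  by apply: Pth_sub PQ; rewrite subUset A0S.
case: B0_ex => b bB; have bS := subsetP B0S _ bB.
have [|w1 w1R ebw] := out_nbr bB.
  have := inst_deg S_inst bS k_gt1.
  have /negbTE-> : b \notin E by apply: contraL bB => /(subsetP EA)/A0_notinB.
  by move: sk; nlia.
have [K [KR w1K cloK cK]] := component_ex e_sym w1R; have KS := R_sub KR.
have ewb : e w1 b by rewrite e_sym.
have w1b : w1 \in K :&: nbr_set e [set b] by rewrite in_setI nbr_set1 w1K.
have [/eqP KB|KB] := boolP (K :&: nbr_set e (B0 :\ b) == set0); last first.
  apply: (exitA_main sk KR cK cloK KB _ bB).
  by apply/set0Pn; exists w1; move: w1b; rewrite !in_setI in_setU orbC => /andP[-> ->].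
have [/eqP KE|KE] := boolP (K :&: nbr_set e E == set0); last first.
  (* Another vertex of [B0] takes the role of [b0], so that the edge from [w1] to b becomes a way
     into [K], while the neighbours of [E] provide the exits. *)
  have /set0Pn[b0] : B0 :\ b != set0.
    by rewrite -card_gt0; move: cardB; rewrite (cardsD1 b) bB; move: s_gt1; nlia.
  rewrite !inE => /andP[b0b b0B].
  apply: (exitA_main (b0 := b0) sk KR cK cloK) => //.
    apply/set0Pn; exists w1; rewrite in_setI w1K (mem_nbr_set (y := b)) //.
    by rewrite !inE eq_sym b0b.
  case/set0Pn: KE => w; rewrite in_setI => /andP[wK wE].
  by apply/set0Pn; exists w; rewrite in_setI in_setU wK wE.
(* What remains is a [K] attached by A0 - E and b only. *)
have eba : e b a0 by rewrite e_sym AB.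
apply: (fam_hangE (D := K) (c := b) _ _ _ _ _ _ _ _ _ _ _ (Pth2 (edge_neq eba) eba)) => //.
- by apply/set0Pn; exists w1.
- by move=> w /(R_notQ KR).
- by apply/negP => /(R_notQ KR)[_]; rewrite bB.
- exact: B0_notinA.
- move=> w y wK yS ewy; case/or3P: (R_nbrs cloK wK yS ewy) => [->//|yA|yB].
    rewrite inE yA andbT; case yE: (y \in E); rewrite ?orbT //.
    by move/setP/(_ w): KE; rewrite in_setI wK in_set0 (mem_nbr_set yE ewy).
  have [->|yb] := eqVneq y b; first by rewrite !orbT.
  have yB1 : y \in B0 :\ b by rewrite !inE yb.
  by move/setP/(_ w): KB; rewrite in_setI wK in_set0 (mem_nbr_set yB1 ewy).
- by exists w1.
- by rewrite subUset !sub1set bS.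
- apply: disjP => y /set2P[]->; rewrite !inE negb_or.
    by rewrite negb_and (B0_notinA bB) orbT andbT; apply/negP => /(R_notQ KR)[_]; rewrite bB.
  by rewrite eqxx andbT; apply/negP => /(R_notQ KR)[]; rewrite a0A.
- have : B0 :\ b \subset B0 :\: [set b; a0].
    apply/subsetP => y; rewrite !inE !negb_or => /andP[-> yB]; rewrite yB andbT /=.
    by apply: contraTneq yB => ->; exact: A0_notinB.
  move/subset_leq_card; apply: leq_trans.
  by move: cardB; rewrite (cardsD1 b) bB.
Qed.

End ExitA.

(** A single exit [a0] is a cut vertex in the sense of [pocket]: the part of S - a0 around a vertex
    of [B0] has no exit. *)
Lemma case_exitA a0 : a0 \in E -> E \subset A0 -> path_family e S N E lam k.
Proof.
move=> a0E EA; have [cE|cE] := ltnP 1 #|E|; first exact: (case_exitA_many a0E EA cE).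
have Ea : E = [set a0].
  by apply/eqP; rewrite eq_sym eqEcard sub1set a0E cards1.
have a0A := subsetP EA _ a0E; have a0S := subsetP A0S _ a0A.
case: B0_ex => b bB.
have [|D [DSa bD cD cnD]] := @component_ex _ e e_sym (S :\ a0) b.
  by rewrite !inE (subsetP B0S) // andbT; apply: contraTneq a0A => <-; exact: B0_notinA.
have aD : a0 \notin D by apply/negP => /(subsetP DSa); rewrite !inE eqxx.
apply: (@famX D a0) => //.
  apply/pocketP; split=> //.
  - exact: subset_trans DSa (subD1set _ _).
  - by apply/set0Pn; exists b.
  - move=> w y wD yS ewy; have [->|ya] := eqVneq y a0; [by right|left].
    by apply: (cD w) => //; rewrite !inE ya.
by move=> w wD; rewrite Ea in_set1; apply: contraNneq aD => <-.
Qed.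

Lemma fam_biclique : path_family e S N E lam k.
Proof.
have [/existsP[w /andP[wR wE]]|/existsPn noE] := boolP [exists w, (w \in R) && (w \in E)].
  have [/exists_inP[u]|/exists_inPn noB] :=
      boolP [exists u in R :&: E, component e R u :&: nbr_set e B0 != set0].
    rewrite in_setI => /andP[uR uE] KB; have [KR uK cloK cK] := component_conn e_sym uR.
    apply: (case_B0 KR cK cloK) KB; apply/set0Pn; exists u; by rewrite inE uK.
  have {}noB D : D \subset R -> connected e D -> absorbs e D R -> D :&: E != set0 ->
      D :&: nbr_set e B0 = set0.
    move=> DR cD cloD /set0Pn[u]; rewrite inE => /andP[uD uE]; have uR := subsetP DR _ uD.
    have [KR uK cloK cK] := component_conn e_sym uR.
    have := noB u; rewrite inE uR uE negbK => /(_ isT)/eqP KB.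
    have DK : D \subset component e R u :&: D.
      apply: cD; [exact: subsetIr| |].
        by apply/set0Pn; exists u; rewrite inE uK.
      move=> x y; rewrite !in_setI => /andP[xK xD] yD exy; rewrite yD andbT.
      by apply: (cloK x) => //; exact: (subsetP DR).
    apply/eqP; rewrite -subset0 -KB; apply: setSI.
    by apply: subset_trans DK _; exact: subsetIl.
  have [KR wK cloK cK] := component_conn e_sym wR; set K := component e R w in KR wK cloK cK.
  have KE : K :&: E != set0 by apply/set0Pn; exists w; rewrite inE wK.
  have KB := noB K KR cK cloK KE; have KS := R_sub KR.
  (* [K] does not see [B0], so only [A0] can connect it to the rest of [S]. *)
  have KA : K :&: nbr_set e A0 != set0.
    apply/negP => /eqP KA; case: B0_ex => b bB.
    have /subsetP/(_ b (subsetP B0S _ bB)) : S \subset K.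
      apply: cS => //; first by apply/set0Pn; exists w.
      move=> x y xK yS exy; case/or3P: (R_nbrs cloK xK yS exy) => // yQ.
        by move/setP/(_ x): KA; rewrite in_setI xK in_set0 (mem_nbr_set yQ exy).
      by move/setP/(_ x): KB; rewrite in_setI xK in_set0 (mem_nbr_set yQ exy).
    by move/(R_notQ KR)=> [_]; rewrite bB.
  have [s0|[s1|s_gt1]] : s = 0 \/ s = 1 \/ 1 < s by nlia.
  - by case/set0Pn: KA => x; rewrite in_setI (s0A s0) => /andP[_ /nbr_setP[y]]; rewrite inE.
  - exact: (case_A0_one s1 KR cK cloK noB KE KA).
  - exact: (case_A0_big s_gt1 KR cK cloK KE KB KA).
case/set0Pn: (inst_E0 S_inst) => e0 e0E.
have EQ : E \subset A0 :|: B0.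
  apply/subsetP => y yE; have := noE y; rewrite yE andbT !inE (subsetP ES _ yE) andbT.
  by rewrite negbK.
have [/existsP[b /andP[bB bE]]|/existsPn EB] := boolP [exists b, (b \in B0) && (b \in E)].
  exact: (case_exitB bB bE EQ).
apply: (case_exitA e0E); apply/subsetP => y yE.
have := subsetP EQ _ yE; rewrite inE => /orP[//|yB].
by have := EB y; rewrite yE yB.
Qed.

End Biclique.

(** * The induction on the size of the bipartite graph *)

Section Core.

Variables (T : finType) (e : rel T) (col : T -> bool).
Hypothesis e_sym : symmetric e.
Hypothesis e_col : forall x y, e x y -> col x != col y.

Theorem core_fam (S N E : {set T}) lam k : instance e col S N E k -> path_family e S N E lam (maxn 1 k).
Proof.
have [n] := ubnP #|S|; elim: n S N E lam k => // n IHn S N E lam k Sn S_inst.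
have [k1|k1] := leqP k 1; first exact: fam_one S_inst.
pose good (P : {set T} * {set T}) := [&& P.1 \subset S, P.2 \subset N,
  [forall a in P.1, forall b in P.2, e a b] & #|P.1| < #|P.2|].
(* The order is lexicographic, with the size of [A0] first, since #|B0| stays below [#|T|.+1].
   Enlarging [A0] by one therefore pays for any shrinking of [B0]. *)
pose weight (P : {set T} * {set T}) := #|P.1| * #|T|.+1 + #|P.2|.
have good0 : good (set0, N).
  rewrite /good sub0set subxx cards0 card_gt0 (inst_N0 S_inst) andbT /=.
  by apply/forall_inP => a; rewrite inE.
have [[A0 B0] /and4P[/= A0S B0N /forall_inP AB cB] maxQ] :=
  arg_maxnP weight (i0 := (set0, N)) good0.
have {}AB a b : a \in A0 -> b \in B0 -> e a b by move/AB/forall_inP; apply.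
have [c0 colN] := inst_mono S_inst.
have IH (D : {set T}) N' E' lam' k' : #|D| < #|S| -> instance e col D N' E' k' ->
    path_family e D N' E' lam' (maxn 1 k').
  by move=> DS; apply: IHn; apply: leq_trans DS _; rewrite -ltnS.
apply: (fam_biclique e_sym e_col lam S_inst k1 IH A0S B0N AB (erefl _) cB colN).
- move=> w wS wA wB; case wN: (w \in N); last by rewrite addn0; exact: deg_le.
  rewrite leqNgt; apply/negP => H.
  have /eqP/setP Ew : [set y in A0 | e w y] == A0.
    rewrite eqEcard; apply/andP; split; last by move: H; rewrite /deg; nlia.
    by apply/subsetP => y; rewrite inE => /andP[].
  have := maxQ (A0, w |: B0); rewrite /good /weight /= A0S subUset sub1set wN B0N /=.
  rewrite cardsU1 wB /= (ltn_trans cB) // andbT => /(_ _).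
  suff -> : [forall a in A0, forall b in w |: B0, e a b] by move=> /(_ isT); nlia.
  apply/forall_inP => a aA; apply/forall_inP => b /setU1P[->|]; last exact: AB.
  by have := Ew a; rewrite inE aA /= e_sym.
- move=> w wS wA wB; rewrite leqNgt; apply/negP => H.
  have := maxQ (w |: A0, [set y in B0 | e w y]).
  rewrite /good /weight /= subUset sub1set wS A0S /= cardsU1 wA -/(deg e B0 w).
  have -> : [set y in B0 | e w y] \subset N.
    by apply: subset_trans B0N; apply/subsetP => y; rewrite inE => /andP[].
  have -> : [forall a in w |: A0, forall b in [set y in B0 | e w y], e a b].
    apply/forall_inP => a /setU1P[->|aA]; apply/forall_inP => b; rewrite inE => /andP[bB //].
    by move=> _; exact: AB.
  have cT : #|B0| <= #|T| by exact: max_card.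
  have H' : #|A0|.+1 < deg e B0 w by [].
  by rewrite /= add1n H' => /(_ isT); rewrite mulSn; move: cT;
     move: #|A0| (deg _ _ _) #|B0| #|T| => *; nlia.
Qed.

End Core.

(** * Menger's theorem *)

Section Menger.

Variables (T : finType) (e : rel T) (A : {set T}).
Implicit Types (B Z : {set T}) (s q t : seq T) (x y z w u : T).

(* (q, x) is a path from A to x; only x lies in B. *)
Definition AB_path B (p : seq T * T) := [/\ sorted e (rcons p.1 p.2), uniq (rcons p.1 p.2),
  head p.2 p.1 \in A, p.2 \in B & forall u, u \in p.1 -> u \notin B].

Definition verts (p : seq T * T) := rcons p.1 p.2.

Definition linkage B (ps : seq (seq T * T)) :=
  uniq (flatten (map verts ps)) /\ forall p, p \in ps -> AB_path B p.

Lemma linkage_perm B ps ps' : perm_eq ps ps' -> linkage B ps -> linkage B ps'.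
Proof.
move=> pp [U H]; split.
  by rewrite -(perm_uniq (perm_flatten (perm_map verts pp))).
by move=> p pps; apply: H; rewrite (perm_mem pp).
Qed.

Lemma split_last (P : pred T) s : has P s -> exists s1 x s2, [/\ s = s1 ++ x :: s2, P x & ~~ has P s2].
Proof.
elim: s => //= a s IH; have [/IH[s1 [x [s2 [-> Px Ps]]]] _|Ns] := boolP (has P s).
  by exists (a :: s1), x, s2.
by rewrite orbF => Pa; exists [::], a, s.
Qed.

Lemma split_first B s : has (mem B) s -> exists q x t,
  [/\ s = rcons q x ++ t, x \in B & forall u, u \in q -> u \notin B].
Proof.
case/split_find=> x q t xB nq; exists q, x, t; split=> // u uq.
by apply: contra nq => uB; apply/hasP; exists u.
Qed.

Lemma suffix_rcons s y s1 x s2 : rcons s y = s1 ++ x :: s2 ->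
  [/\ last x s2 = y, {subset belast x s2 <= s} & s = s1 ++ belast x s2].
Proof.
rewrite [x :: s2]lastI -rcons_cat => /rcons_inj[-> <-]; split=> // u uB.
by rewrite mem_cat uB orbT.
Qed.

(** The prolongation runs inside [B'], which [q] avoids, so no vertex is repeated. *)
Lemma ab_ext B B' q x t : AB_path B' (q, x) -> path e x t -> uniq (x :: t) ->
    {subset t <= B'} -> last x t \in B -> B \subset B' ->
    (forall u, u \in belast x t -> u \notin B) ->
  AB_path B (q ++ belast x t, last x t).
Proof.
case=> /= sq uq hq xB qB pt ut tB lB BB bB; split=> //=.
- rewrite rcons_cat -lastI -cat_rcons; move: sq.
  case: q {uq hq qB} => [|a q] //=; by rewrite cat_path last_rcons => ->.
- rewrite rcons_cat -lastI cat_uniq /= ut andbT.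
  move: uq; rewrite rcons_uniq negb_or => /andP[-> ->] /=.
  by apply/hasPn => u /tB uB; apply/negP => /qB; rewrite uB.
- by case: q hq {sq uq qB} => //; case: t {pt ut tB lB bB}.
- move=> u; rewrite mem_cat => /orP[/qB|/bB//]; apply: contra; exact: (subsetP BB).
Qed.

Lemma uniq_extend (p1 p2 t1 t2 F : seq T) : uniq (p1 ++ p2 ++ F) -> uniq (t1 ++ t2) ->
    (forall u, u \in t1 ++ t2 -> u \notin p1 ++ p2 ++ F) ->
  uniq ((p1 ++ t1) ++ (p2 ++ t2) ++ F).
Proof.
move=> U1 U2 H; rewrite (perm_uniq (s2 := (t1 ++ t2) ++ (p1 ++ p2 ++ F))).
  rewrite cat_uniq U2 U1 andbT /=; apply/hasPn => u uF; apply: contraL uF; exact: H.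
apply/permP => P; rewrite !count_cat; nlia.
Qed.

(* Menger's theorem in the augmenting form of Boehme, Goering and Harant: the
   ends in B of the given paths remain ends. *)
Theorem augment B ps : linkage B ps ->
    (forall Z, #|Z| <= size ps ->
       exists2 p, AB_path B p & forall u, u \in verts p -> u \notin Z) ->
  exists ps', [/\ linkage B ps', size ps' = (size ps).+1 &
    {subset map snd ps <= map snd ps'}].
Proof.
have [m] := ubnP (size (flatten (map verts ps))).
elim: m B ps => // m IHm B ps szm Lps HZ; have [Ups Hps] := Lps.
(* This path avoids the ends of [ps]. If it meets [ps], its last vertex x there is therefore not an
   end, and the path P of [ps] through x can be cut short at x. *)
have [|[r z] Rab RZ] := HZ [set y | y \in map snd ps].
  by rewrite cardsE -(size_map snd ps) card_size.
have [/split_last[r1 [x [R2 [Er xF nF]]]]|/hasPn nF] :=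
  boolP (has (mem (flatten (map verts ps))) (rcons r z)); last first.
  exists ((r, z) :: ps); split=> //.
  - split; last by move=> p; rewrite inE => /predU1P[->//|/Hps].
    rewrite /= cat_uniq Ups andbT; case: Rab => _ -> _ _ _ /=.
    by apply/hasPn => u uF; apply: contraL uF => /nF.
  - by move=> u; rewrite inE orbC => ->.
case/flattenP: (xF) => _ /mapP[[s y] Pps ->]; rewrite /verts /= => xP.
have [ssP usP hsP yB sB] := Hps _ Pps; have [srR urR hrR zB rB] := Rab.
rewrite /= in ssP usP hsP yB sB srR urR hrR zB rB.
have xs : x \in s.
  move: xP; rewrite mem_rcons inE => /predU1P[xy|//].
  have := RZ x; rewrite /verts /= Er mem_cat mem_head orbT inE => /(_ isT)/negP[].
  by apply/mapP; exists (s, y).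
have [s1 [s2 Es]] : exists s1 s2, s = s1 ++ x :: s2 by case/splitPr: xs => s1 s2; exists s1, s2.
have [ps0 permps] : exists ps0, perm_eq ps ((s, y) :: ps0).
  by exists (rem (s, y) ps); apply: perm_to_rem.
have [U0 H0] := linkage_perm permps Lps.
rewrite /= in U0; pose F0 := flatten (map verts ps0); rewrite -/F0 /verts /= in U0.
have memF u : (u \in flatten (map verts ps)) = (u \in rcons s y) || (u \in F0).
  by rewrite (perm_mem (perm_flatten (perm_map verts permps))) /= mem_cat.
pose P2 := rcons s2 y.
have EP : rcons s y = s1 ++ x :: P2 by rewrite Es rcons_cat.
(* [B] is enlarged by x and the tails of P and R after x. The linkage cut at x has fewer vertices,
   so the induction applies to [B']. *)
pose B' := B :|: [set u | u \in x :: P2 ++ R2].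
have BB' : B \subset B' by apply: subsetUl.
have inB' u : (u \in B') = (u \in B) || (u \in x :: P2 ++ R2) by rewrite !inE.
have F0lasts u : u \in map snd ps0 -> u \in F0.
  case/mapP=> p pps0 ->; apply/flattenP; exists (verts p); first exact: map_f.
  by rewrite /verts mem_rcons mem_head.
move: U0; rewrite EP !cat_uniq -/P2 /= => /and3P[/and3P[us1 s1P2 /andP[xP2 uP2]] PF0 uF0].
have R2F u : u \in R2 -> u \notin flatten (map verts ps) by move=> uR; apply: (hasPn nF).
have PnotF0 u : u \in rcons s y -> u \notin F0.
  by rewrite EP => uP; apply: contra PF0 => uF; apply/hasP; exists u.
have R2x : x \notin R2 by apply/negP => /R2F/negP[].
have uR2 : uniq R2 by move: urR; rewrite Er cat_uniq /= => /and4P[].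
have [lR bR _] := suffix_rcons Er; have [lP bP _] := suffix_rcons EP.
have xB : x \notin B by apply: sB.
have pR : path e x R2 by move: srR; rewrite Er; case: (r1) => [|a r1'] //=; rewrite cat_path => /and3P[].
have pP : path e x P2 by move: ssP; rewrite EP; case: (s1) => [|a r1'] //=; rewrite cat_path => /and3P[].
have L1 : linkage B' ((s1, x) :: ps0).
  split.
    rewrite /= -/F0 /verts /= cat_uniq rcons_uniq us1 uF0 !andbT.
    move: s1P2; rewrite /= negb_or => /andP[-> _] /=.
    apply/hasPn => u uF; apply: contraL uF; rewrite mem_rcons -[_ \in x :: s1]orbF.
    move=> us; apply: PnotF0; rewrite EP mem_cat inE; move: us; rewrite inE orbF.
    by case/orP=> ->; rewrite ?orbT.
  move=> p; rewrite inE => /predU1P[->|pps0].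
    split=> /=.
    - by move: ssP; rewrite EP -cat_rcons => /cat_sorted2[].
    - by rewrite rcons_uniq us1 andbT; move: s1P2; rewrite negb_or => /andP[].
    - by move: hsP; rewrite Es; case: (s1).
    - by rewrite inB' mem_head orbT.
    - move=> u us1'; rewrite inB' negb_or; apply/andP; split.
        by apply: sB; rewrite Es mem_cat us1'.
      rewrite -cat_cons mem_cat negb_or; apply/andP; split.
        move: s1P2; rewrite negb_or => /andP[xs1 /hasPn h2].
        by apply: contraL us1'; rewrite inE => /predU1P[->|/h2].
      apply/negP => /R2F; rewrite memF EP mem_cat us1' //.
  have pps : p \in ps by rewrite (perm_mem permps) inE pps0 orbT.
  have [h1 h2 h3 h4 h5] := Hps _ pps; split=> //.
    by rewrite inB' h4.
  move=> u up; rewrite inB' negb_or h5 //=.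
  have uF : u \in F0.
    by apply/flattenP; exists (verts p); [exact: map_f|rewrite /verts mem_rcons inE up orbT].
  rewrite -cat_cons mem_cat negb_or; apply/andP; split.
    apply: contraL uF => uP; apply: PnotF0; by rewrite EP mem_cat uP orbT.
  by apply/negP => /R2F; rewrite memF uF orbT.
have szps : size ps = (size ps0).+1 by rewrite (perm_size permps).
have [|Z cZ|ps1 [L1' sz1 sub1]] := IHm _ _ _ L1.
- move: szm; rewrite (perm_size (perm_flatten (perm_map verts permps))) /= !size_cat.
  rewrite /verts /= !size_rcons Es size_cat /=; nlia.
- have [|[q w] [h1 h2 h3 h4 h5] hZ] := HZ Z; first by rewrite szps.
  rewrite /= in h1 h2 h3 h4 h5.
  have hq : has (mem B') (rcons q w).
    by apply/hasP; exists w; [rewrite mem_rcons mem_head|exact: (subsetP BB')].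
  have [q1 [w' [q2 [Eq w'B nq]]]] := split_first hq.
  exists (q1, w'); last by move=> u; rewrite /verts /= => uq; apply: hZ; rewrite /verts /= Eq mem_cat uq.
  split=> //=.
  + by move: h1; rewrite Eq => /cat_sorted2[].
  + by move: h2; rewrite Eq cat_uniq => /andP[].
  + move: h3; have : head w (rcons q w) = head w q by case: (q).
    by rewrite Eq; case: (q1) => [|a q1'] /= <-.
have xl1 : x \in map snd ps1 by apply: sub1; rewrite mem_head.
case/mapP: xl1 => [[q x'] qps /= xx']; subst x'.
have [rest perm1] : exists rest, perm_eq ps1 ((q, x) :: rest).
  by exists (rem (q, x) ps1); apply: perm_to_rem.
have L2 := linkage_perm perm1 L1'.
have szr : size rest = (size ps0).+1 by move: sz1; rewrite (perm_size perm1) /= => -[].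
have uniq_lasts (X : {set T}) (ls : seq (seq T * T)) : linkage X ls -> uniq (map snd ls).
  case=> + _; elim: ls => //= p ls IH; rewrite cat_uniq => /and3P[_ H /IH->]; rewrite andbT.
  apply: contra H => /mapP[p' pls Ep]; apply/hasP; exists p.2; last by rewrite mem_rcons mem_head.
  rewrite Ep; apply/flattenP; exists (verts p'); first exact: map_f.
  by rewrite mem_rcons mem_head.
have := uniq_lasts _ _ L2; rewrite /= => /andP[xrest urest].
have := uniq_lasts _ _ L1; rewrite /= => /andP[xps0 ups0].
have sub2 : {subset map snd ps0 <= map snd rest}.
  move=> u u0; have : u \in map snd ps1 by apply: sub1; rewrite inE u0 orbT.
  rewrite (perm_mem (perm_map snd perm1)) /= inE => /predU1P[ux|//].
  by rewrite -ux u0 in xps0.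
(* The linkage to [B'] ends at x, at the ends of [ps0], and at exactly one new vertex w. *)
have [w wrest wps0] : exists2 w, w \in map snd rest & w \notin map snd ps0.
  apply/hasP; apply: contraT => /hasPn H.
  have : size (map snd rest) <= size (map snd ps0).
    by apply: uniq_leq_size => // u /H; rewrite negbK.
  by rewrite !size_map szr ltnn.
case/mapP: wrest => [[q' w'] q'rest /= ww']; subst w'.
have [rest0 perm2] : exists rest0, perm_eq rest ((q', w) :: rest0).
  by exists (rem (q', w) rest); apply: perm_to_rem.
have perm3 : perm_eq ps1 [:: (q, x), (q', w) & rest0].
  by rewrite (perm_trans perm1) // perm_cons.
have [U3 H3] := linkage_perm perm3 L1'.
have szr0 : size rest0 = size ps0 by move: szr; rewrite (perm_size perm2) /= => -[].
have sub3 : {subset map snd ps0 <= map snd rest0}.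
  move=> u u0; have := sub2 u u0; rewrite (perm_mem (perm_map snd perm2)) /= inE.
  by case/predU1P=> // uw; rewrite -uw u0 in wps0.
have eq3 : map snd rest0 =i map snd ps0.
  have ur0 : uniq (map snd rest0).
    by move: urest; rewrite (perm_uniq (perm_map snd perm2)) /= => /andP[].
  have [|_ E] := uniq_min_size ups0 sub3; first by rewrite !size_map szr0.
  by move=> u; rewrite E.
have wx : w != x.
  apply: contraNneq xrest => <-; rewrite (perm_mem (perm_map snd perm2)); exact: mem_head.
set F3 := flatten (map verts rest0) in U3.
rewrite /= -/F3 /verts /= in U3.
have abq : AB_path B' (q, x) by apply: H3; rewrite mem_head.
have abq' : AB_path B' (q', w) by apply: H3; rewrite !inE eqxx orbT.
have B'ends u : u \in rcons q x ++ rcons q' w ++ F3 -> u \in B' ->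
    [\/ u = x, u = w | u \in map snd ps0].
  move=> + uB; rewrite !mem_cat !mem_rcons !inE.
  case: abq abq' => /= _ _ _ _ nq [/= _ _ _ _ nq'].
  case/or3P => [/predU1P[->|/nq]|/predU1P[->|/nq']|]; rewrite ?uB //; try by constructor.
  case/flattenP=> _ /mapP[p prest ->]; rewrite /verts mem_rcons inE => /predU1P[->|].
    by apply: Or33; rewrite -eq3 map_f.
  have [|_ _ _ _ H] := H3 p; first by rewrite !inE prest !orbT.
  by move/H; rewrite uB.
(* The paths ending at x and w are continued to [B] by disjoint tails. One of these reaches y, so no
   old end is lost. *)
have finish t1 t2 : path e x t1 -> path e w t2 -> uniq (t1 ++ t2) -> x \notin t1 -> w \notin t2 ->
    {subset t1 ++ t2 <= P2 ++ R2} -> w \notin t1 -> x \notin t2 ->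
    last x t1 \in B -> last w t2 \in B ->
    (forall u, u \in belast x t1 -> u \notin B) ->
    (forall u, u \in belast w t2 -> u \notin B) ->
    (y = last x t1 \/ y = last w t2) ->
  exists ps', [/\ linkage B ps', size ps' = (size ps).+1 &
    {subset map snd ps <= map snd ps'}].
  move=> pt1 pt2 ut xt1 wt2 tsub wt1 xt2 lt1 lt2 bt1 bt2 ylast.
  have tB u : u \in t1 ++ t2 -> u \in B'.
    by move=> /tsub uPR; rewrite inB' inE uPR !orbT.
  have ut1 : uniq t1 by move: ut; rewrite cat_uniq => /andP[].
  have ut2 : uniq t2 by move: ut; rewrite cat_uniq => /and3P[].
  exists [:: (q ++ belast x t1, last x t1), (q' ++ belast w t2, last w t2) & rest0].
  split; last 2 first.
  - by rewrite /= szr0 szps.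
  - move=> u; rewrite (perm_mem (perm_map snd permps)) /= !inE -eq3.
    by case/predU1P=> [->|->]; rewrite ?orbT //; case: ylast => ->; rewrite eqxx ?orbT.
  split.
    rewrite /= -/F3 /verts /= !rcons_cat -!lastI -!cat_rcons; apply: uniq_extend => //.
    move=> u ut'; apply/negP => uin.
    case: (B'ends u uin (tB u ut')) => [ux|uw|u0].
    - by move: ut'; rewrite ux mem_cat (negbTE xt1) (negbTE xt2).
    - by move: ut'; rewrite uw mem_cat (negbTE wt1) (negbTE wt2).
    - have uF := F0lasts _ u0; have := tsub u ut'; rewrite mem_cat => /orP[uP|/R2F].
        by have := PnotF0 u; rewrite EP mem_cat inE uP !orbT uF => /(_ isT).
      by rewrite memF uF orbT.
  move=> p; rewrite !inE => /or3P[/eqP->|/eqP->|prest].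
  - apply: ab_ext abq _ _ _ _ BB' bt1 => //; first by rewrite /= xt1.
    by move=> u ut'; apply: tB; rewrite mem_cat ut'.
  - apply: ab_ext abq' _ _ _ _ BB' bt2 => //; first by rewrite /= wt2.
    by move=> u ut'; apply: tB; rewrite mem_cat ut' orbT.
  - have [|h1 h2 h3 h4 h5] := H3 p; first by rewrite !inE prest !orbT.
    split=> //; last by move=> u /h5; apply: contra; exact: (subsetP BB').
    have : p.2 \in map snd ps0 by rewrite -eq3 map_f.
    case/mapP=> p' p'0 ->; have [|//] := Hps p'.
    by rewrite (perm_mem permps) inE p'0 orbT.
have wB' : w \in B' by case: abq'.
(* If w lies on one tail, it keeps that tail and x takes the other; if on neither, w is already in
   [B] and x follows P. *)
have [wP2|wP2] := boolP (w \in P2).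
  have [P3 [P4 E4]] : exists P3 P4, P2 = P3 ++ w :: P4.
    by case/splitPr: wP2 => P3 P4; exists P3, P4.
  have E4' : rcons s y = (s1 ++ x :: P3) ++ w :: P4 by rewrite EP E4 -catA.
  have [l4 b4 _] := suffix_rcons E4'.
  have P4P2 u : u \in P4 -> u \in P2 by move=> uP; rewrite E4 mem_cat inE uP !orbT.
  have R2P2 u : u \in R2 -> u \notin P2.
    by move/R2F; rewrite memF EP; apply: contra => uP; rewrite mem_cat inE uP !orbT.
  move: uP2; rewrite E4 cat_uniq /= => /and4P[_ _ wP4 uP4].
  apply: (finish R2 P4) => //.
  - by move: pP; rewrite E4 cat_path /= => /and3P[].
  - rewrite cat_uniq uR2 uP4 andbT /=; apply/hasPn => u /P4P2; apply: contraL; exact: R2P2.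
  - by move=> u; rewrite !mem_cat => /orP[->|/P4P2->]; rewrite ?orbT.
  - by apply: contraL wP2; apply: R2P2.
  - by apply: contra xP2; apply: P4P2.
  - by rewrite lR.
  - by rewrite l4.
  - by move=> u /bR/rB.
  - by move=> u /b4/sB.
  - by right.
have [wR2|wR2] := boolP (w \in R2).
  have [R3 [R4 E4]] : exists R3 R4, R2 = R3 ++ w :: R4.
    by case/splitPr: wR2 => P3 P4; exists P3, P4.
  have E4' : rcons r z = (r1 ++ x :: R3) ++ w :: R4 by rewrite Er E4 -catA.
  have [l4 b4 _] := suffix_rcons E4'.
  have R4R2 u : u \in R4 -> u \in R2 by move=> uP; rewrite E4 mem_cat inE uP !orbT.
  have R2P2 u : u \in R2 -> u \notin P2.
    by move/R2F; rewrite memF EP; apply: contra => uP; rewrite mem_cat inE uP !orbT.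
  move: uR2; rewrite E4 cat_uniq /= => /and4P[_ _ wP4 uP4].
  apply: (finish P2 R4) => //.
  - by move: pR; rewrite E4 cat_path /= => /and3P[].
  - rewrite cat_uniq uP2 uP4 andbT /=; apply/hasPn => u /R4R2; exact: R2P2.
  - by move=> u; rewrite !mem_cat => /orP[->|/R4R2->]; rewrite ?orbT.
  - by apply: contra R2x; apply: R4R2.
  - by rewrite lP.
  - by rewrite l4.
  - by move=> u /bP/sB.
  - by move=> u /b4/rB.
  - by left.
apply: (finish P2 [::]) => //.
- by rewrite cats0.
- by move=> u; rewrite cats0 mem_cat => ->.
- by rewrite lP.
- by move: wB'; rewrite inB' inE mem_cat (negbTE wP2) (negbTE wR2) (negbTE wx) !orbF.
- by move=> u /bP/sB.
- by left.
Qed.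

End Menger.

(** * Menger's theorem in terms of vertex sets, and joining of paths *)

Section Linkages.

Variables (T : finType) (e : rel T).
Hypothesis e_sym : symmetric e.
Implicit Types (A B L M S W X Y Z : {set T}) (x y z w u a b m : T).

(** In contrast to [Pth], [S] is exactly the vertex set of the path, so that it can be split at any
    of its vertices. *)
Definition xpath S x y := exists p, [/\ path e x p, last x p = y, uniq (x :: p) &
  S = [set u in x :: p]].

Lemma xpath_Pth S x y : xpath S x y -> exists n, Pth e S x y n.
Proof.
case=> p [ep lp up ->]; exists (size (x :: p)), p => //; split=> // u; by rewrite !inE.
Qed.

Lemma xpath_ends S x y : xpath S x y -> x \in S /\ y \in S.
Proof. by case/xpath_Pth=> n /Pth_in. Qed.

Lemma Pth_xpath S x y n : Pth e S x y n -> exists2 S' : {set T}, S' \subset S & xpath S' x y.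
Proof.
case=> p ep [lp up sp _]; exists [set u in x :: p]; last by exists p.
by apply/subsetP => u; rewrite inE => /sp.
Qed.

Lemma xpath_sym S x y : xpath S x y -> xpath S y x.
Proof.
case=> p [ep lp up ->]; exists (rev (belast x p)); split.
- by rewrite -lp rev_path; apply: sub_path ep => a b; rewrite e_sym.
- by case: p lp {ep up} => [|b p] //= <-; rewrite rev_cons last_rcons.
- by rewrite -lp -rev_rcons -lastI rev_uniq.
- by apply/setP => u; rewrite !inE -lp -in_cons -[RHS]in_cons -rev_rcons -lastI mem_rev.
Qed.

Lemma xpath_split S x y m : xpath S x y -> m \in S -> exists S1 S2,
  [/\ S = S1 :|: S2, S1 :&: S2 = [set m], xpath S1 x m & xpath S2 m y].
Proof.
case=> p [ep lp up ->]; rewrite inE => mp.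
have [p1 [p2 [Ep lp1]]] : exists p1 p2, p = p1 ++ p2 /\ last x p1 = m.
  by case/splitPl: mp => p1 p2 lp1; exists p1, p2.
move: ep lp up; rewrite Ep cat_path lp1 => /andP[ep1 ep2]; rewrite last_cat lp1 => lp2.
rewrite -cat_cons cat_uniq => /and3P[u1 nu u2].
have mp1 : m \in x :: p1 by rewrite -lp1 mem_last.
have mp2 : m \notin p2.
  by apply/negP => mp2; case/hasP: nu; exists m.
exists [set u in x :: p1], [set u in m :: p2]; split.
- apply/setP => u; rewrite !inE mem_cat.
  case: (eqVneq u m) => [->|]; last by rewrite orbA.
  by move: mp1; rewrite inE orbA => ->.
- apply/setP => u; rewrite in_setI !inE -in_cons andb_orr.
  case: (eqVneq u m) => [->|um]; first by rewrite mp1.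
  rewrite andbF /=; apply/negP => /andP[u1' u2']; by case/hasP: nu; exists u.
- by exists p1.
- by exists p2; split=> //=; rewrite mp2.
Qed.

Definition restrict M := [rel x y | [&& x \in M, y \in M & e x y]].

(** [X] stands for what [A] reaches in [M] without [Z]; as a closed set that misses [B], it
    certifies that [Z] separates. *)
Definition separates A B M Z X := [&& A :\: Z \subset X, [disjoint X & Z], [disjoint X & B] &
  [forall w in X, forall y, restrict M w y ==> (y \in Z) || (y \in X)]].

Lemma ab_or A B M Z : (exists2 p, AB_path (restrict M) A B p & forall u, u \in verts p -> u \notin Z) \/
  exists X, separates A B M Z X.
Proof.
pose r := [rel x y | [&& x \notin Z, y \notin Z & restrict M x y]].
pose X := [set y | [exists a in A :\: Z, connect r a y]].
have [/existsP[b /andP[bX bB]]|/existsPn H] := boolP [exists b, (b \in X) && (b \in B)].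
  left; move: bX; rewrite inE => /exists_inP[a /setDP[aA aZ] /connectP[p0 rp0 lp0]].
  case: (shortenP rp0) lp0 => p rp up _ lp {p0 rp0}.
  have hB : has (mem B) (a :: p) by apply/hasP; exists b; rewrite // lp mem_last.
  have avoid u : u \in a :: p -> u \notin Z.
    rewrite inE => /predU1P[->//|up'].
    elim: p (a) rp up' {up lp aA aZ hB} => //= c p IH a' /andP[/and3P[_ cZ _] rp].
    by rewrite inE => /predU1P[->//|]; apply: IH rp.
  have sp : sorted (restrict M) (a :: p) by apply: sub_path rp => x y /and3P[].
  have [q [x [t [E xB nq]]]] := split_first hB.
  exists (q, x); last by move=> u uq; apply: avoid; rewrite E mem_cat uq.
  split=> //=.
  - by move: sp; rewrite E => /cat_sorted2[].
  - by move: up; rewrite E cat_uniq => /andP[].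
  - by move: aA; case: q E {nq} => [|c q] [-> _].
right; exists X; apply/and4P; split.
- apply/subsetP => a aA; rewrite inE; apply/exists_inP; exists a; by rewrite ?connect0.
- apply: disjP => y; rewrite inE => /exists_inP[a /setDP[_ aZ] /connectP[p rp ->]].
  elim: p a aZ rp => //= c p IH a aZ /andP[/and3P[_ cZ _]]; exact: IH.
- by apply: disjP => y yX; have := H y; rewrite yX.
- apply/forall_inP => w wX; apply/forallP => y; apply/implyP => rwy.
  have wZ : w \notin Z.
    move: wX; rewrite inE => /exists_inP[a /setDP[_ aZ] /connectP[p rp ->]].
    elim: p a aZ rp => //= c p IH a aZ /andP[/and3P[_ cZ _]]; exact: IH.
  case yZ: (y \in Z) => //=; move: wX; rewrite !inE => /exists_inP[a aA aw].
  apply/exists_inP; exists a => //; apply: connect_trans aw _; apply: connect1.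
  by rewrite /= wZ yZ; exact: rwy.
Qed.

(** A path that stops as soon as it meets [B], but may pass through [A] repeatedly. *)
Definition leg A B M S a b := [/\ xpath S a b, a \in A, b \in B, S \subset M &
  forall u, u \in S -> u \in B -> u = b].

Lemma ab_leg A B M p : A \subset M -> AB_path (restrict M) A B p ->
  exists a, leg A B M [set u in verts p] a p.2.
Proof.
case: p => [q b] AM [/= sq uq hq bB nq].
have [a [p [E lp]]] : exists a p, rcons q b = a :: p /\ last a p = b.
  case: q {sq uq hq nq} => [|a q]; first by exists b, [::].
  by exists a, (rcons q b); rewrite last_rcons.
have aA : a \in A by move: hq E; case: (q) => [|c q'] /= hA [<-].
exists a; rewrite /verts /= E; move: sq uq; rewrite E => sq uq; split=> //.
- exists p; split=> //; by apply: sub_path sq => x y /and3P[].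
- apply/subsetP => u; rewrite inE inE => /predU1P[->|]; first exact: (subsetP AM).
  elim: p (a) sq {uq E lp aA} => //= c p IH a' /andP[/and3P[_ cM _] rp].
  by rewrite inE => /predU1P[->//|]; apply: IH rp.
- move=> u; rewrite inE -E mem_rcons inE => /predU1P[//|/nq uB]; by rewrite (negbTE uB).
Qed.

Lemma disjoint_seqs (s t : seq T) : ~~ has (mem s) t ->
  [disjoint [set u in s] & [set u in t]].
Proof.
move/hasPn=> H; apply: disjP => u; rewrite !inE => us; by apply: contraL us => /H.
Qed.

Lemma linkage2 A B M p1 p2 : A \subset M -> linkage (restrict M) A B [:: p1; p2] ->
  exists S1 a1 S2 a2, [/\ leg A B M S1 a1 p1.2, leg A B M S2 a2 p2.2 & [disjoint S1 & S2]].
Proof.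
move=> AM [U H]; have [|a1 L1] := ab_leg AM (H p1 _); first by rewrite mem_head.
have [|a2 L2] := ab_leg AM (H p2 _); first by rewrite !inE eqxx orbT.
exists [set u in verts p1], a1, [set u in verts p2], a2; split=> //; apply: disjoint_seqs.
by move: U; rewrite /= cats0 cat_uniq => /and3P[].
Qed.

Lemma linkage3 A B M p1 p2 p3 : A \subset M -> linkage (restrict M) A B [:: p1; p2; p3] ->
  exists S1 a1 S2 a2 S3 a3,
    [/\ leg A B M S1 a1 p1.2, leg A B M S2 a2 p2.2, leg A B M S3 a3 p3.2 &
    [/\ [disjoint S1 & S2], [disjoint S1 & S3] & [disjoint S2 & S3]]].
Proof.
move=> AM [U H]; have [|a1 L1] := ab_leg AM (H p1 _); first by rewrite mem_head.
have [|a2 L2] := ab_leg AM (H p2 _); first by rewrite !inE eqxx orbT.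
have [|a3 L3] := ab_leg AM (H p3 _); first by rewrite !inE eqxx !orbT.
exists [set u in verts p1], a1, [set u in verts p2], a2, [set u in verts p3], a3.
move: U; rewrite /= cats0 !cat_uniq has_cat negb_or => /and3P[_ /andP[h12 h13] /and3P[_ h23 _]].
by split=> //; split=> //; apply: disjoint_seqs.
Qed.

Lemma menger A B M n : (forall Z X, #|Z| < n -> ~~ separates A B M Z X) ->
  exists2 ps, linkage (restrict M) A B ps & size ps = n.
Proof.
elim: n => [|n IH] H; first by exists [::].
have [|ps Lps szps] := IH; first by move=> Z X Zn; apply: H; apply: ltnW.
have [|ps' [Lps' szps' _]] := augment Lps; last by exists ps'; rewrite ?szps' ?szps.
move=> Z; rewrite szps => Zn; have [//|[X]] := ab_or A B M Z.
by rewrite (negbTE (H Z X _)).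
Qed.

Lemma menger2 A B M : A \subset M -> (forall Z X, #|Z| < 2 -> ~~ separates A B M Z X) ->
  exists S1 a1 b1 S2 a2 b2, [/\ leg A B M S1 a1 b1, leg A B M S2 a2 b2 & [disjoint S1 & S2]].
Proof.
move=> AM /menger[[|p1 [|p2 [|]]]] // L _.
have [S1 [a1 [S2 [a2 [H1 H2 H12]]]]] := linkage2 AM L.
by exists S1, a1, p1.2, S2, a2, p2.2.
Qed.

Lemma menger3 A B M : A \subset M -> (forall Z X, #|Z| < 3 -> ~~ separates A B M Z X) ->
  exists S1 a1 b1 S2 a2 b2 S3 a3 b3,
    [/\ leg A B M S1 a1 b1, leg A B M S2 a2 b2, leg A B M S3 a3 b3 &
    [/\ [disjoint S1 & S2], [disjoint S1 & S3] & [disjoint S2 & S3]]].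
Proof.
move=> AM /menger[[|p1 [|p2 [|p3 [|]]]]] // L _.
have [S1 [a1 [S2 [a2 [S3 [a3 H]]]]]] := linkage3 AM L.
by exists S1, a1, p1.2, S2, a2, p2.2, S3, a3, p3.2.
Qed.

Lemma leg_in A B M S a b : leg A B M S a b -> a \in S /\ b \in S.
Proof. by case=> /xpath_ends. Qed.

Definition flexible S x y k := exists b : nat, forall i, i < k -> Pth e S x y (b + 2 * i).

Lemma flexible_sym S x y k : flexible S x y k -> flexible S y x k.
Proof. by case=> b H; exists b => i /H; apply: Pth_sym. Qed.

Lemma flexible_sub S S' x y k : S \subset S' -> flexible S x y k -> flexible S' x y k.
Proof. by move=> sub [b H]; exists b => i /H; apply: Pth_sub. Qed.

Lemma flexible_joinl S1 S2 x y z k : S1 :&: S2 \subset [set y] -> xpath S1 x y -> flexible S2 y z k ->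
  flexible (S1 :|: S2) x z k.
Proof.
move=> dis /xpath_Pth[n P] [b H]; exists (n + b).-1 => i ik.
have := Pth_join dis P (H i ik); have := Pth_pos P.
by case: n {P} => // n _; rewrite addnA.
Qed.

Lemma flexible_joinr S1 S2 x y z k : S1 :&: S2 \subset [set y] -> flexible S1 x y k -> xpath S2 y z ->
  flexible (S1 :|: S2) x z k.
Proof.
move=> dis /flexible_sym P1 /xpath_sym P2; apply: flexible_sym; rewrite setUC.
by apply: flexible_joinl P2 P1; rewrite setIC.
Qed.

Lemma xpath_trim S x y A : xpath S x y -> y \in A -> exists (S' : {set T}) m,
  [/\ S' \subset S, xpath S' x m, m \in A & forall u, u \in S' -> u \in A -> u = m].
Proof.
case=> p [ep lp up ->] yA.
have hA : has (mem A) (x :: p) by apply/hasP; exists y; rewrite // -lp mem_last.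
have [q [m [t [E mA nq]]]] := split_first hA.
have [p' Ep'] : exists p', rcons q m = x :: p'.
  by case: q E {nq} => [|c q] [-> _]; [exists [::]|exists (rcons q m)].
have lp' : last x p' = m by have := congr1 (last x) Ep'; rewrite last_rcons.
exists [set u in rcons q m], m; split=> //.
- by apply/subsetP => u; rewrite !inE -in_cons E mem_cat => ->.
- exists p'; rewrite -Ep'; split=> //.
    have : sorted e (x :: p) by [].
    by rewrite E Ep' => /cat_sorted2[].
  by move: up; rewrite E cat_uniq => /andP[].
- move=> u; rewrite inE mem_rcons inE => /predU1P[//|/nq uA]; by rewrite (negbTE uA).
Qed.

Lemma leg_ab A B M S a m : leg A B M S a m -> exists2 q, AB_path (restrict M) A B (q, m) &
  S = [set u in verts (q, m)].
Proof.
case=> [[p [ep lp up ES]]] aA mB SM SB.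
have E : rcons (belast a p) m = a :: p by rewrite -lp -lastI.
have pM : {subset a :: p <= M} by move=> u up'; apply: (subsetP SM); rewrite ES inE.
exists (belast a p); last by rewrite ES /verts E.
split=> //=; rewrite ?E //.
- rewrite /=; elim: p a ep pM {lp up ES E aA} => //= c p IH a /andP[eac ep] pM.
  rewrite eac !pM ?inE ?eqxx ?orbT //=; apply: IH => // u uc; apply: pM.
  by rewrite inE uc orbT.
- by case: (p) lp => [|c p'] //= <-.
- move=> u ub; apply/negP => uB.
  have uS : u \in S by rewrite ES inE -E mem_rcons inE ub orbT.
  by move: up; rewrite -E rcons_uniq -(SB u uS uB) ub.
Qed.

(** The boundary is taken on the inner side: a path coming from outside meets [Y] first in
    [bd Y]. *)
Definition bd Y := [set y in Y | [exists x, (x \notin Y) && e y x]].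

Lemma bdP Y y : reflect (y \in Y /\ exists2 x, x \notin Y & e y x) (y \in bd Y).
Proof.
rewrite inE; apply: (iffP andP) => [[-> /existsP[x /andP[xY eyx]]]|[-> [x xY eyx]]].
  by split=> //; exists x.
by split=> //; apply/existsP; exists x; rewrite xY.
Qed.

Lemma bd_sub Y : bd Y \subset Y.
Proof. by apply/subsetP => y /bdP[]. Qed.

(** The path can enter [Y] only through [bd Y], hence through [W], which it meets at [z] alone. A
    start in [W] is [z] itself. *)
Lemma xpath_avoid S a z Y W : xpath S a z -> bd Y \subset W ->
    (forall u, u \in S -> u \in W -> u = z) -> a \notin Y \/ a \in W ->
  forall u, u \in S -> u \in Y -> u = z.
Proof.
case=> p [ep lp up ->] /subsetP bW SW aYW u; rewrite inE => uap uY.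
have {}SW w : w \in a :: p -> w \in W -> w = z by move=> wp; apply: SW; rewrite inE.
elim: p a ep lp up SW aYW uap => [|c p IH] a /=.
  by move=> _ <- _ _ _; rewrite inE => /eqP.
move=> /andP[eac ep] lp /andP[ap up] SW aYW uap.
have aY : a \notin Y.
  case: aYW => // aW; apply: contra ap => _.
  by rewrite (SW a (mem_head _ _) aW) -lp mem_last.
apply: (IH c) => //.
- by move=> w wp; apply: SW; rewrite inE wp orbT.
- case cY: (c \in Y); [right|by left]; apply: bW; apply/bdP; split=> //.
  by exists a => //; rewrite e_sym.
- by move: uap; rewrite inE => /predU1P[ua|//]; rewrite -ua uY in aY.
Qed.

End Linkages.

Lemma Pth_rel (T : finType) (e e' : rel T) S x y n : subrel e e' -> Pth e S x y n -> Pth e' S x y n.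
Proof. by move=> sub [p ep H]; exists p => //; apply: sub_path ep. Qed.

(** * Flexible subgraphs *)

Section Lumps.

Variables (T : finType) (e : rel T) (col : T -> bool).
Hypothesis e_sym : symmetric e.
Hypothesis e_col : forall x y, e x y -> col x != col y.
Implicit Types (A D K L M S U X : {set T}) (x y z w u d c v : T).

(** A component of M - {x, y} sees both roots, for otherwise it would be a pocket at one of them
    without containing either. Neighbours of [x] become entries and neighbours of [y] exits, which
    makes up for the lost roots. *)
Lemma flexible_two_roots M x y k : 0 < k -> x \in M -> y \in M -> x != y -> hits_pockets e M [set x; y] ->
    (exists w, [/\ w \in M, w != x & w != y]) ->
    (forall w, w \in M -> w != x -> w != y -> k < deg e M w) ->
  flexible e M x y k.
Proof.
move=> k0 xM yM xy sM [w0 [w0M w0x w0y]] dM.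
have w0R : w0 \in M :\: [set x; y] by rewrite !inE negb_or w0x w0y.
have [K [KR w0K cloK cK]] := component_ex e_sym w0R.
have KM w : w \in K -> [/\ w \in M, w != x & w != y].
  by move=> /(subsetP KR); rewrite !inE negb_or => /andP[/andP[]].
have KS : K \subset M by apply/subsetP => w /KM[].
have xK : x \notin K by apply/negP => /KM[_]; rewrite eqxx.
have yK : y \notin K by apply/negP => /KM[_ _]; rewrite eqxx.
have nbrs w z : w \in K -> z \in M -> e w z -> [|| z \in K, z == x | z == y].
  move=> wK zM ewz; case zx: (z == x); first by rewrite orbT.
  case zy: (z == y); first by rewrite !orbT.
  by rewrite (cloK w z) // !inE zx zy.
have attach d d' : (d = x /\ d' = y) \/ (d = y /\ d' = x) -> K :&: nbr_set e [set d] != set0.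
  move=> apart; apply/negP => /eqP K0.
  have [|w wK] := sepP (d := d') (A := K) sM; last first.
    by case: (KM w wK) => _ wx wy; rewrite !inE (negbTE wx) (negbTE wy).
  apply/pocketP; split=> //; try by case: apart => -[_ ->].
  - by apply/set0Pn; exists w0.
  - move=> w z wK zM ewz; have nwd : z != d.
      apply/negP => /eqP zd; move/setP/(_ w): K0.
      by rewrite in_setI wK nbr_set1 in_set0 -zd ewz.
    case/or3P: (nbrs w z wK zM ewz) => [|/eqP zx|/eqP zy]; first by left.
      by case: apart nwd => -[-> ->]; rewrite ?zx ?eqxx //; right.
    by case: apart nwd => -[-> ->]; rewrite ?zy ?eqxx //; right.
have iK : instance e col K (K :&: nbr_set e [set x]) (K :&: nbr_set e [set y]) k.
  split=> //; try exact: subsetIl.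
  - by apply: (attach x y); left.
  - by apply: (attach y x); right.
  - exists (~~ col x) => w; rewrite in_setI nbr_set1 => /andP[_ /e_col].
    by case: (col w); case: (col x).
  - apply: sep_sub sM KS _ _ => [w /KM[_ wx wy]|w z wK zM zK ewz].
      by rewrite !inE (negbTE wx) (negbTE wy).
    rewrite in_setU !in_setI !nbr_set1 wK /=.
    by case/or3P: (nbrs w z wK zM ewz) zK => [->//|/eqP<-|/eqP<-]; rewrite ewz ?orbT.
  - move=> w wK _; have [wM wx wy] := KM w wK; have := dM w wM wx wy.
    rewrite !in_setI !nbr_set1 wK /=.
    have : deg e M w <= deg e K w + deg e [set x; y] w.
      by apply: deg_cover => z zM ewz; rewrite !inE; exact: nbrs ewz.
    have := degU e [set x] [set y] w; rewrite !deg1; nlia.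
have [b F] := core_fam e_sym e_col (fun=> 0) iK.
exists (b + 2) => i ik; have [|u [w [n []]]] := F i; first by move: ik; nlia.
rewrite !in_setI !nbr_set1 => /andP[uK eux] /andP[wK ewy] P En.
have exu : e x u by rewrite e_sym.
have dis2 : [disjoint K & [set y]].
  by apply: disjP => t tK; rewrite in_set1; apply: contraTneq tK => ->.
have dis1 : [disjoint [set x] & K :|: [set y]].
  by apply: disjP => t /set1P->; rewrite !inE negb_or xK.
rewrite (_ : b + 2 + 2 * i = 1 + (n + 1)); last by move: En; nlia.
apply: Pth_sub (Pth_cat dis1 exu (Pth1 e (set11 x)) (Pth_cat dis2 ewy P (Pth1 e (set11 y)))).
by rewrite !subUset !sub1set xM yM KS.
Qed.

Lemma Pth_parity S x y n : Pth e S x y n -> odd n = (col x == col y).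
Proof.
case=> p ep [lp _ _ <-] /=; elim: p x ep lp => [|z p IH] x /=; first by move=> _ ->; rewrite eqxx.
case/andP=> /e_col exz /IH{}IH /IH ->; move: exz.
by case: (col x); case: (col z); case: (col y).
Qed.

Definition biconn L := forall d, d \in L -> connected e (L :\ d).

Lemma biconn_sep L x y : biconn L -> x \in L -> y \in L -> x != y -> hits_pockets e L [set x; y].
Proof.
move=> bL xL yL xy; apply/forallP => d; apply/forallP => A; apply/implyP.
move=> /pocketP[dL AL dA A0 cA].
have /subsetP sub : L :\ d \subset A.
  apply: bL => //; first by apply/subsetP => w wA; rewrite !inE (subsetP AL _ wA) andbT;
    apply: contraTneq wA => ->.
  move=> w z wA; rewrite !inE => /andP[zd zL] ewz.
  by case: (cA w z wA zL ewz) => // zd'; rewrite zd' eqxx in zd.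
have [xd|xd] := eqVneq x d.
  apply/pred0Pn; exists y; rewrite /= !inE eqxx orbT andbT; apply: sub.
  by rewrite !inE yL andbT -xd eq_sym.
by apply/pred0Pn; exists x; rewrite /= !inE eqxx andbT; apply: sub; rewrite !inE xd.
Qed.

Lemma deg_D1 S c w : deg e S w <= (deg e (S :\ c) w).+1.
Proof.
rewrite -addn1; apply: leq_trans (leq_add (leqnn _) (leq_b1 (e w c))).
by rewrite -deg1; apply: deg_cover => y yS _; rewrite !inE yS andbT orNb.
Qed.

(* All vertices but c have a degree one larger than needed: either c can be
   deleted, or a part cut off by c and one more vertex provides the paths. *)
Lemma flexible_biconn L c k x y : 0 < k -> biconn L -> c \in L ->
    (forall w, w \in L -> w != c -> k.+1 < deg e L w) ->
    x \in L -> y \in L -> x != y ->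
  flexible e L x y k.
Proof.
move=> k0 bL cL dL xL yL xy.
have third a b : a \in L -> a != c -> exists w, [/\ w \in L, w != c, w != b & w != a].
  move=> aL ac; have := dL a aL ac.
  have := deg_D1 L c a; have := deg_D1 (L :\ c) b a => h1 h2 h3.
  have : 0 < deg e (L :\ c :\ b) a by move: h1 h2 h3 k0; nlia.
  rewrite -deg_nbr_set => /nbr_setP[w]; rewrite !inE => /andP[wb /andP[wc wL]] eaw; exists w; split=> //.
  by apply: contraTneq (e_col eaw) => ->; rewrite eqxx.
have viac a : a \in L -> a != c -> flexible e L a c k.
  move=> aL ac; apply: flexible_two_roots => //; first exact: biconn_sep.
    by have [w [wL wc _ wa]] := third a c aL ac; exists w.
  by move=> w wL wa wc; apply: leq_trans (dL w wL wc).
have [xc|xc] := eqVneq x c; first by subst x; apply: flexible_sym => //; apply: viac; rewrite // eq_sym.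
have [yc|yc] := eqVneq y c; first by subst y; apply: viac.
have sub1 : L :\ c \subset L by apply: subD1set.
have xD : x \in L :\ c by rewrite !inE xc.
have yD : y \in L :\ c by rewrite !inE yc.
have [sD|nsD] := boolP (hits_pockets e (L :\ c) [set x; y]).
  apply: flexible_sub sub1 _; apply: flexible_two_roots => //.
    by have [w [wL wc wy wx]] := third x y xL xc; exists w; rewrite !inE wc.
  move=> w; rewrite !inE => /andP[wc wL] _ _; have := dL w wL wc; have := deg_D1 L c w; nlia.
(* Outside itself [A] sees only d and [c]. It supplies the paths between these two, and two disjoint
   paths avoiding [A] link them to [x] and [y]. *)
have [d [A [/pocketP[dD AD dA A0 cA] cnA Axy [a aA ead]]]] := sepPn e_sym (bL c cL) nsD.
have /andP[dc dL'] : (d != c) && (d \in L) by move: dD; rewrite !inE.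
have cA' : c \notin A by apply/negP => /(subsetP AD); rewrite !inE eqxx.
have AL : A \subset L by apply: subset_trans sub1.
pose P := A :|: [set d; c].
have nbP' w z : w \in A -> z \in L -> e w z -> z \in P.
  move=> wA zL ewz; rewrite !inE; have [->|zc] := eqVneq z c; first by rewrite !orbT.
  by case: (cA w z wA _ ewz) => [|->|->]; rewrite ?inE ?zc // ?eqxx ?orbT.
have PL : P \subset L by rewrite !subUset AL !sub1set dL' cL.
have AP1 : flexible e P d c k.
  apply: flexible_two_roots => //; try by rewrite !inE eqxx ?orbT.
  - apply/forallP => d'; apply/forallP => A'; apply/implyP => /pocketP[d'P A'P d'A' A'0 cA''].
    apply/negP => dis.
    have A'A w : w \in A' -> w \in A.
      move=> wA'; have := subsetP A'P _ wA'; rewrite inE => /orP[//|wdc].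
      by move/pred0P/(_ w): dis; rewrite /= wA' wdc.
    have /subsetP sub : L :\ d' \subset A'.
      apply: bL; [exact: (subsetP PL)| |by []|].
        apply/subsetP => w wA'; rewrite !inE (subsetP AL _ (A'A _ wA')) andbT.
        by apply: contraTneq wA' => ->.
      move=> w z wA'; rewrite !inE => /andP[zd zL] ewz.
      have zP := nbP' w z (A'A w wA') zL ewz.
      by case: (cA'' w z wA' zP ewz) => // E; rewrite E eqxx in zd.
    have [xd|xd] := eqVneq x d'.
      have yA : y \in A by apply/A'A/sub; rewrite !inE yL -xd eq_sym xy.
      by have := Axy y yA; rewrite !inE eqxx orbT.
    have xA : x \in A by apply/A'A/sub; rewrite !inE xL xd.
    by have := Axy x xA; rewrite !inE eqxx.
  - exists a; rewrite !inE aA; split=> //; first by apply: contraTneq aA => ->.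
    by apply: contraTneq aA => ->.
  - move=> w; rewrite !inE orbC => /orP[/orP[]->//|wA] wd wc; rewrite ?andbF //.
    have wL := subsetP AL _ wA; have := dL w wL wc.
    have : deg e L w <= deg e P w + deg e set0 w.
      by apply: deg_cover => z zL ewz; rewrite (nbP' w).
    by rewrite (deg0 (S := set0)); [nlia|move=> z; rewrite inE].
have sxyM : [set x; y] \subset L :\: A.
  apply/subsetP => w wxy; rewrite inE; apply/andP; split.
    by apply/negP => /Axy; rewrite wxy.
  by case/set2P: wxy => ->.
(* One vertex q cannot separate: L - q is connected, and a set that avoids d and [c] cannot get out
   of it through [A]. *)
have noSep (Z X : {set T}) : #|Z| < 2 -> ~~ separates e [set x; y] [set d; c] (L :\: A) Z X.
  move=> Z2; apply/negP => /and4P[/subsetP XZ dXZ dXB /forall_inP cX].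
  have XB w : w \in X -> (w != d) && (w != c).
    by move=> wX; move/pred0P/(_ w): dXB; rewrite /= wX /= !inE => /norP/andP.
  have XnZ w : w \in X -> w \notin Z.
    by move=> wX; apply/negP => wZ; move/pred0P/(_ w): dXZ; rewrite /= wX wZ.
  have [q [qL qZ]] : exists q, q \in L /\ Z :&: L \subset [set q].
    have [/eqP Z0|/set0Pn[q]] := boolP (Z :&: L == set0).
      by exists x; rewrite Z0 sub0set.
    rewrite inE => /andP[qZ qL]; exists q; split=> //; apply/subsetP => t /setIP[tZ _].
    by have /card_le1_eqP ZZ : #|Z| <= 1; [by []|rewrite (ZZ t q) ?set11].
  have [r rX rL] : exists2 r, r \in X & r \in L :\ q /\ r \in L :\: A.
    have [xq|xq] := eqVneq x q.
      exists y; last by rewrite !inE yL -xq eq_sym xy; move/subsetP: sxyM => /(_ y); rewrite !inE eqxx orbT yL => /(_ isT).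
      apply: XZ; rewrite !inE eqxx orbT andbT; apply/negP => yZ.
      have /subsetP/(_ y) := qZ; rewrite !inE yZ yL => /(_ isT); by rewrite -xq eq_sym (negbTE xy).
    exists x; last by rewrite !inE xL xq; move/subsetP: sxyM => /(_ x); rewrite !inE eqxx xL => /(_ isT).
    apply: XZ; rewrite !inE eqxx andbT; apply/negP => xZ.
    by have /subsetP/(_ x) := qZ; rewrite !inE xZ xL (negbTE xq) => /(_ isT).
  have /subsetP sub : L :\ q \subset X :&: (L :\: A) :\ q.
    apply: bL => //.
    - by apply/subsetP => w; rewrite !inE => /and4P[-> _ _ ->].
    - by apply/set0Pn; exists r; move: rL; rewrite !inE rX /= => -[/andP[-> _] ->].
    - move=> w z; rewrite !inE => /and4P[wq wX wA wL] /andP[zq zL] ewz.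
      rewrite zq zL andbT /=.
      have zA : z \notin A.
        apply/negP => zA; have ezw : e z w by rewrite e_sym.
        have := nbP' z w zA wL ezw; rewrite !inE (negbTE wA) /=.
        by have /andP[/negbTE-> /negbTE->] := XB w wX.
      rewrite zA andbT.
      have /forallP/(_ z) := cX w wX; rewrite /= !inE wA wL zA zL ewz /= => /orP[zZ|//].
      by have /subsetP/(_ z) := qZ; rewrite !inE zZ zL (negbTE zq) => /(_ isT).
  have [dq|dq] := eqVneq d q.
    have := sub c; rewrite !inE -dq cL eq_sym dc /= => /(_ isT)/andP[cX' _].
    by have := XB c cX'; rewrite eqxx andbF.
  have := sub d; rewrite !inE dq dL' /= => /(_ isT)/andP[dX' _].
  by have := XB d dX'; rewrite eqxx.
have [S1 [a1 [b1 [S2 [a2 [b2 [L1 L2 dS]]]]]]] := menger2 sxyM noSep.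
have [a1S b1S] := leg_in L1; have [a2S b2S] := leg_in L2.
have [P1 a1A b1B S1M S1B] := L1; have [P2 a2A b2B S2M S2B] := L2.
have a12 : a1 != a2.
  by apply/negP => /eqP E; move/pred0P/(_ a1): dS; rewrite /= a1S E a2S.
have b12 : b1 != b2.
  by apply/negP => /eqP E; move/pred0P/(_ b1): dS; rewrite /= b1S E b2S.
have joint (S : {set T}) b : S \subset L :\: A -> (forall u, u \in S -> u \in [set d; c] -> u = b) ->
    S :&: P \subset [set b].
  move=> SM SB; apply/subsetP => u; rewrite in_setI in_set1 => /andP[uS].
  rewrite in_setU => /orP[uA|udc]; last by rewrite (SB u).
  by move: (subsetP SM _ uS); rewrite inE uA.
have APb : flexible e P b1 b2 k.
  case/set2P: b1B b12 => ->; case/set2P: b2B => ->; rewrite ?eqxx // => _.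
  exact: flexible_sym.
have AP12 : flexible e L a1 a2 k.
  have H1 := flexible_joinl (joint S1 b1 S1M S1B) P1 APb.
  have apart : (S1 :|: P) :&: S2 \subset [set b2].
    rewrite setIUl subUset setIC [P :&: _]setIC joint // andbT.
    by apply/subsetP => u /setIP[u2 u1]; move/pred0P/(_ u): dS; rewrite /= u1 u2.
  have := flexible_joinr e_sym apart H1 (xpath_sym e_sym P2); apply: flexible_sub.
  have SL (S : {set T}) : S \subset L :\: A -> S \subset L.
    by move/subset_trans; apply; exact: subsetDl.
  by apply/subUsetP; split; [apply/subUsetP; split=> //|]; exact: SL.
case/set2P: a1A a12 AP12 => ->; case/set2P: a2A => ->; rewrite ?eqxx // => _.
exact: flexible_sym.
Qed.

End Lumps.

(** * End blocks, and the choice between cycles and a lump *)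

Section Leaves.

Variables (T : finType) (e : rel T) (col : T -> bool).
Hypothesis e_sym : symmetric e.
Hypothesis e_col : forall x y, e x y -> col x != col y.
Implicit Types (A D K L M S U X : {set T}) (x y z w u d c v : T).

Definition out_nbrs M D := [set y in M :\: D | [exists w in D, e w y]].

Lemma out_nbrsP M D y : reflect [/\ y \in M, y \notin D & exists2 w, w \in D & e w y] (y \in out_nbrs M D).
Proof.
rewrite !inE; apply: (iffP andP) => [[/andP[-> ->] /exists_inP]|[-> -> [w wD ewy]]]; first by split.
by split=> //; apply/exists_inP; exists w.
Qed.

Lemma out_nbrs1 M D d : (forall w y, w \in D -> y \in M -> e w y -> y \in D \/ y = d) ->
  out_nbrs M D \subset [set d].
Proof.
move=> H; apply/subsetP => y /out_nbrsP[yM yD [w wD ewy]]; rewrite in_set1.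
by case: (H w y wD yM ewy) yD => [->|->].
Qed.

(** [v] is excluded also as outer neighbour, so that a minimal such set together with its cut vertex
    avoids [v]. *)
Definition small M v D := [&& D \subset M, D != set0, #|out_nbrs M D| <= 1, v \notin D & v \notin out_nbrs M D].

Lemma small1 M v D d : D \subset M -> D != set0 -> v \notin D -> d != v ->
  out_nbrs M D \subset [set d] -> small M v D.
Proof.
move=> DM D0 vD dv sub; apply/and5P; split=> //.
  by rewrite -(cards1 d) subset_leq_card.
by apply: contra dv => /(subsetP sub); rewrite in_set1 eq_sym.
Qed.

(* A smallest set with at most one outer neighbour is an end block without its
   cut vertex. *)
Lemma leaf M v D0 : small M v D0 -> (forall w, w \in M -> w != v -> 1 < deg e M w) ->
  exists D d, [/\ D \subset M, D != set0, v \notin d |: D & pocket e M d D] /\ biconn e (d |: D).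
Proof.
move=> sD0 dM; case: (@arg_minnP _ D0 (small M v) (fun D : {set T} => #|D|) sD0) => D.
move=> /and5P[DM DN0 on1 vD von] minD.
have smaller K d : K \subset D -> K != set0 -> d \in M -> d != v ->
    out_nbrs M K \subset [set d] -> D \subset K.
  move=> KD K0 dM' dv sub; have := minD K; rewrite (small1 (d := d)) //.
  - by move=> /(_ isT) cK; rewrite (_ : D = K) //; apply/eqP; rewrite eq_sym eqEcard KD.
  - exact: subset_trans DM.
  - by apply: contra vD; apply: (subsetP KD).
(* If [D] had no outer neighbour, deleting any a from it would give a smaller such set, with a as
   outer neighbour. *)
have [d don] : exists d, d \in out_nbrs M D.
  apply/set0Pn; apply/negP => /eqP on0; case/set0Pn: (DN0) => a aD.
  have aM := subsetP DM _ aD; have av : a != v by apply: contraNneq vD => <-.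
  have inD w y : w \in D -> y \in M -> e w y -> y \in D.
    move=> wD yM ewy; apply/negPn/negP => yD; move/setP/(_ y): on0; rewrite in_set0.
    by move/negP=> []; apply/out_nbrsP; split=> //; exists w.
  have [b bD] : exists b, b \in D :\ a.
    have := dM a aM av; have := deg1 e a a => _ H.
    have : 0 < deg e M a by apply: leq_trans H.
    rewrite -deg_nbr_set => /nbr_setP[b bM eab]; exists b; rewrite !inE (inD a) // andbT.
    by apply: contraTneq (e_col eab) => ->; rewrite eqxx.
  have := smaller (D :\ a) a (subD1set _ _).
  have -> : D :\ a != set0 by apply/set0Pn; exists b.
  move=> /(_ isT aM av) H; have /subsetP/(_ a aD) : D \subset D :\ a; last by rewrite !inE eqxx.
  apply: H; apply: out_nbrs1 => w y /setD1P[wa wD] yM ewy.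
  have [->|ya] := eqVneq y a; [by right|left]; by rewrite !inE ya (inD w).
have onD y : y \in out_nbrs M D -> y = d by move=> yon; move/card_le1_eqP: on1; apply.
have [dMem dD _] := out_nbrsP _ _ _ don.
have dv : d != v by apply: contraNneq von => <-.
have cD w y : w \in D -> y \in M -> e w y -> y \in D \/ y = d.
  move=> wD yM ewy; case yD: (y \in D); [by left|right]; apply: onD.
  by apply/out_nbrsP; rewrite yD; split=> //; exists w.
have cnD : connected e D.
  move=> X XD X0 cX; apply: (smaller X d) => //; apply: out_nbrs1 => w y wX yM ewy.
  by case: (cD w y (subsetP XD _ wX) yM ewy) => [yD|]; [left; apply: (cX w)|right].
exists D, d; split.
  split=> //; first by rewrite in_setU1 negb_or vD andbT eq_sym.
  by apply/pocketP.
move=> x xL; have [->|xd] := eqVneq x d; first by rewrite setU1K.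
have xD : x \in D by move: xL; rewrite in_setU1 (negbTE xd).
have xv : x != v by apply: contraNneq vD => <-.
have xM := subsetP DM _ xD.
move=> X XL X0 cX.
have inX w y : w \in X -> y \in D -> y != x -> e w y -> y \in X.
  by move=> wX yD yx ewy; apply: (cX w) => //; rewrite !inE yx yD orbT.
(* If deleting x disconnected the block, a side without d would have x as its only outer neighbour,
   against minimality of [D]. *)
case dX: (d \in X).
  pose K := D :\: (x |: X).
  have [/eqP K0|K0] := boolP (K == set0).
    apply/subsetP => w; rewrite !inE => /andP[wx /orP[/eqP->//|wD]].
    by move/setP/(_ w): K0; rewrite !inE wD (negbTE wx) /= andbT => /negbFE.
  have /subsetP/(_ x xD) : D \subset K; last by rewrite !inE eqxx.
  apply: (smaller K x) => //; first exact: subsetDl.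
  apply: out_nbrs1 => w y /setDP[wD]; rewrite in_setU1 negb_or => /andP[wx wX] yM ewy.
  have [->|yx] := eqVneq y x; [by right|left].
  have eyw : e y w by rewrite e_sym.
  case yX: (y \in X); first by have := inX y w yX wD wx eyw; rewrite (negbTE wX).
  case: (cD w y wD yM ewy) => [yD|yd]; last by rewrite yd dX in yX.
  by rewrite !inE yD yX (negbTE yx).
have XD : X \subset D.
  apply/subsetP => w wX; have := subsetP XL _ wX; rewrite !inE => /andP[_ /predU1P[wd|//]].
  by rewrite -wd wX in dX.
have /subsetP/(_ x xD) : D \subset X.
  apply: (smaller X x) => //; apply: out_nbrs1 => w y wX yM ewy.
  have [->|yx] := eqVneq y x; [by right|left].
  case: (cD w y (subsetP XD _ wX) yM ewy) => [yD|yd]; first exact: (inX w).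
  have : y \in X by apply: (cX w) => //; rewrite !inE yx yd eqxx.
  by rewrite yd dX.
by move/(subsetP XL); rewrite !inE eqxx.
Qed.

Lemma deg_eq S S' w : (forall y, y \in S -> e w y -> y \in S') -> deg e S w <= deg e S' w.
Proof.
move=> H; rewrite -[leqRHS]addn0 -(deg0 (e := e) (S := set0) (w := w)).
  by apply: deg_cover => y yS ewy; rewrite H.
by move=> y; rewrite inE.
Qed.

Lemma edge_irr x : ~~ e x x.
Proof. by apply/negP => /e_col; rewrite eqxx. Qed.

(** If one vertex cuts off a part away from [v], an end block there is a lump. Otherwise, in a
    component M of U - v, each part cut off by one vertex contains a neighbour of [v]: one lies in
    an end block of M and another elsewhere in M, and the paths between them vary within the end
    block. *)
Lemma cycle_or_lump U v k : 0 < k -> v \in U -> U :\ v != set0 ->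
    (forall w, w \in U -> w != v -> k.+1 < deg e U w) ->
  (exists x y M, [/\ e v x, e v y, x != y, v \notin M & flexible e M x y k]) \/
  (exists L, [/\ L \subset U :\ v, 2 < #|L| &
     forall x y, x \in L -> y \in L -> x != y -> flexible e L x y k]).
Proof.
move=> k0 vU U0 dU; have [/existsP[D0 sD0]|/existsPn noS] := boolP [exists D, small U v D].
  right; have [|D [d [[DU DN0 vL pD] bL]]] := leaf sD0.
    by move=> w wU wv; have := dU w wU wv; move: k0; nlia.
  have /pocketP[dU' _ dD _ cD] := pD.
  have LU : d |: D \subset U by rewrite subUset sub1set dU'.
  have dL w : w \in D -> k.+1 < deg e (d |: D) w.
    move=> wD; have wU := subsetP DU _ wD.
    have wv : w != v by apply: contraNneq vL => <-; rewrite in_setU1 wD orbT.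
    apply: leq_trans (dU w wU wv) _; apply: deg_eq => y yU ewy; rewrite in_setU1.
    by case: (cD w y wD yU ewy) => [->|->]; rewrite ?eqxx ?orbT.
  exists (d |: D); split.
  - by rewrite subsetD1 LU.
  - by case/set0Pn: DN0 => w /dL H; apply: leq_trans (deg_le e _ w); move: H k0; nlia.
  - move=> x y xL yL xy; apply: (flexible_biconn e_sym e_col (c := d)) => //; first exact: setU11.
    by move=> w /setU1P[->|]; [rewrite eqxx|move/dL].
left; case/set0Pn: U0 => w0 w0U.
have [M [MU w0M cloM cM]] := component_ex e_sym w0U.
have MU' w : w \in M -> w \in U /\ w != v.
  by move/(subsetP MU); rewrite !inE => /andP[].
have vM : v \notin M by apply/negP => /MU'[_]; rewrite eqxx.
have touch D d : D \subset M -> D != set0 ->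
    (forall w y, w \in D -> y \in M -> e w y -> y \in D \/ y = d) -> d \in M ->
    exists2 x, x \in D & e v x.
  move=> DM D0 cD dM; have [/exists_inP//|/exists_inPn no] := boolP [exists x in D, e v x].
  have := noS D; rewrite (small1 (d := d)) //.
  - by apply/subsetP => w /(subsetP DM)/MU'[].
  - by apply: contra vM; apply: (subsetP DM).
  - by case: (MU' d dM).
  - apply: out_nbrs1 => w y wD yU ewy; apply: (cD w) => //.
    have wM := subsetP DM _ wD; apply: (cloM w) => //; rewrite !inE yU andbT.
    by apply: contraNneq (no w wD) => <-; rewrite e_sym.
have dM w : w \in M -> k < deg e M w.
  move=> wM; have [wU wv] := MU' w wM; have := dU w wU wv; have := deg_D1 e U v w.
  have : deg e (U :\ v) w <= deg e M w.
    by apply: deg_eq => y yU ewy; apply: (cloM w).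
  nlia.
have sM : small M v M.
  apply/and5P; split=> //; first by apply/set0Pn; exists w0.
    rewrite (_ : out_nbrs M M = set0) ?cards0 //; apply/setP => y; rewrite in_set0.
    by apply/negP => /out_nbrsP[->].
  by apply: contra vM => /out_nbrsP[].
have [|D [d [[DM DN0 vL pD] bL]]] := leaf sM.
  by move=> w wM _; have := dM w wM; move: k0; nlia.
have /pocketP[dM' _ dD _ cD] := pD.
have [x xD evx] := touch D d DM DN0 cD dM'.
have xM := subsetP DM _ xD; have xd : x != d by apply: contraNneq dD => <-.
have LM : d |: D \subset M by rewrite subUset sub1set dM'.
have degL w : w \in D -> k < deg e (d |: D) w.
  move=> wD; apply: leq_trans (dM w (subsetP DM _ wD)) _; apply: deg_eq => y yM ewy.
  by rewrite in_setU1; case: (cD w y wD yM ewy) => [->|->]; rewrite ?eqxx ?orbT.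
have [/existsP[y /andP[/setDP[yM yD] evy]]|/existsPn noy] :=
    boolP [exists y, (y \in M :\: D) && e v y].
  exists x, y, M; split=> //; first by apply: contraNneq yD => <-.
  have AP1 : flexible e (d |: D) x d k.
    apply: (flexible_two_roots e_sym e_col) => //; try by rewrite !inE ?eqxx ?xD ?orbT.
      by apply: biconn_sep; rewrite // !inE ?eqxx ?xD ?orbT.
    have : 0 < deg e D x.
      by have := degL x xD; have := degU e [set d] D x; rewrite deg1; move: k0; nlia.
    rewrite -deg_nbr_set => /nbr_setP[w wD exw]; exists w.
    rewrite !inE wD orbT; split=> //; last by apply: contraNneq dD => <-.
    by apply: contraTneq exw => ->; apply: edge_irr.
    by move=> w /setU1P[->|wD] _; [rewrite eqxx|move=> _; exact: degL].
  have cMD := conn_pocket e_sym cM pD.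
  have [t Pt] : exists t, Pth e (M :\: D) d y t by apply: connected_Pth; rewrite // inE ?dD ?yD.
  have [S SM xpS] := Pth_xpath Pt.
  apply: flexible_sub (flexible_joinr e_sym _ AP1 xpS).
    by rewrite subUset LM (subset_trans SM (subsetDl _ _)).
  apply/subsetP => w /setIP[/setU1P[->|wD]]; first by rewrite set11.
  by move/(subsetP SM)/setDP=> [_]; rewrite wD.
(* A remainder beyond the end block would be cut off by d and thus contain a neighbour of [v]. *)
have EM : M = d |: D.
  apply/eqP; rewrite eqEsubset LM andbT; apply/negPn/negP => nsub.
  pose K := M :\: (d |: D).
  have K0 : K != set0 by rewrite setD_eq0.
  have [||z zK evz] := touch K d (subsetDl _ _) K0.
  - move=> w y; rewrite !inE negb_or => /andP[/andP[wd wD] wM] yM ewy.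
    have [->|yd] := eqVneq y d; [by right|left; rewrite yM andbT /=].
    apply/negP => yD; have eyw : e y w by rewrite e_sym.
    by case: (cD y w yD wM eyw) => [|/eqP]; [rewrite (negbTE wD)|rewrite (negbTE wd)].
  - exact: dM'.
  - have := noy z; rewrite evz andbT; move: zK; rewrite !inE negb_or => /andP[/andP[_ ->] ->] //.
have [|||y yMx evy] := touch (M :\ x) x (subD1set _ _).
- by apply/set0Pn; exists d; rewrite !inE eq_sym xd.
- move=> w y _ yM _; have [->|yx] := eqVneq y x; [by right|left]; by rewrite !inE yx.
- exact: xM.
move: yMx; rewrite !inE => /andP[yx yM].
have yD : y \in D by have := noy y; rewrite evy andbT in_setD yM andbT negbK.
exists x, y, M; split=> //; first by rewrite eq_sym.
apply: (flexible_two_roots e_sym e_col) => //; first by rewrite eq_sym.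
- by apply: biconn_sep; rewrite ?EM // ?inE ?xD ?yD ?orbT // eq_sym.
- exists d; rewrite dM' eq_sym xd; split=> //.
  by apply: contraNneq dD => ->.
- by move=> w wM _ _; apply: dM.
Qed.

End Leaves.

(** * Cycles through a vertex *)

Section Graph.

Variables (T : finType) (F : rel T).
Hypothesis F_sym : symmetric F.
Hypothesis F_irr : irreflexive F.
Implicit Types (A B D K L M Q R S U W X Y Z : {set T}) (a x y z w u d c m s t : T).

Definition cut U X : rel T :=
  fun x y => [&& x \in U, y \in U, F x y & (x \in X) != (y \in X)].

Arguments cut : simpl never.

Lemma cut_sym U X : symmetric (cut U X).
Proof. by move=> x y; rewrite /cut F_sym eq_sym; case: (x \in U); case: (y \in U). Qed.

Lemma deg_sum (e : rel T) U w : (forall y, e w y -> y \in U) -> deg e U w = \sum_y e w y.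
Proof.
move=> eU; rewrite /deg -sum1dep_card big_mkcond /=; apply: eq_bigr => y _.
by case ewy: (e w y); rewrite ?andbF ?andbT //; rewrite eU.
Qed.

(** In a cut with most edges, moving w to the other side exchanges its cut edges with its other
    edges, so these are not more numerous. *)
Lemma max_cut U : exists X, forall w, w \in U -> deg F U w <= 2 * deg (cut U X) U w.
Proof.
pose c X := \sum_x \sum_y cut U X x y.
case: (@arg_maxnP _ (set0 : {set T}) predT c isT) => X _ maxX; exists X => w wU.
pose X' := if w \in X then X :\ w else w |: X.
have memX' y : (y \in X') = (y \in X) (+) (y == w).
  rewrite /X'; case wX: (w \in X); rewrite !inE; case: eqP => [->|_]; by rewrite ?wX ?addbF.
have split_c (X0 : {set T}) : c X0 = 2 * (\sum_y cut U X0 w y) +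
    \sum_(x | x != w) \sum_(y | y != w) cut U X0 x y.
  have cut0 : cut U X0 w w = false by rewrite /cut F_irr !andbF.
  rewrite /c (bigD1 w) //= mul2n -addnn -addnA; congr (_ + _).
  have -> : \sum_y cut U X0 w y = \sum_(x | x != w) cut U X0 x w.
    rewrite (bigD1 w) //= cut0 add0n; apply: eq_bigr => y _.
    by rewrite cut_sym.
  by rewrite -big_split /=; apply: eq_bigr => x _; rewrite (bigD1 w).
have same : \sum_(x | x != w) \sum_(y | y != w) cut U X' x y =
            \sum_(x | x != w) \sum_(y | y != w) cut U X x y.
  apply: eq_bigr => x /negbTE xw; apply: eq_bigr => y /negbTE yw.
  by rewrite /cut !memX' xw yw !addbF.
have := maxX X' isT; rewrite /= !split_c same leq_add2r => Hle.
have cutU (X0 : {set T}) y : cut U X0 w y -> y \in U by case/and4P.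
rewrite (deg_sum (cutU X)).
have -> : deg F U w = \sum_y cut U X w y + \sum_y cut U X' w y.
  rewrite /deg -sum1dep_card big_mkcond /= -big_split; apply: eq_bigr => y _ /=.
  rewrite /cut !memX' wU eqxx addbT /=; case yU: (y \in U) => //=; case Fwy: (F w y) => //=.
  have -> : (y == w) = false by apply/eqP => yw; rewrite yw F_irr in Fwy.
  by rewrite addbF; case: (w \in X); case: (y \in X).
by move: Hle; nlia.
Qed.

Variables (k : nat) (v : T).
Hypothesis k_gt0 : 0 < k.

(* b counts vertices, so that adding v to an odd number of them gives an even cycle *)
Definition good_cycles := exists x y S (b : nat), [/\ F v x, F v y, x != y, v \notin S &
  odd b /\ forall i, i < k -> Pth F S x y (b + 2 * i)].

(** [col] is the bipartition of the cut in which [L] is found; it determines the parity of the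
    lengths, although the paths are taken in [F]. *)
Definition lump L := 2 < #|L| /\ exists col : T -> bool, forall x y, x \in L -> y \in L ->
  x != y -> exists2 b : nat, odd b = (col x == col y) & forall i, i < k -> Pth F L x y (b + 2 * i).

Lemma find_lump U : v \in U -> U :\ v != set0 ->
    (forall w, w \in U -> w != v -> 2 * k + 3 <= deg F U w) ->
  good_cycles \/ exists2 L : {set T}, L \subset U :\ v & lump L.
Proof.
move=> vU U0 dU; have [X cX] := max_cut U.
have gsub : subrel (cut U X) F by move=> x y /and4P[].
have gcol x y : cut U X x y -> (x \in X) != (y \in X) by case/and4P.
(* Half of 2k + 3, rounded up, is k + 2. *)
have dg w : w \in U -> w != v -> k.+1 < deg (cut U X) U w.
  by move=> wU wv; have := dU w wU wv; have := cX w wU; nlia.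
have parity S x y b : (forall i, i < k -> Pth (cut U X) S x y (b + 2 * i)) ->
    odd b = ((x \in X) == (y \in X)).
  by move=> H; have := Pth_parity (col := mem X) gcol (H 0 k_gt0); rewrite muln0 addn0.
have [[x [y [M [evx evy xy vM [b H]]]]]|[L [LU cL APL]]] :=
  cycle_or_lump (cut_sym U X) (col := mem X) gcol k_gt0 vU U0 dg.
  left; exists x, y, M, b; split=> //; [exact: gsub|exact: gsub|].
  split; last by move=> i /H; apply: Pth_rel.
  rewrite (parity _ _ _ _ H); move: (gcol _ _ evx) (gcol _ _ evy).
  by case: (v \in X); case: (x \in X); case: (y \in X).
right; exists L => //; split=> //; exists (mem X) => x y xL yL xy.
have [b H] := APL x y xL yL xy; exists b; first exact: (parity _ _ _ _ H).
by move=> i /H; apply: Pth_rel.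
Qed.

Definition meets_at A B c := forall u, u \in A -> u \in B -> u = c.
Definition apart A B := forall u, u \in A -> u \notin B.

Lemma meets_at_sub A B c : meets_at A B c -> A :&: B \subset [set c].
Proof. by move=> H; apply/subsetP => u /setIP[uA uB]; rewrite (H u) ?set11. Qed.

Lemma meets_at_sym A B c : meets_at A B c -> meets_at B A c.
Proof. by move=> H u uB uA; apply: H. Qed.

Lemma meets_at_Ul A A' B c : meets_at A B c -> meets_at A' B c -> meets_at (A :|: A') B c.
Proof. by move=> H H' u /setUP[/H|/H']. Qed.

Lemma meets_at_Ur A B B' c : meets_at A B c -> meets_at A B' c -> meets_at A (B :|: B') c.
Proof. by move=> H H' u uA /setUP[/(H u uA)|/(H' u uA)]. Qed.

Lemma apart_meets_at A B c : apart A B -> meets_at A B c.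
Proof. by move=> H u /H/negbTE->. Qed.

Lemma apart_sym A B : apart A B -> apart B A.
Proof. by move=> H u uB; apply: contraL uB => /H. Qed.

Lemma disjoint_apart A B : [disjoint A & B] -> apart A B.
Proof. by rewrite disjoints_subset => /subsetP H u /H; rewrite inE. Qed.

(** The junctions [u1] and [u2] are counted twice; subtracting 2 does not change the parity. *)
Lemma odd_Pth S1 S2 S3 a1 u1 u2 a2 n1 n2 (b : nat) : apart S1 S3 -> meets_at S1 S2 u1 -> meets_at S2 S3 u2 ->
    F v a1 -> F v a2 -> a1 != a2 -> v \notin S1 :|: S2 :|: S3 ->
    Pth F S1 a1 u1 n1 -> Pth F S3 a2 u2 n2 -> odd (b + n1 + n2) ->
    (forall i, i < k -> Pth F S2 u1 u2 (b + 2 * i)) ->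
  good_cycles.
Proof.
move=> d13 i12 i23 Fa1 Fa2 a12 vS P1 P3 ob P2.
have n1_gt0 := Pth_pos P1; have n2_gt0 := Pth_pos P3.
exists a1, a2, (S1 :|: S2 :|: S3), (n1 + b + n2).-2; split=> //.
have b_gt0 : 0 < b by have := Pth_pos (P2 0 k_gt0); rewrite muln0 addn0.
split.
  have E : b + n1 + n2 = (n1 + b + n2).-2.+2 by nlia.
  by move: ob; rewrite E /= negbK.
move=> i ik.
have J1 := Pth_join (meets_at_sub i12) P1 (P2 i ik).
have i123 : meets_at (S1 :|: S2) S3 u2 by apply: meets_at_Ul => //; apply: apart_meets_at.
have := Pth_join (meets_at_sub i123) J1 (Pth_sym F_sym P3).
by rewrite (_ : ((n1 + (b + 2 * i)).-1 + n2).-1 = (n1 + b + n2).-2 + 2 * i) //; nlia.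
Qed.

(* Three arcs from v to m, two of them flexible: two of the arcs have lengths of
   equal parity. *)
Lemma theta S1 S2 S3 a1 a2 a3 m : flexible F S1 a1 m k -> flexible F S2 a2 m k -> xpath F S3 a3 m ->
    meets_at S1 S2 m -> meets_at S1 S3 m -> meets_at S2 S3 m ->
    v \notin S1 -> v \notin S2 -> v \notin S3 ->
    F v a1 -> F v a2 -> F v a3 -> a1 != a2 -> a1 != a3 -> a2 != a3 ->
  good_cycles.
Proof.
move=> [b1 H1] [b2 H2] /xpath_Pth[n3 P3] i12 i13 i23 v1 v2 v3 F1 F2 F3 a12 a13 a23.
have [m1 m2] : m \in S1 /\ m \in S2.
  by split; [case: (Pth_in (H1 0 k_gt0))|case: (Pth_in (H2 0 k_gt0))].
have go (S S' : {set T}) a a' (b n : nat) : meets_at S S' m -> v \notin S -> v \notin S' ->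
    F v a -> F v a' -> a != a' -> (forall i, i < k -> Pth F S a m (b + 2 * i)) ->
    Pth F S' a' m n -> odd b = odd n -> good_cycles.
  move=> iSS vS vS' Fa Fa' aa Hb Pn obn; exists a, a', (S :|: S'), (b + n).-1; split=> //.
    by rewrite inE negb_or vS.
  have n_gt0 := Pth_pos Pn.
  have b_gt0 : 0 < b by have := Pth_pos (Hb 0 k_gt0); rewrite muln0 addn0.
  split.
    have E : b + n = (b + n).-1.+1 by nlia.
    by have := oddD b n; rewrite obn addbb E /= => /negbFE.
  move=> i ik; have := Pth_join (meets_at_sub iSS) (Hb i ik) (Pth_sym F_sym Pn).
  by rewrite (_ : (b + 2 * i + n).-1 = (b + n).-1 + 2 * i) //; nlia.
have H20 := H2 0 k_gt0; rewrite muln0 addn0 in H20.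
have [o12|o12] := eqVneq (odd b1) (odd b2).
  exact: (go S1 S2 a1 a2 b1 b2).
have [o13|o13] := eqVneq (odd b1) (odd n3).
  exact: (go S1 S3 a1 a3 b1 n3).
apply: (go S2 S3 a2 a3 b2 n3) => //.
by move: o12 o13; case: (odd b1); case: (odd b2); case: (odd n3).
Qed.

Let M := [set~ v].
Let Nv := nbr_set F [set v].

Lemma NvP a : (a \in Nv) = F v a.
Proof. by rewrite /Nv nbr_set1 F_sym. Qed.

Lemma Nv_M : Nv \subset M.
Proof.
by apply/subsetP => a; rewrite NvP !inE => Fva; apply: contraTneq Fva => ->; rewrite F_irr.
Qed.

Lemma M_notin S : S \subset M -> v \notin S.
Proof. by move=> SM; apply/negP => /(subsetP SM); rewrite !inE eqxx. Qed.

(** Assign to each leg the parity of its length corrected by the colour of its end in [L]. Two of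
    the three legs agree, and joining them through [L] gives paths with an odd number of
    vertices. *)
Lemma fan_lump L S1 a1 b1 S2 a2 b2 S3 a3 b3 : lump L -> v \notin L ->
    leg F Nv L M S1 a1 b1 -> leg F Nv L M S2 a2 b2 -> leg F Nv L M S3 a3 b3 ->
    [disjoint S1 & S2] -> [disjoint S1 & S3] -> [disjoint S2 & S3] ->
  good_cycles.
Proof.
move=> [_ [col HL]] vL L1 L2 L3 /disjoint_apart d12 /disjoint_apart d13 /disjoint_apart d23.
have go S a b S' a' b' n n' : leg F Nv L M S a b -> leg F Nv L M S' a' b' -> apart S S' ->
    Pth F S a b n -> Pth F S' a' b' n' ->
    odd n (+) col b = odd n' (+) col b' -> good_cycles.
  move=> Lg Lg' dS P P' E; have [aS bS] := leg_in Lg; have [aS' bS'] := leg_in Lg'.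
  case: Lg => _ aN bL SM SL; case: Lg' => _ aN' bL' SM' SL'.
  have bb : b != b' by apply: contraNneq (dS _ bS) => ->.
  have aa : a != a' by apply: contraNneq (dS _ aS) => ->.
  have [c oc Hc] := HL b b' bL bL' bb.
  apply: (odd_Pth (S2 := L) dS _ _ _ _ aa _ P P' _ Hc).
  - by move=> u uS uL; apply: SL.
  - by move=> u uL uS; apply: SL'.
  - by rewrite -NvP.
  - by rewrite -NvP.
  - by rewrite !inE !negb_or vL !M_notin.
  - rewrite !oddD oc; move: E; case: (odd n); case: (odd n'); case: (col b); by case: (col b').
have [[/xpath_Pth[n1 P1] _ _ _ _] [/xpath_Pth[n2 P2] _ _ _ _]] := (L1, L2).
have [/xpath_Pth[n3 P3] _ _ _ _] := L3.
have [E|E12] := eqVneq (odd n1 (+) col b1) (odd n2 (+) col b2).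
  exact: (go _ _ _ _ _ _ _ _ L1 L2 d12 P1 P2 E).
have [E|E13] := eqVneq (odd n1 (+) col b1) (odd n3 (+) col b3).
  exact: (go _ _ _ _ _ _ _ _ L1 L3 d13 P1 P3 E).
apply: (go _ _ _ _ _ _ _ _ L2 L3 d23 P2 P3).
by move: E12 E13; do 3! case: (_ (+) _).
Qed.

Lemma fan_or_sep W : v \notin W ->
  (exists S1 a1 b1 S2 a2 b2 S3 a3 b3,
    [/\ leg F Nv W M S1 a1 b1, leg F Nv W M S2 a2 b2, leg F Nv W M S3 a3 b3 &
    [/\ [disjoint S1 & S2], [disjoint S1 & S3] & [disjoint S2 & S3]]]) \/
  exists Y, [/\ W \subset Y, v \notin Y & #|bd F Y| <= 2].
Proof.
move=> vW; have [/existsP[Z /existsP[X /andP[Z3 sepX]]]|/existsPn no] :=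
    boolP [exists Z : {set T}, exists X, (#|Z| < 3) && separates F Nv W M Z X].
  (* Y is everything except [v] and what its neighbours reach without Z, so its boundary lies in
     Z. *)
  right; case/and4P: sepX => /subsetP AX dXZ dXW /forall_inP cX; exists (~: (v |: X)); split.
  - apply/subsetP => w wW; rewrite !inE negb_or; apply/andP; split.
      by apply: contraNneq vW => <-.
    by apply/negP => wX; move/pred0P/(_ w): dXW; rewrite /= wX wW.
  - by rewrite !inE eqxx.
  - apply: leq_trans (subset_leq_card _) (Z3 : #|Z| <= 2); apply/subsetP => y /bdP[].
    rewrite !inE negb_or => /andP[yv yX] [x]; rewrite !inE negbK => xvX Fyx.
    have [xv|xv] := eqVneq x v.
      apply: contraNT yX => yZ; apply: AX; rewrite inE yZ NvP -xv F_sym //.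
    have xX : x \in X by move: xvX; rewrite (negbTE xv).
    have /forallP/(_ y) := cX x xX; by rewrite /= !inE xv yv F_sym Fyx (negbTE yX) orbF.
left; apply: menger3; first exact: Nv_M.
by move=> Z X Z3; have := no Z; rewrite negb_exists => /forallP/(_ X); rewrite Z3.
Qed.

Hypothesis F_bi : forall d, connected F ([set: T] :\ d).
Hypothesis Nv_gt1 : 1 < #|Nv|.

(** A single boundary vertex would separate the rest of [Y] from [v]. *)
Lemma bd_gt1 Y : v \notin Y -> 1 < #|Y| -> 1 < #|bd F Y|.
Proof.
move=> vY Y2; rewrite ltnNge; apply/negP => b1.
have [d dY bd_d] : exists2 d, d \in Y & bd F Y \subset [set d].
  have [/eqP->|/set0Pn[d dbd]] := boolP (bd F Y == set0).
    have /set0Pn[d dY] : Y != set0 by rewrite -card_gt0 ltnW.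
    by exists d; rewrite ?sub0set.
  exists d; first exact: (subsetP (bd_sub F Y)).
  by apply/subsetP => u ubd; rewrite in_set1; apply/eqP; move/card_le1_eqP: b1; apply.
have /subsetP/(_ v) : [set: T] :\ d \subset Y :\ d.
  apply: F_bi.
  - by apply: setSD; exact: subsetT.
  - by rewrite -card_gt0; move: Y2; rewrite (cardsD1 d) dY.
  - move=> w y /setD1P[wd wY]; rewrite !inE andbT => yd Fwy; rewrite yd /=.
    apply/negPn/negP => yY; move: wd; rewrite -in_set1.
    have /(subsetP bd_d)-> // : w \in bd F Y by apply/bdP; split=> //; exists y.
rewrite !inE (negbTE vY) andbF andbT; move=> H; have : v == d by apply/negPn/negP => /H.
by move/eqP => vd; rewrite vd dY in vY.
Qed.

(** Submodularity: the unions of the two boundaries on either side are nested, and so are their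
    intersections, which gives the inequality of the sums. *)
Lemma bd_submod Y Y' : #|bd F (Y :|: Y')| + #|bd F (Y :&: Y')| <= #|bd F Y| + #|bd F Y'|.
Proof.
rewrite -cardsUI -[leqRHS]cardsUI; apply: leq_add; apply: subset_leq_card.
  apply/subsetP => u /setUP[] /bdP[].
    rewrite !inE => /orP[uY|uY] [x]; rewrite !inE negb_or => /andP[xY xY'] Fux.
      by rewrite uY; apply/orP; left; apply/existsP; exists x; rewrite xY.
    by rewrite uY; apply/orP; right; apply/existsP; exists x; rewrite xY'.
  rewrite !inE => /andP[uY uY'] [x]; rewrite !inE negb_and uY uY' => /orP[xY|xY] Fux.
    by apply/orP; left; apply/existsP; exists x; rewrite xY.
  by apply/orP; right; apply/existsP; exists x; rewrite xY.
apply/subsetP => u /setIP[/bdP[_ [x]]]; rewrite inE negb_or => /andP[xY xY'] Fux.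
case/bdP=> /setIP[uY uY'] _; rewrite inE; apply/andP; split; apply/bdP; split=> //; by exists x.
Qed.

(** Seen from outside, such a set acts as an edge between [s] and [t] of flexible length. *)
Definition rich Y s t := [/\ v \notin Y, s != t, bd F Y = [set s; t] & flexible F Y s t k].

Lemma rich_sym Y s t : rich Y s t -> rich Y t s.
Proof. by case=> vY st E H; split=> //; [rewrite eq_sym|rewrite E setUC|exact: flexible_sym]. Qed.

Lemma lump_rich Y s t L : v \notin Y -> L \subset Y -> lump L -> s != t ->
  bd F Y = [set s; t] -> rich Y s t.
Proof.
move=> vY LY [L3 [col HL]] st Est; split=> //.
have stY : [set s; t] \subset Y by rewrite -Est bd_sub.
have [|S1 [a1 [b1 [S2 [a2 [b2 [L1 L2 dS]]]]]]] := @menger2 _ F _ L _ stY.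
  move=> Z X Z2.
  apply/negP => /and4P[/subsetP stX dXZ dXL /forall_inP cX].
  pose Y2 := Y :\: (X :\: Z) :|: (Z :&: Y).
  (* [Y1] contains [L] and has its boundary in Z, so fewer than two vertices in Z contradict
     [bd_gt1]. *)
  pose Y1 := Y :\: X.
  have LY1 : L \subset Y1.
    apply/subsetP => u uL; rewrite inE (subsetP LY _ uL) andbT.
    by apply/negP => uX; move/pred0P/(_ u): dXL; rewrite /= uX uL.
  have bdZ : bd F Y1 \subset Z.
    apply/subsetP => u /bdP[/setDP[uY uX] [x]]; rewrite inE negb_and negbK => xXY Fux.
    apply/negPn/negP => uZ; have [xY|xY] := boolP (x \in Y).
      have xX : x \in X by move: xXY; rewrite xY orbF.
      have /forallP/(_ u) := cX x xX; rewrite /= xY uY F_sym Fux /= (negbTE uZ).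
      by rewrite (negbTE uX).
    have : u \in bd F Y by apply/bdP; split=> //; exists x.
    by rewrite Est => ust; rewrite stX // inE uZ in uX.
  have vY1 : v \notin Y1 by rewrite inE (negbTE vY) andbF.
  have := bd_gt1 vY1 (leq_trans (ltnW L3) (subset_leq_card LY1)).
  by move/leq_trans/(_ (subset_leq_card bdZ)); rewrite ltnNge -ltnS Z2.
have [a1S b1S] := leg_in L1; have [a2S b2S] := leg_in L2.
case: L1 => P1 a1st b1L S1Y S1L; case: L2 => P2 a2st b2L S2Y S2L.
have dS' := disjoint_apart dS.
have b12 : b1 != b2 by apply: contraNneq (dS' _ b1S) => ->.
have a12 : a1 != a2 by apply: contraNneq (dS' _ a1S) => ->.
have [c _ Hc] := HL b1 b2 b1L b2L b12.
have APL : flexible F L b1 b2 k by exists c.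
have i1 : meets_at S1 L b1 by [].
have J1 := flexible_joinl (meets_at_sub i1) P1 APL.
have i2 : meets_at (S1 :|: L) S2 b2.
  by apply: meets_at_Ul; [exact: apart_meets_at|move=> u uL uS; exact: S2L].
have J2 := flexible_joinr F_sym (meets_at_sub i2) J1 (xpath_sym F_sym P2).
have {J2}J : flexible F Y a1 a2 k by apply: flexible_sub J2; rewrite !subUset S1Y LY S2Y.
case/set2P: a1st a12 J => ->; case/set2P: a2st => ->; rewrite ?eqxx // => _ J.
exact: flexible_sym.
Qed.

(** The arcs meet at [m]: one is [X], one the part of [S1] before [m], and one follows [S2], crosses
    [Y] and returns along [S1]. The first and the last are flexible, as [theta] requires. *)
Lemma theta_rich Y s t S1 S2 a1 a2 X a m : rich Y s t ->
    xpath F S1 a1 s -> xpath F S2 a2 t -> S1 \subset M -> S2 \subset M ->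
    F v a1 -> F v a2 -> apart S1 S2 -> meets_at S1 Y s -> meets_at S2 Y t ->
    m \in S1 -> flexible F X a m k -> meets_at X S1 m -> meets_at X S2 m -> meets_at X Y m ->
    v \notin X -> F v a -> a \notin S1 -> a \notin S2 ->
  good_cycles.
Proof.
move=> [vY st Est APst] P1 P2 S1M S2M F1 F2 d12 i1Y i2Y mS1 APX iX1 iX2 iXY vX Fa aS1 aS2.
have [S11 [S12 [E S11I P11 P12]]] := xpath_split P1 mS1.
have S11sub u : u \in S11 -> u \in S1 by rewrite E inE => ->.
have S12sub u : u \in S12 -> u \in S1 by rewrite E inE orbC => ->.
have iS u : u \in S11 -> u \in S12 -> u = m.
  by move=> u1 u2; apply/set1P; rewrite -S11I inE u1.
have [s12 _] := xpath_ends (xpath_sym F_sym P12); have [_ m11] := xpath_ends P11.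
have [tY _] : t \in Y /\ s \in Y.
  by have /subsetP := bd_sub F Y; rewrite Est => H; rewrite !H // !inE eqxx ?orbT.
have [_ tS2] := xpath_ends P2; have [a11 _] := xpath_ends P11.
have [a2S2 _] := xpath_ends P2.
have j1 : meets_at S2 Y t by [].
have J1 := flexible_joinl (meets_at_sub j1) P2 (flexible_sym F_sym APst).
have j2 : meets_at (S2 :|: Y) S12 s.
  apply: meets_at_Ul => u uS u12.
    by have := d12 u (S12sub u u12); rewrite uS.
  by apply: i1Y => //; exact: S12sub.
have J2 := flexible_joinr F_sym (meets_at_sub j2) J1 (xpath_sym F_sym P12).
apply: (theta APX J2 P11) => //.
- apply: meets_at_Ur; first exact: meets_at_Ur.
  by move=> u uX u12; apply: iX1 => //; exact: S12sub.
- by move=> u uX u11; apply: iX1 => //; exact: S11sub.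
- apply: meets_at_Ul; last by move=> u u12 u11; exact: iS.
  apply: meets_at_Ul => u uS u11; first by have := d12 u (S11sub u u11); rewrite uS.
  have us : u = s by apply: i1Y => //; exact: S11sub.
  by apply: iS => //; rewrite us.
- rewrite !inE !negb_or vY M_notin //=; apply/negP => /S12sub.
  by rewrite (negbTE (M_notin S1M)).
- by apply/negP => /S11sub; rewrite (negbTE (M_notin S1M)).
- by apply: contraNneq aS2 => ->.
- by apply: contraNneq aS1 => ->; exact: S11sub.
- by apply: contraTneq a2S2 => ->; apply: d12; exact: S11sub.
Qed.

Lemma leg_avoid W Y S a z : bd F Y \subset W -> leg F Nv W M S a z -> v \notin Y ->
  meets_at S Y z.
Proof.
move=> bW [P aN zW SM SW] vY; apply: (xpath_avoid F_sym P bW SW).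
case aY: (a \in Y); [right|by left]; apply: (subsetP bW); apply/bdP; split=> //.
by exists v => //; rewrite F_sym -NvP.
Qed.

(** The flexible arc demanded by [theta_rich] starts at [c2], follows [Q2], crosses [Y'], goes along
    [Q1] up to [m2] and then along [R]. *)
Lemma theta_far Y s t S1 a1 S2 a2 Y' h1 h2 Q1 c1 Q2 c2 R m1 m2 : rich Y s t ->
    xpath F S1 a1 s -> xpath F S2 a2 t -> S1 \subset M -> S2 \subset M ->
    F v a1 -> F v a2 -> apart S1 S2 -> meets_at S1 Y s -> meets_at S2 Y t ->
    flexible F Y' h1 h2 k -> v \notin Y' -> xpath F Q1 h1 c1 -> xpath F Q2 h2 c2 ->
    Q1 \subset M -> Q2 \subset M -> apart Q1 Q2 -> meets_at Q1 Y' h1 -> meets_at Q2 Y' h2 -> F v c2 ->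
    apart (Q1 :|: Q2 :|: Y') (S1 :|: S2 :|: Y) -> xpath F R m2 m1 -> R \subset M ->
    m1 \in S1 -> m2 \in Q1 -> meets_at R (Q1 :|: Q2 :|: Y') m2 -> meets_at R (S1 :|: S2 :|: Y) m1 ->
  good_cycles.
Proof.
move=> RY P1 P2 S1M S2M F1 F2 d12 i1Y i2Y APY' vY' PQ1 PQ2 Q1M Q2M dQ iQ1 iQ2 Fc2 dOO PR RM
  mS1 mQ1 iRQ iRS.
have [Q11 [Q12 [E _ P11 _]]] := xpath_split PQ1 mQ1.
have Q11sub u : u \in Q11 -> u \in Q1 by rewrite E inE => ->.
have j1 : meets_at Q2 Y' h2 by [].
have J1 := flexible_joinl (meets_at_sub j1) (xpath_sym F_sym PQ2) (flexible_sym F_sym APY').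
have j2 : meets_at (Q2 :|: Y') Q11 h1.
  apply: meets_at_Ul; first by apply/apart_meets_at/apart_sym => u /Q11sub/dQ.
  by apply: meets_at_sym => u /Q11sub; apply: iQ1.
have J2 := flexible_joinr F_sym (meets_at_sub j2) J1 P11.
have subO u : u \in Q2 :|: Y' :|: Q11 -> u \in Q1 :|: Q2 :|: Y'.
  rewrite !inE => /orP[/orP[->|->]|/Q11sub->]; by rewrite ?orbT.
have j3 : meets_at (Q2 :|: Y' :|: Q11) R m2 by apply: meets_at_sym => u uR /subO; apply: iRQ.
have J3 := flexible_joinr F_sym (meets_at_sub j3) J2 PR.
have {}iRS u : u \in Q2 :|: Y' :|: Q11 :|: R -> u \in S1 :|: S2 :|: Y -> u = m1.
  by case/setUP=> [/subO/dOO/negbTE->|/iRS].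
have c2S : c2 \notin S1 :|: S2 :|: Y.
  by apply: dOO; rewrite !inE (proj2 (xpath_ends PQ2)) orbT.
apply: (theta_rich RY P1 P2 S1M S2M F1 F2 d12 i1Y i2Y mS1 J3) => //.
- by move=> u uX uS; apply: iRS; rewrite // !inE uS.
- by move=> u uX uS; apply: iRS; rewrite // !inE uS orbT.
- by move=> u uX uS; apply: iRS; rewrite // !inE uS orbT.
- rewrite !in_setU !negb_or vY' !M_notin //.
  by apply/subsetP => u /Q11sub; apply: (subsetP Q1M).
- by apply: contra c2S => c2S; rewrite !inE c2S.
- by apply: contra c2S => c2S; rewrite !inE c2S orbT.
Qed.

(* Augmenting S3 links s' and t' to Nv, S1 and S2 by disjoint paths Q1 and Q2, one
   of them still ending in Nv.  If the other one ends on S1 or S2, that is where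
   the three arcs meet; otherwise a path from S1, S2 to Q1, Q2 is added. *)
Lemma two_rich4 Y s t Y' s' t' S1 a1 S2 a2 S3 a3 : rich Y s t -> rich Y' s' t' -> apart Y Y' ->
    let W := [set s; t] :|: [set s'; t'] in
    leg F Nv W M S1 a1 s -> leg F Nv W M S2 a2 t -> leg F Nv W M S3 a3 s' ->
    apart S1 S2 -> apart S1 S3 -> apart S2 S3 ->
  good_cycles.
Proof.
move=> RY RY' dY W L1 L2 L3 d12 d13 d23.
have [vY st Est APst] := RY; have [vY' st' Est' APst'] := RY'.
have bYW : bd F Y \subset W by rewrite Est subsetUl.
have bYW' : bd F Y' \subset W by rewrite Est' subsetUr.
have i1Y := leg_avoid bYW L1 vY; have i2Y := leg_avoid bYW L2 vY.
have i3Y' := leg_avoid bYW' L3 vY'; have i1Y' := leg_avoid bYW' L1 vY'.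
have i2Y' := leg_avoid bYW' L2 vY'.
have sub_st := subsetP (bd_sub F Y); have sub_st' := subsetP (bd_sub F Y').
rewrite Est in sub_st; rewrite Est' in sub_st'.
have sY : s \in Y by apply: sub_st; rewrite !inE eqxx.
have tY : t \in Y by apply: sub_st; rewrite !inE eqxx orbT.
have s'Y' : s' \in Y' by apply: sub_st'; rewrite !inE eqxx.
have t'Y' : t' \in Y' by apply: sub_st'; rewrite !inE eqxx orbT.
have d1Y' : apart S1 Y'.
  by move=> u uS; apply/negP => uY'; have us := i1Y' u uS uY'; have := dY s sY; rewrite -us uY'.
have d2Y' : apart S2 Y'.
  by move=> u uS; apply/negP => uY'; have us := i2Y' u uS uY'; have := dY t tY; rewrite -us uY'.
have [sS1 tS2 s'S3] : [/\ s \in S1, t \in S2 & s' \in S3].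
  by rewrite (proj2 (leg_in L1)) (proj2 (leg_in L2)) (proj2 (leg_in L3)).
have [P1 a1N _ S1M _] := L1; have [P2 a2N _ S2M _] := L2; have [P3 a3N _ S3M _] := L3.
pose B := Nv :|: (S1 :|: S2).
have BM : B \subset M by rewrite !subUset Nv_M S1M S2M.
have stM' : [set s'; t'] \subset M.
  by apply/subsetP => u /sub_st' uY'; rewrite !inE; apply: contraNneq vY' => <-.
(* The leg [S3] is reversed and stopped on reaching [B]. It avoids [S1] and [S2], so it stops at a
   neighbour of [v]. *)
have [|R3 [al0 [R3S P3' al0B R3B]]] := @xpath_trim _ F _ _ _ B (xpath_sym F_sym P3).
  by rewrite inE a3N.
have al0N : al0 \in Nv.
  have /(subsetP R3S) alS3 : al0 \in R3 by case: (xpath_ends P3').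
  move: al0B; rewrite !inE => /or3P[//|al1|al2].
    by have := d13 _ al1; rewrite alS3.
  by have := d23 _ al2; rewrite alS3.
have legR3 : leg F [set s'; t'] B M R3 s' al0.
  by split=> //; [rewrite !inE eqxx|exact: subset_trans S3M].
have [q0 abq0 ER3] := leg_ab legR3.
have lnk0 : linkage (restrict F M) [set s'; t'] B [:: (q0, al0)].
  split; last by move=> p; rewrite inE => /eqP->.
  by rewrite /= cats0; case: abq0.
(* No vertex d separates {s', t'} from [B], since F - d is connected and [v] has a neighbour other
   than d. Augmenting keeps the end [al0], so one path still ends in [Nv] off [S1] and [S2]. *)
have [Z Z1|ps [Lps szps subps]] := augment lnk0.
  have [//|[X /and4P[/subsetP stX dXZ dXB /forall_inP cX]]] := ab_or F [set s'; t'] B M Z.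
  have [d Zd] : exists d, Z \subset [set d].
    have [/eqP->|/set0Pn[d dZ]] := boolP (Z == set0); first by exists v; rewrite sub0set.
    exists d; apply/subsetP => u uZ; rewrite in_set1; apply/eqP.
    by move/card_le1_eqP: (Z1 : #|Z| <= 1); apply.
  have [r restrict rd] : exists2 r, r \in [set s'; t'] & r != d.
    have [E|sd] := eqVneq s' d; last by exists s'; rewrite // !inE eqxx.
    by exists t'; rewrite ?inE ?eqxx ?orbT // -E eq_sym.
  have XB u : u \in X -> u \notin B.
    by move=> uX; apply/negP => uB; move/pred0P/(_ u): dXB; rewrite /= uX uB.
  have /subsetP sub : [set: T] :\ d \subset X :\ v :\ d.
    apply: F_bi.
    - by apply: setSD; exact: subsetT.
    - apply/set0Pn; exists r; rewrite !inE rd /=; apply/andP; split.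
        by have := subsetP stM' _ restrict; rewrite /M !inE.
      apply: stX; rewrite inE restrict andbT; apply/negP => /(subsetP Zd).
      by rewrite in_set1 (negbTE rd).
    - move=> w y; rewrite !inE andbT => /and3P[wd wv wX] yd Fwy; rewrite yd /=.
      have yv : y != v.
        apply/negP => /eqP yv; have := XB w wX.
        by rewrite /B in_setU negb_or /Nv NvP -yv F_sym Fwy.
      rewrite yv /=; have /forallP/(_ y) := cX w wX; rewrite /= /M !inE wv yv Fwy /=.
      by case/orP=> // /(subsetP Zd); rewrite in_set1 (negbTE yd).
  have /set0Pn[n] : Nv :\ d != set0.
    by rewrite -card_gt0; have := cardsD1 d Nv; move: Nv_gt1; case: (d \in Nv); nlia.
  case/setD1P=> nd nN.
  have := sub n; rewrite !inE nd => /(_ isT).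
  by case/and3P=> _ _ /XB; rewrite in_setU nN.
have [p1 [p2 [lnk E1]]] : exists p1 p2, linkage (restrict F M) [set s'; t'] B [:: p1; p2] /\ p1.2 = al0.
  case: ps szps Lps subps => [|p1 [|p2 [|]]] // _ Lps subps.
  have := subps al0; rewrite /= !inE eqxx => /(_ isT)/orP[/eqP E|/eqP E].
    by exists p1, p2.
  exists p2, p1; split=> //; apply: linkage_perm Lps.
  exact: (permEl (perm_catC [:: p1] [:: p2])).
have [Q1 [h1 [Q2 [h2 [LQ1 LQ2 /disjoint_apart dQ]]]]] := linkage2 stM' lnk.
rewrite E1 in LQ1; move: LQ2; set be := p2.2 => LQ2.
have [PQ1 h1st _ Q1M Q1B] := LQ1; have [PQ2 h2st beB Q2M Q2B] := LQ2.
have [h1Q alQ] := leg_in LQ1; have [h2Q beQ] := leg_in LQ2.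
have h12 : h1 != h2 by apply: contraNneq (dQ _ h1Q) => ->.
have Ehh : [set h1; h2] = [set s'; t'].
  case/set2P: h1st h12 => ->; case/set2P: h2st => ->; rewrite ?eqxx // => _.
  exact: setUC.
have al12 : al0 \notin S1 /\ al0 \notin S2.
  have /(subsetP R3S) alS3 : al0 \in R3 by case: (xpath_ends P3').
  by split; apply/negP => al; [have := d13 _ al|have := d23 _ al]; rewrite alS3.
have N_st a : a \in Nv -> a \in Y -> a \in S1 :|: S2.
  move=> aN aY; have : a \in bd F Y by apply/bdP; split=> //; exists v => //; rewrite F_sym -NvP.
  by rewrite Est => /set2P[]->; rewrite in_setU ?sS1 ?tS2 ?orbT.
have stB : bd F Y \subset B.
  by rewrite Est; apply/subsetP => u /set2P[]->; rewrite !inE ?sS1 ?tS2 ?orbT.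
have startY h : h \in [set s'; t'] -> h \notin Y \/ h \in B.
  by move=> /sub_st' hY'; left; apply/negP => /dY; rewrite hY'.
have iQ1Y : apart Q1 Y.
  move=> u uQ; apply/negP => uY; have E := xpath_avoid F_sym PQ1 stB Q1B (startY _ h1st) uQ uY.
  have := N_st al0 al0N; rewrite -E uY => /(_ isT); rewrite E !inE.
  by case: al12 => /negbTE-> /negbTE->.
have iQ2Y := xpath_avoid F_sym PQ2 stB Q2B (startY _ h2st).
have Q1h u : u \in Q1 -> u \in [set s'; t'] -> u = h1.
  rewrite -Ehh => uQ /set2P[//|E]; by have := dQ _ uQ; rewrite E h2Q.
have Q2h u : u \in Q2 -> u \in [set s'; t'] -> u = h2.
  rewrite -Ehh => uQ /set2P[E|//]; by have := dQ _ h1Q; rewrite -E uQ.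
have stY'sub : bd F Y' \subset [set s'; t'] by rewrite Est'.
have startY' a : a \in B -> a \notin Y' \/ a \in [set s'; t'].
  move=> aB; case aY': (a \in Y'); [right|by left]; rewrite -Est'; apply/bdP; split=> //.
  case/setUP: aB => [aN|/setUP[aS|aS]].
  - by exists v => //; rewrite F_sym -NvP.
  - by have := d1Y' _ aS; rewrite aY'.
  - by have := d2Y' _ aS; rewrite aY'.
have iQ1Y' := xpath_avoid F_sym (xpath_sym F_sym PQ1) stY'sub Q1h (startY' _ (subsetP (subsetUl _ _) _ al0N)).
have iQ2Y' := xpath_avoid F_sym (xpath_sym F_sym PQ2) stY'sub Q2h (startY' _ beB).
have APh : flexible F Y' h1 h2 k.
  case/set2P: h1st h12 => ->; case/set2P: h2st => ->; rewrite ?eqxx // => _.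
  exact: flexible_sym.
have Fal : F v al0 by rewrite -NvP.
have [F1 F2] : F v a1 /\ F v a2 by rewrite -!NvP.
have Q1S u : u \in Q1 -> u \notin S1 /\ u \notin S2.
  move=> uQ; have H : u \in S1 :|: S2 -> False.
    move=> uS; have uB : u \in B by rewrite in_setU uS orbT.
    move: uS; rewrite (Q1B u uQ uB) inE.
    by case: al12 => /negbTE-> /negbTE->.
  by split; apply/negP => uS; apply: H; rewrite inE uS ?orbT.
have J1 := flexible_joinl (meets_at_sub iQ1Y') (xpath_sym F_sym PQ1) APh.
have j2 : meets_at (Q1 :|: Y') Q2 h2 by apply: meets_at_Ul; [exact: apart_meets_at|exact: meets_at_sym].
have J2 := flexible_joinr F_sym (meets_at_sub j2) J1 PQ2.
have vX : v \notin Q1 :|: Y' :|: Q2 by rewrite !in_setU !negb_or vY' !M_notin.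
have Q2BS u : u \in Q2 -> u \in S1 :|: S2 -> u = be.
  by move=> uQ uS; apply: Q2B; rewrite // in_setU uS orbT.
have iXY : meets_at (Q1 :|: Y' :|: Q2) Y be.
  by apply: meets_at_Ul => //; apply: meets_at_Ul; [exact: apart_meets_at|exact/apart_meets_at/apart_sym].
have iXS (S : {set T}) : S \subset S1 :|: S2 -> meets_at (Q1 :|: Y' :|: Q2) S be.
  move=> /subsetP sS; apply: meets_at_Ul; last by move=> u uQ /sS; apply: Q2BS.
  move=> u uX /sS; case/setUP=> uS; case/setUP: uX => uX.
  - by have [/negP] := Q1S u uX.
  - by have := d1Y' u uS; rewrite uX.
  - by have [_ /negP] := Q1S u uX.
  - by have := d2Y' u uS; rewrite uX.
have iXS1 := iXS _ (subsetUl S1 S2); have iXS2 := iXS _ (subsetUr S1 S2).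
have [al1 al2] := al12.
have [be1|be1] := boolP (be \in S1).
  exact: (theta_rich RY P1 P2 S1M S2M F1 F2 d12 i1Y i2Y be1 J2).
have [be2|be2] := boolP (be \in S2).
  exact: (theta_rich (rich_sym RY) P2 P1 S2M S1M F2 F1 (apart_sym d12) i2Y i1Y be2 J2).
have beN : be \in Nv by move: beB; rewrite !in_setU (negbTE be1) (negbTE be2) !orbF.
have {}iQ2Y : apart Q2 Y.
  move=> u uQ; apply/negP => uY; have E := iQ2Y u uQ uY; rewrite E in uY.
  by have := N_st be beN uY; rewrite in_setU (negbTE be1) (negbTE be2).
have Q2S u : u \in Q2 -> u \notin S1 :|: S2.
  move=> uQ; apply/negP => uS; move: (uS); rewrite (Q2BS u uQ uS) in_setU.
  by rewrite (negbTE be1) (negbTE be2).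
have Fbe : F v be by rewrite -NvP.
have conM : connected F M.
  rewrite (_ : M = [set: T] :\ v); first exact: F_bi.
  by apply/setP => u; rewrite /M !inE andbT.
have [n0 Pn] := connected_Pth conM (subsetP S1M _ sS1) (subsetP Q1M _ h1Q).
have [R0 R0M PR0] := Pth_xpath Pn.
have [|R1 [m2 [R1R PR1 m2Q R1Q]]] := @xpath_trim _ F _ _ _ (Q1 :|: Q2) PR0.
  by rewrite inE h1Q.
have [|R [m1 [RR1 PR m1S RS]]] := @xpath_trim _ F _ _ _ (S1 :|: S2) (xpath_sym F_sym PR1).
  by rewrite inE sS1.
have RM : R \subset M by exact: subset_trans RR1 (subset_trans R1R R0M).
have {}R1Q u : u \in R -> u \in Q1 :|: Q2 -> u = m2.
  by move=> uR; apply: R1Q; exact: (subsetP RR1).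
have iRY : meets_at R Y m1.
  apply: (xpath_avoid F_sym PR _ RS).
    by rewrite Est; apply/subsetP => u /set2P[]->; rewrite inE ?sS1 ?tS2 ?orbT.
  by left; case/setUP: m2Q => [/iQ1Y|/iQ2Y].
have iRY' : meets_at R Y' m2.
  apply: (xpath_avoid F_sym (xpath_sym F_sym PR) _ R1Q).
    rewrite Est' -Ehh; apply/subsetP => u /set2P[]->; by rewrite inE ?h1Q ?h2Q ?orbT.
  by left; case/setUP: m1S => [/d1Y'|/d2Y'].
have dOO : apart (Q1 :|: Q2 :|: Y') (S1 :|: S2 :|: Y).
  move=> u /setUP[/setUP[uQ|uQ]|uY']; rewrite !in_setU !negb_or.
  - by have [-> ->] := Q1S u uQ; rewrite iQ1Y.
  - by have := Q2S u uQ; rewrite in_setU negb_or => ->; rewrite iQ2Y.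
  - rewrite (apart_sym dY) // andbT; apply/andP; split.
      by apply: (apart_sym d1Y').
    by apply: (apart_sym d2Y').
have iRS : meets_at R (S1 :|: S2 :|: Y) m1 by apply: meets_at_Ur.
have iRQ : meets_at R (Q1 :|: Q2 :|: Y') m2 by apply: meets_at_Ur.
case/setUP: m1S => mS; case/setUP: m2Q => mQ.
- exact: (theta_far RY P1 P2 S1M S2M F1 F2 d12 i1Y i2Y APh vY' PQ1 PQ2 Q1M Q2M dQ
          iQ1Y' iQ2Y' Fbe dOO PR RM mS mQ iRQ iRS).
- rewrite (setUC Q1) in dOO iRQ.
  exact: (theta_far RY P1 P2 S1M S2M F1 F2 d12 i1Y i2Y (flexible_sym F_sym APh) vY' PQ2 PQ1 Q2M Q1M
          (apart_sym dQ) iQ2Y' iQ1Y' Fal dOO PR RM mS mQ iRQ iRS).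
- rewrite (setUC S1) in dOO iRS.
  exact: (theta_far (rich_sym RY) P2 P1 S2M S1M F2 F1 (apart_sym d12) i2Y i1Y APh vY' PQ1 PQ2 Q1M Q2M
          dQ iQ1Y' iQ2Y' Fbe dOO PR RM mS mQ iRQ iRS).
- rewrite (setUC S1) in dOO iRS; rewrite (setUC Q1) in dOO iRQ.
  exact: (theta_far (rich_sym RY) P2 P1 S2M S1M F2 F1 (apart_sym d12) i2Y i1Y (flexible_sym F_sym APh) vY'
          PQ2 PQ1 Q2M Q1M (apart_sym dQ) iQ2Y' iQ1Y' Fal dOO PR RM mS mQ iRQ iRS).
Qed.

Lemma two_one Y s t Y' s' t' S1 a1 b1 S2 a2 b2 S3 a3 b3 : rich Y s t -> rich Y' s' t' ->
    apart Y Y' -> let W := [set s; t] :|: [set s'; t'] in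
    leg F Nv W M S1 a1 b1 -> leg F Nv W M S2 a2 b2 -> leg F Nv W M S3 a3 b3 ->
    apart S1 S2 -> apart S1 S3 -> apart S2 S3 ->
    b1 \in [set s; t] -> b2 \in [set s; t] -> b3 \in [set s'; t'] ->
  good_cycles.
Proof.
move=> RY RY' dY W; rewrite {}/W => L1 L2 L3 d12 d13 d23.
have b12 : b1 != b2 by apply: contraNneq (d12 _ (proj2 (leg_in L1))) => ->; case: (leg_in L2).
wlog: s' t' RY' L1 L2 L3 / b3 = s'.
  move=> H b1st b2st /set2P[b3s|b3t].
    by apply: (H s' t'); rewrite // !inE b3s eqxx.
  apply: (H t' s' (rich_sym RY')) => //; try by rewrite (setUC [set t']).
  by rewrite !inE b3t eqxx.
move=> b3s; rewrite {}b3s in L3 * => /set2P[b1s|b1t] /set2P[b2s|b2t] _.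
- by rewrite b1s b2s eqxx in b12.
- by rewrite b1s in L1; rewrite b2t in L2; exact: (two_rich4 RY RY' dY L1 L2 L3).
- rewrite b1t in L1; rewrite b2s in L2; rewrite (setUC [set s]) in L1 L2 L3.
  exact: (two_rich4 (rich_sym RY) RY' dY L1 L2 L3).
- by rewrite b1t b2t eqxx in b12.
Qed.

(** The arcs meet at [q]: two legs prolonged through [Y] and [Y'], and the third leg itself. *)
Lemma theta_touch Y s Y' s' q S1 a1 S2 a2 S3 a3 : rich Y s q -> rich Y' s' q -> meets_at Y Y' q ->
    let W := [set s; q] :|: [set s'; q] in
    leg F Nv W M S1 a1 s -> leg F Nv W M S2 a2 s' -> leg F Nv W M S3 a3 q ->
    apart S1 S2 -> apart S1 S3 -> apart S2 S3 ->
  good_cycles.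
Proof.
move=> [vY sq Est AY] [vY' sq' Est' AY'] iY W L1 L2 L3 d12 d13 d23.
have bW : bd F Y \subset W by rewrite Est subsetUl.
have bW' : bd F Y' \subset W by rewrite Est' subsetUr.
have i1Y := leg_avoid bW L1 vY; have i1Y' := leg_avoid bW' L1 vY'.
have i2Y := leg_avoid bW L2 vY; have i2Y' := leg_avoid bW' L2 vY'.
have i3Y := leg_avoid bW L3 vY; have i3Y' := leg_avoid bW' L3 vY'.
have sY : s \in Y by apply: (subsetP (bd_sub F Y)); rewrite Est !inE eqxx.
have sY' : s' \in Y' by apply: (subsetP (bd_sub F Y')); rewrite Est' !inE eqxx.
have [[a1S _] [a2S _] [a3S _]] := And3 (leg_in L1) (leg_in L2) (leg_in L3).
case: L1 L2 L3 => P1 a1N _ S1M _ [P2 a2N _ S2M _] [P3 a3N _ S3M _].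
apply: (theta (flexible_joinl (meets_at_sub i1Y) P1 AY) (flexible_joinl (meets_at_sub i2Y') P2 AY') P3);
  rewrite -?NvP // ?in_setU ?negb_or ?vY ?vY' ?andbT ?M_notin //.
- apply: meets_at_Ul; apply: meets_at_Ur => // u.
  + by move=> uS; rewrite (negbTE (d12 u uS)).
  + by move=> uS uY'; apply: iY => //; rewrite (i1Y' u uS uY').
  + by move=> uY uS; apply: iY => //; rewrite (i2Y u uS uY).
- by apply: meets_at_Ul; [exact: apart_meets_at|exact: meets_at_sym].
- by apply: meets_at_Ul; [exact: apart_meets_at|exact: meets_at_sym].
- by apply: contraNneq (d12 _ a1S) => ->.
- by apply: contraNneq (d13 _ a1S) => ->.
- by apply: contraNneq (d23 _ a2S) => ->.
Qed.

(** If the sets are disjoint, two of the three ends lie on one boundary and one on the other. If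
    they share a vertex q, there are only three boundary vertices in all, and each is an end. *)
Lemma two_rich Y s t Y' s' t' S1 a1 b1 S2 a2 b2 S3 a3 b3 : rich Y s t -> rich Y' s' t' ->
    #|Y :&: Y'| <= 1 -> Y :&: Y' \subset bd F Y :&: bd F Y' ->
    let W := bd F Y :|: bd F Y' in
    leg F Nv W M S1 a1 b1 -> leg F Nv W M S2 a2 b2 -> leg F Nv W M S3 a3 b3 ->
    apart S1 S2 -> apart S1 S3 -> apart S2 S3 ->
  good_cycles.
Proof.
move=> RY RY' I1 Ibd W L1 L2 L3 d12 d13 d23.
have [_ _ Est _] := RY; have [_ _ Est' _] := RY'.
have b12 : b1 != b2 by apply: contraNneq (d12 _ (proj2 (leg_in L1))) => ->; case: (leg_in L2).
have b13 : b1 != b3 by apply: contraNneq (d13 _ (proj2 (leg_in L1))) => ->; case: (leg_in L3).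
have b23 : b2 != b3 by apply: contraNneq (d23 _ (proj2 (leg_in L2))) => ->; case: (leg_in L3).
have [_ _ b1W _ _] := L1; have [_ _ b2W _ _] := L2; have [_ _ b3W _ _] := L3.
have d21 := apart_sym d12; have d31 := apart_sym d13; have d32 := apart_sym d23.
rewrite {}/W Est Est' in L1 L2 L3 b1W b2W b3W.
have [/eqP Y0|/set0Pn[q qI]] := boolP (Y :&: Y' == set0).
  have dY : apart Y Y' by apply/disjoint_apart; rewrite -setI_eq0 Y0.
  have two (x y : T) (b b' b'' : T) : b \in [set x; y] -> b' \in [set x; y] -> b'' \in [set x; y] ->
      b != b' -> b != b'' -> b' != b'' -> False.
    by move=> /set2P[]-> /set2P[]-> /set2P[]->; rewrite ?eqxx.
  have L1' := L1; have L2' := L2; have L3' := L3; rewrite setUC in L1' L2' L3'.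
  case/setUP: b1W => b1W; case/setUP: b2W => b2W; case/setUP: b3W => b3W.
  - by case: (two _ _ _ _ _ b1W b2W b3W).
  - exact: (two_one RY RY' dY L1 L2 L3).
  - exact: (two_one RY RY' dY L1 L3 L2).
  - exact: (two_one RY' RY (apart_sym dY) L2' L3' L1').
  - exact: (two_one RY RY' dY L2 L3 L1).
  - exact: (two_one RY' RY (apart_sym dY) L1' L3' L2').
  - exact: (two_one RY' RY (apart_sym dY) L1' L2' L3').
  - by case: (two _ _ _ _ _ b1W b2W b3W).
have iY : meets_at Y Y' q.
  by move=> u uY uY'; move/card_le1_eqP: I1; apply; rewrite // inE uY.
have /(subsetP Ibd)/setIP[] := qI; rewrite Est Est' => qst qst'.
wlog {qst} qt : s t RY L1 L2 L3 Est b1W b2W b3W / q = t.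
  move=> H; case/set2P: qst => E; last exact: (H s t).
  by apply: (H t s (rich_sym RY)); rewrite // (setUC [set t]).
wlog {qst'} qt' : s' t' RY' L1 L2 L3 Est' b1W b2W b3W / q = t'.
  move=> H; case/set2P: qst' => E; last exact: (H s' t').
  by apply: (H t' s' (rich_sym RY')); rewrite // (setUC [set t']).
subst t t'.
have inW b : b \in [set s; q] :|: [set s'; q] -> [\/ b = s, b = s' | b = q].
  by case/setUP=> /set2P[]->; [constructor 1|constructor 3|constructor 2|constructor 3].
by case: (inW b1 b1W) => E1; case: (inW b2 b2W) => E2; case: (inW b3 b3W) => E3; subst;
  (try by rewrite eqxx in b12 b13 b23);
  first [exact: (theta_touch RY RY' iY L1 L2 L3)|exact: (theta_touch RY RY' iY L1 L3 L2)
        |exact: (theta_touch RY RY' iY L2 L1 L3)|exact: (theta_touch RY RY' iY L2 L3 L1)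
        |exact: (theta_touch RY RY' iY L3 L1 L2)|exact: (theta_touch RY RY' iY L3 L2 L1)].
Qed.

Lemma neighbour q : 2 < #|T| -> exists x, F q x.
Proof.
move=> T3; have [//|/existsPn no] := boolP [exists x, F q x]; first by move/existsP.
have [d dq] : exists d, d != q.
  have /set0Pn[d] : [set~ q] != set0 by rewrite -card_gt0 cardsC1; move: T3; nlia.
  by rewrite !inE => dq; exists d.
have /subset_leq_card : [set: T] :\ d \subset [set q].
  apply: F_bi.
  - by rewrite sub1set !inE eq_sym dq.
  - by apply/set0Pn; exists q; rewrite inE.
  - by move=> w y /set1P-> _; rewrite (negbTE (no y)).
by rewrite cards1; have := cardsD1 d [set: T]; rewrite cardsT inE; move: T3; nlia.
Qed.

(** Otherwise all neighbours of [q] lie in [Y], hence outside [Y']. Then removing [q] from [Y'] also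
    removes it from the boundary and adds nothing, leaving one boundary vertex at most, against
    [bd_gt1]. *)
Lemma touch_bd Y Y' q : q \in Y -> q \in Y' -> meets_at Y Y' q -> v \notin Y' -> 2 < #|Y'| ->
  #|bd F Y'| <= 2 -> q \in bd F Y.
Proof.
move=> qY qY' iY vY' Y3 b2; apply/negPn/negP => qb.
have nbY x : F q x -> x \in Y.
  by move=> Fqx; apply/negPn/negP => xY; case/negP: qb; apply/bdP; split=> //; exists x.
have qb' : q \in bd F Y'.
  have [|x Fqx] := @neighbour q; first by apply: leq_trans Y3 (max_card _).
  apply/bdP; split=> //; exists x => //; apply/negP => xY'.
  by have := iY x (nbY x Fqx) xY' => xq; rewrite xq F_irr in Fqx.
have : 1 < #|bd F (Y' :\ q)|.
  by apply: bd_gt1; rewrite ?inE ?(negbTE vY') ?andbF //; move: Y3; rewrite (cardsD1 q) qY'.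
apply/negP; rewrite -leqNgt -ltnS; apply: leq_trans _ b2.
rewrite [leqRHS](cardsD1 q) qb' add1n ltnS; apply: subset_leq_card.
apply/subsetP => u /bdP[/setD1P[uq uY'] [x]]; rewrite !inE negb_and negbK => xY Fux.
rewrite uq uY' /=; have [xq|xq] := eqVneq x q.
  by case/negP: uq; apply/eqP/iY => //; apply: nbY; rewrite -xq F_sym.
by apply/existsP; exists x; rewrite Fux andbT; move: xY; rewrite (negbTE xq).
Qed.

Lemma good_exists z : v != z -> 5 <= #|Nv| ->
    (forall w, w != v -> w != z -> 2 * k + 6 <= deg F [set: T] w) ->
  good_cycles.
Proof.
move=> vz N5 dg.
(* At most three neighbours are given up, so 2k + 6 falls to 2k + 3. *)
have dgU (R : {set T}) U w : (forall y, y \notin U -> F w y -> y \in R) -> #|R| <= 3 ->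
    w != v -> w != z -> 2 * k + 3 <= deg F U w.
  move=> UR R3 wv wz; have := dg w wv wz.
  have : deg F [set: T] w <= deg F U w + #|R|.
    apply: leq_trans (leq_add (leqnn _) (deg_le F R w)).
    by apply: deg_cover => y _ Fwy; case yU: (y \in U) => //=; apply: UR; rewrite ?yU.
  by move: R3; nlia.
have U0 (R : {set T}) U : (forall y, y \notin U -> F v y -> y \in R) -> #|R| <= 3 ->
    U :\ v != set0.
  move=> UR R3; apply/negP => /eqP U0.
  have /subset_leq_card : Nv \subset R.
    apply/subsetP => y yN; have Fvy : F v y by rewrite -NvP.
    apply: UR => //; apply/negP => yU; have := in_set0 y; rewrite -U0 !inE yU andbT.
    by move/negbFE/eqP => yv; rewrite yv F_irr in Fvy.
  by move: N5 R3; nlia.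
have [||w|//|[L1 L1U LL1]] := find_lump (U := [set~ z]).
- by rewrite !inE.
- apply: (U0 [set z]); last by rewrite cards1.
  by move=> y; rewrite !inE negbK.
- rewrite !inE => wz wv; apply: (dgU [set z]); rewrite ?cards1 //.
  by move=> y; rewrite !inE negbK.
have vL1 : v \notin L1 by apply/negP => /(subsetP L1U); rewrite !inE eqxx.
have [|[Y0 [LY0 vY0 bY0]]] := fan_or_sep vL1.
  case=> S1 [a1 [b1 [S2 [a2 [b2 [S3 [a3 [b3 [H1 H2 H3 [d1 d2 d3]]]]]]]]]].
  exact: (fan_lump LL1 vL1 H1 H2 H3).
pose P (Y : {set T}) := [&& L1 \subset Y, v \notin Y & #|bd F Y| <= 2].
have PY0 : P Y0 by apply/and3P.
case: (arg_maxnP (fun Y : {set T} => #|Y|) PY0) => Y /and3P[LY vY bY] maxY.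
have ext B : Y \subset B -> v \notin B -> #|bd F B| <= 2 -> B \subset Y.
  move=> YB vB bB; have := maxY B; rewrite /P (subset_trans LY YB) vB bB => /(_ isT) le.
  by have /eqP-> : Y == B by rewrite eqEcard YB.
have Y2 : 2 < #|Y| by case: LL1 => L3 _; apply: leq_trans L3 (subset_leq_card LY).
have bd2 B : v \notin B -> 2 < #|B| -> #|bd F B| <= 2 -> exists s t, s != t /\ bd F B = [set s; t].
  by move=> vB B2 bB; apply/cards2P; rewrite eqn_leq bB bd_gt1 // ltnW.
have [s [t [st Est]]] := bd2 Y vY Y2 bY.
have Rc : #|z |: bd F Y| <= 3.
  by apply: leq_trans (leq_card_setU _ _) _; rewrite cards1.
(* From outside, only [bd F Y] is visible in [Y]; deleting [z] and all of [Y] costs a vertex at most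
   three neighbours. *)
have YR w y : w \notin Y -> y \notin ~: (z |: Y) -> F w y -> y \in z |: bd F Y.
  move=> wY; rewrite !inE negbK => /orP[->//|yY] Fwy; apply/orP; right.
  by rewrite yY; apply/existsP; exists w; rewrite wY F_sym.
have [||w|//|[L2 L2U LL2]] := find_lump (U := ~: (z |: Y)).
- by rewrite !inE negb_or vz.
- exact: (U0 (z |: bd F Y) _ (YR v ^~ vY)).
- rewrite !inE negb_or => /andP[wz wY] wv.
  exact: (dgU (z |: bd F Y) _ _ (fun y => YR w y wY)).
have vL2 : v \notin L2 by apply/negP => /(subsetP L2U); rewrite !inE eqxx.
have [|[Y' [LY' vY' bY']]] := fan_or_sep vL2.
  case=> S1 [a1 [b1 [S2 [a2 [b2 [S3 [a3 [b3 [H1 H2 H3 [d1 d2 d3]]]]]]]]]].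
  exact: (fan_lump LL2 vL2 H1 H2 H3).
have Y2' : 2 < #|Y'| by case: LL2 => L3 _; apply: leq_trans L3 (subset_leq_card LY').
have [s' [t' [st' Est']]] := bd2 Y' vY' Y2' bY'.
(* [L2] lies in [Y'] outside [Y], so the union would contradict the maximality of [Y]. *)
have bU : 2 < #|bd F (Y :|: Y')|.
  rewrite ltnNge; apply/negP => bU.
  have /subsetP sub : Y :|: Y' \subset Y.
    by apply: ext; rewrite ?subsetUl // inE negb_or vY.
  have /set0Pn[u uL] : L2 != set0 by case: LL2 => L3 _; rewrite -card_gt0; apply: leq_trans L3.
  have := subsetP L2U u uL; rewrite !inE negb_or sub ?andbF //.
  by rewrite inE (subsetP LY' u uL) orbT.
(* By submodularity at most 4 - 3 = 1 boundary vertex is left for the intersection. *)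
have I1 : #|Y :&: Y'| <= 1.
  rewrite leqNgt; apply/negP => /(bd_gt1 _); rewrite inE (negbTE vY) => /(_ isT).
  by move: (bd_submod Y Y') bU bY bY'; nlia.
have Ibd : Y :&: Y' \subset bd F Y :&: bd F Y'.
  apply/subsetP => q /[dup] qI /setIP[qY qY'].
  have iY : meets_at Y Y' q by move=> u uY uY'; move/card_le1_eqP: I1; apply; rewrite // inE uY.
  by rewrite inE (touch_bd qY qY' iY) // (touch_bd qY' qY (meets_at_sym iY)).
have vW : v \notin bd F Y :|: bd F Y'.
  rewrite inE negb_or; apply/andP; split; last by apply: contra vY' => /(subsetP (bd_sub F Y')).
  by apply: contra vY => /(subsetP (bd_sub F Y)).
have [|[B [WB vB bB]]] := fan_or_sep vW.
  case=> S1 [a1 [b1 [S2 [a2 [b2 [S3 [a3 [b3 [H1 H2 H3 [d1 d2 d3]]]]]]]]]].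
  move/disjoint_apart: d3; move/disjoint_apart: d2; move/disjoint_apart: d1 => d1 d2 d3.
  exact: (two_rich (lump_rich vY LY LL1 st Est) (lump_rich vY' LY' LL2 st' Est') I1 Ibd H1 H2 H3).
move: WB; rewrite subUset => /andP[/subsetP WB /subsetP WB'].
(* Uniting [B] with [Y] creates no boundary beyond that of [B], so [Y] contains [B] by maximality.
   Then both vertices of [bd F Y'] lie in an intersection of at most one vertex. *)
have /subsetP sub : B :|: Y \subset Y.
  apply: ext; rewrite ?subsetUr ?inE ?negb_or ?vB //; apply: leq_trans bB.
  apply: subset_leq_card; apply/subsetP => u /bdP[uBY [x]].
  rewrite in_setU negb_or => /andP[xB xY] Fux; apply/bdP; split; last by exists x.
  by case/setUP: uBY => // uY; apply: WB; apply/bdP; split=> //; exists x.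
have : 1 < #|bd F Y'| by rewrite Est' cards2 st'.
rewrite ltnNge; case/negP; apply: leq_trans I1; apply: subset_leq_card; apply/subsetP => u ub.
by rewrite inE sub ?inE ?(WB' u ub) // (subsetP (bd_sub F Y')).
Qed.

End Graph.

(** * Translation into the cycles of the theorem *)

Lemma k_connected2_conn (T : finType) (F : rel T) d : k_connected F 2 -> connected F ([set: T] :\ d).
Proof.
case=> _ /(_ [set d]); rewrite cards1 => /(_ isT) H A /subsetP AS /set0Pn[a aA] cA.
apply/subsetP => y; rewrite !inE andbT => yd; have := AS a aA; rewrite !inE andbT => ad.
have := H a y; rewrite !inE => /(_ ad yd)/connectP[p]; elim: p a aA {ad} => [|c p IH] a aA /=.
  by move=> _ ->.
case/andP=> /and3P[_ cd Fac] pp; apply: IH => //; apply: (cA a) => //.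
by move: cd; rewrite !inE andbT.
Qed.

Lemma next_at_last (T : eqType) (y0 x : T) s : uniq (x :: s) -> next_at (last x s) y0 x s = y0.
Proof.
elim: s x => [|c s IH] x /=; first by rewrite eqxx.
move=> /andP[xs us]; rewrite IH //; case: eqP => // E; case/negP: xs.
by rewrite -E mem_last.
Qed.

Lemma cycle_of_path (T : finType) (F : rel T) (v x y : T) s : symmetric F ->
    F v x -> F v y -> x != y -> path F x s -> last x s = y -> uniq (v :: x :: s) ->
  [/\ is_cycle F (v :: x :: s), cycle_edge (v :: x :: s) v x & cycle_edge (v :: x :: s) v y].
Proof.
move=> F_sym Fvx Fvy xy ps ls us; split.
- rewrite /is_cycle /ucycleb us andbT /= Fvx rcons_path ps ls F_sym Fvy !andbT.
  by case: s ls {ps us} => [/= E|//]; rewrite E eqxx in xy.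
- by rewrite /cycle_edge /= !inE !eqxx.
- rewrite /cycle_edge; apply/orP; right; rewrite -ls inE mem_last orbT.
  by apply/eqP; exact: (@next_at_last _ v v (x :: s) us).
Qed.

Theorem lemma4p6 (p : nat) (hp8 : 8 <= p) (hp_even : ~~ odd p)
    (T : finType) (F : rel T) (hF : simple_graph F) (hF2 : k_connected F 2)
    (v z : T) (hvz : v != z) (hv : 5 <= degree F v)
    (hdeg : forall w : T, w != v -> w != z -> p <= degree F w) :
  exists x y : T,
    [/\ x \in nbhd F v, y \in nbhd F v, x != y &
      exists l : nat, ~~ odd l /\
        exists D : nat -> seq T,
          forall i : nat, i <= (p - 8) %/ 2 ->
            [/\ is_cycle F (D i), cycle_edge (D i) v x, cycle_edge (D i) v y &
                size (D i) = l + 2 * i]].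
Proof.
have [F_sym F_irr] := hF.
(* Here (p - 8) / 2 = k - 1, so i takes exactly k values. *)
have [k k_gt0 Ep] : exists2 k, 0 < k & p = 2 * k + 6.
  by exists (p - 6)./2; move: hp8 hp_even; nlia.
have Nv5 : 5 <= #|nbr_set F [set v]|.
  by rewrite (_ : nbr_set F [set v] = nbhd F v) //; apply/setP => w; rewrite nbr_set1 inE F_sym.
have dg w : w != v -> w != z -> 2 * k + 6 <= deg F [set: T] w.
  move=> wv wz; have := hdeg w wv wz; rewrite Ep /deg => /leq_trans; apply.
  by apply: subset_leq_card; apply/subsetP => y; rewrite !inE.
have [x [y [S [b [Fx Fy xy vS [ob H]]]]]] :=
  good_exists F_sym F_irr k_gt0 (@k_connected2_conn T F ^~ hF2) (leq_trans (isT : 1 < 5) Nv5) hvz Nv5 dg.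
pose P i s := [&& path F x s, last x s == y, uniq (v :: x :: s) & size (v :: x :: s) == b.+1 + 2 * i].
(* The implication allows a choice for every i, so that [xchoose] yields a function on all of
   [nat]. *)
have ex i : exists s, (i < k) ==> P i s.
  have [ik|_] := boolP (i < k); last by exists [::].
  have [s ps [ls us sS szs]] := H i ik; exists s; rewrite /P ps ls eqxx /= addSn eqSS -szs eqxx.
  by move: us => /= ->; rewrite !andbT; apply: contra vS => /sS.
exists x, y; split; rewrite ?inE //; exists b.+1; split; first by rewrite /= negbK.
exists (fun i => v :: x :: xchoose (ex i)) => i ip.
have /implyP/(_ _)/and4P[|ps /eqP ls us /eqP szs] := xchooseP (ex i).
  by move: ip; rewrite Ep; nlia.
by have [H1 H2 H3] := cycle_of_path F_sym Fx Fy xy ps ls us; split.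
Qed.
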